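(* The cluster structure $\mathcal C_{CG}(n)$ (on $\operatorname{Mat}_n$, and on $SL_n$) is regular: every cluster variable in every seed of $\mathcal C_{CG}(n)$ is a regular function (a polynomial in the matrix entries).
   Context: $\mathcal C_{CG}(n)$ on $\operatorname{Mat}_n$ is the cluster structure (skew-symmetric, geometric type, mutations $x_kx_k'=\prod_{b_{ki}>0}x_i^{b_{ki}}+\prod_{b_{ki}<0}x_i^{-b_{ki}}$ with the usual quiver mutation) generated by the following initial seed. For a matrix $A$, $A_{I}^{J}$ is the submatrix with rows $I$ and columns $J$. For $n\times n$ matrices $X,Y$ let $\mathcal X=[X_{[2,n]}\ 0]$ (rows $2..n$ of $X$ then a zero column) and $\mathcal Y=[0\ Y_{[1,n-1]}]$ (a zero column then rows $1..n-1$ of $Y$). Let $k=\lfloor (n+1)/2\rfloor$, $N=k(n-1)$, $M=N$ if $n$ even, $M=N-n+1$ if $n$ odd. $U(X,Y)$ is the $k(n-1)\times(k+1)(n+1)$ block matrix whose $i$-th block row has $\mathcal Y$ in block column $i$ and $\mathcal X$ in block column $i+1$ (block columns of width $n+1$), zeros elsewhere. Extended cluster: $\theta_i(X)=\det X_{[n-i+1,n]}^{[n-i+1,n]}$, $i\in[n]$; $\varphi_p(X,X)$, $p\in[N]$, with $\varphi_p(X,Y)=\det U(X,Y)_{[N-p+1,N]}^{[k(n+1)-p+1,\,k(n+1)]}$; $\psi_q(X,X)$, $q\in[M]$, with $\psi_q(X,Y)=\det U(X,Y)_{[N-q+1,N]}^{[k(n+1)-q+2,\,k(n+1)+1]}$;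 stable variables $\theta_n,\varphi_N,\psi_M$. Each function is placed at the vertex $(i,j)\in[n]\times[n]$ with $x_{ij}$ the upper-left entry of its defining submatrix (a bijection). Quiver $Q_{CG}(n)$: arrows $(i,j+1)\to(i,j)$ ($i\in[n],j\in[n-1]$, except $(1,n-1)$); $(i+1,j)\to(i,j)$ ($i\in[n-1],j\in[n]$, except $(1,1)$); $(i,j)\to(i+1,j+1)$ ($i,j\in[n-1]$); $(n,j)\to(1,j)$, $(1,j)\to(n,j+1)$ ($j\in[2,n-1]$); $(i,n)\to(i+2,1)$, $(i+2,1)\to(i+1,n)$ ($i\in[1,n-2]$). On $SL_n$ one deletes $\theta_n$ and vertex $(1,1)$. *)

(* Defs.v *)
From HB Require Import structures.
From mathcomp Require Import all_boot all_order all_algebra.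
From mathcomp Require Import fraction.
Set Implicit Arguments. Unset Strict Implicit. Unset Printing Implicit Defensive.
Import Order.TTheory GRing.Theory Num.Theory.
Local Open Scope ring_scope.

Notation "x %:F" := (@FracField.tofrac _ x) : ring_scope.

(* The outermost polynomial variable of mpoly K m.+1 is x_m.            *)
Section MPoly.
Variable K : fieldType.

Fixpoint mpoly (m : nat) : idomainType :=
  match m with
  | 0%N => K
  | m'.+1 => ({poly mpoly m'} : idomainType)
  end.

(* the variable x_i (0 if i >= m) *)
Fixpoint mvar (m i : nat) {struct m} : mpoly m :=
  match m return mpoly m with
  | 0%N => 0
  | m'.+1 => if i == m' then ('X : {poly mpoly m'}) else (mvar m' i)%:P
  end.

Fixpoint mconst (m : nat) (a : K) {struct m} : mpoly m :=
  match m return mpoly m with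
  | 0%N => a
  | m'.+1 => (mconst m' a)%:P
  end.

Fixpoint meval (F : fieldType) (c : K -> F) (e : nat -> F) (m : nat) {struct m}
  : mpoly m -> F :=
  match m return mpoly m -> F with
  | 0%N => fun p => c p
  | m'.+1 => fun p =>
      \sum_(i < size (p : {poly mpoly m'})) meval c e (p : {poly mpoly m'})`_i * e m' ^+ i
  end.
End MPoly.

(* A seed is an (extended) exchange matrix B (b_ij = #arrows i->j minus  *)
(* #arrows j->i) together with an extended cluster x : V -> F.          *)
Section Cluster.
Variables (V : finType) (F : fieldType).

Definition intpos (z : int) : int := if 0 <= z then z else 0.

Definition mutB (B : V -> V -> int) (k : V) : V -> V -> int :=
  fun i j => if (i == k) || (j == k) then - B i j
             else B i j + intpos (B i k) * intpos (B k j)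
                        - intpos (- B i k) * intpos (- B k j).

Definition mutx (B : V -> V -> int) (x : V -> F) (k : V) : V -> F :=
  fun i => if i == k then
             ((\prod_(j | 0 < B k j) x j ^+ absz (B k j))
              + (\prod_(j | B k j < 0) x j ^+ absz (B k j))) / x k
           else x i.

Definition seed := ((V -> V -> int) * (V -> F))%type.

Definition mutate (S : seed) (k : V) : seed := (mutB S.1 k, mutx S.1 S.2 k).

Definition mutseq (S : seed) (s : seq V) : seed := foldl mutate S s.
End Cluster.

(* The data of C_CG(n).  All indices below are 0-based unless stated.   *)
Section CGcomb.
Variable n : nat.

Definition kCG : nat := (n.+1)./2.
Definition NCG : nat := (kCG * n.-1)%N.
Definition MCG : nat := if odd n then (NCG - n.-1)%N else NCG.

(* Entry (r,c) (0-based) of U(X,X): Some (i,j) if it is x_ij (0-based),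
   None if it is 0.  Block rows have height n-1, block columns width n+1;
   block row b has calY = [0 Y_[1,n-1]] in block column b and
   calX = [X_[2,n] 0] in block column b+1. *)
Definition Upos (r c : nat) : option (nat * nat) :=
  let bi := (r %/ n.-1)%N in let a := (r %% n.-1)%N in
  let bc := (c %/ n.+1)%N in let d := (c %% n.+1)%N in
  if bc == bi then (if d == 0%N then None else Some (a, d.-1))
  else if bc == bi.+1 then (if d == n then None else Some (a.+1, d))
  else None.

Inductive cgidx := Theta of nat | Phi of nat | Psi of nat.

(* 0-based position of the upper-left entry of the defining submatrix *)
Definition place (f : cgidx) : option (nat * nat) :=
  match f with
  | Theta i => Some ((n - i)%N, (n - i)%N)
  | Phi p => Upos (NCG - p) (kCG * n.+1 - p)
  | Psi q => Upos (NCG - q) (kCG * n.+1 - q + 1)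
  end.

Definition cgidxs : seq cgidx :=
  map Theta (iota 1 n) ++ map Phi (iota 1 NCG) ++ map Psi (iota 1 MCG).

Definition fun_at (i j : nat) : option cgidx :=
  ohead [seq f <- cgidxs | place f == Some (i, j)].

Definition frozenMat (i j : nat) : bool :=
  [|| place (Theta n) == Some (i, j), place (Phi NCG) == Some (i, j)
    | (0 < MCG)%N && (place (Psi MCG) == Some (i, j))].

(* on SL_n theta_n is deleted *)
Definition frozenSL (i j : nat) : bool :=
  (place (Phi NCG) == Some (i, j))
  || (0 < MCG)%N && (place (Psi MCG) == Some (i, j)).

(* number of arrows (i1,j1) -> (i2,j2) of Q_CG(n), 1-based coordinates *)
Definition narr (i1 j1 i2 j2 : nat) : nat :=
  [&& i1 == i2, j1 == j2.+1, (1 <= i2 <= n)%N, (1 <= j2 <= n.-1)%N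
    & ~~ ((i2 == 1%N) && (j2 == n.-1))]
  + [&& i1 == i2.+1, j1 == j2, (1 <= i2 <= n.-1)%N, (1 <= j2 <= n)%N
    & ~~ ((i2 == 1%N) && (j2 == 1%N))]
  + [&& i2 == i1.+1, j2 == j1.+1, (1 <= i1 <= n.-1)%N & (1 <= j1 <= n.-1)%N]
  + [&& i1 == n, i2 == 1%N, j1 == j2 & (2 <= j1 <= n.-1)%N]
  + [&& i1 == 1%N, i2 == n, j2 == j1.+1 & (2 <= j1 <= n.-1)%N]
  + [&& j1 == n, j2 == 1%N, i2 == i1.+2 & (1 <= i1 <= n.-2)%N]
  + [&& j1 == 1%N, j2 == n, i1 == i2.+1 & (2 <= i2 <= n.-1)%N].

Definition vtx := ('I_n * 'I_n)%type.

Definition BMat (u v : vtx) : int :=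
  (narr u.1.+1 u.2.+1 v.1.+1 v.2.+1)%:Z - (narr v.1.+1 v.2.+1 u.1.+1 u.2.+1)%:Z.

Definition vtxSL := {v : vtx | (nat_of_ord v.1, nat_of_ord v.2) != (0, 0)%N}.

Definition BSL (u v : vtxSL) : int := BMat (val u) (val v).
End CGcomb.

Section CGfun.
Variables (K : fieldType) (n : nat).

Definition RCG := mpoly K (n * n).

Definition xg (i j : nat) : RCG := mvar K (n * n) (i * n + j).

Definition Uent (r c : nat) : RCG :=
  match Upos n r c with Some (i, j) => xg i j | None => 0 end.

Definition minorU (r0 c0 p : nat) : RCG :=
  \det (\matrix_(a < p, b < p) Uent (r0 + a) (c0 + b)).

Definition cgfun (f : cgidx) : RCG :=
  match f with
  | Theta i => \det (\matrix_(a < i, b < i) xg (n - i + a) (n - i + b))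
  | Phi p => minorU (NCG n - p) (kCG n * n.+1 - p) p
  | Psi q => minorU (NCG n - q) (kCG n * n.+1 - q + 1) q
  end.

Definition x0Mat (v : vtx n) : {fraction RCG} :=
  match fun_at n v.1 v.2 with Some f => (cgfun f)%:F | None => 0 end.

Definition seedMat : seed (vtx n) {fraction RCG} := (@BMat n, x0Mat).

(* --- SL_n.  C(SL_n) is identified with the rational function field in
   the x_ij, (i,j) <> (1,1), via the birational chart of SL_n obtained by
   solving det X = 1 for x_11 (cofactor expansion along the first row);
   restriction of functions K[Mat_n] -> K[SL_n] -> C(SL_n) then becomes
   the substitution sigmaSL below, and K[SL_n] is its image. --- *)

Definition cof0 (j : nat) : RCG :=
  (-1) ^+ j * \det (\matrix_(a < n.-1, b < n.-1) xg a.+1 (bump j b)).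

Definition sub11 : {fraction RCG} :=
  (1 - \sum_(1 <= j < n) (xg 0 j)%:F * (cof0 j)%:F) / (cof0 0)%:F.

Definition sigmaSL (p : RCG) : {fraction RCG} :=
  meval (fun a => (@mconst K (n * n) a)%:F)
        (fun i => if i == 0%N then sub11 else (mvar K (n * n) i)%:F) p.

Definition x0SL (v : vtxSL n) : {fraction RCG} :=
  match fun_at n (val v).1 (val v).2 with
  | Some f => sigmaSL (cgfun f) | None => 0 end.

Definition seedSL : seed (vtxSL n) {fraction RCG} := (@BSL n, x0SL).
End CGfun.

(* Main.v *)
Require Import Defs.
From HB Require Import structures.
From mathcomp Require Import all_boot all_order all_algebra all_fingroup.
From mathcomp Require Import fraction.
From mathcomp Require Import ring lra zify.
From Stdlib Require Import FunctionalExtensionality.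

(* A seed with values in a domain whose variables are pairwise coprime and coprime to
   their first mutations has all its cluster variables in that domain: by the Laurent
   phenomenon at the seed and at its neighbours, the denominators of a cluster variable
   involve only the f_j, and each f_k may be traded for its mutation f'_k.  Coprimality
   is taken in the sense that b is a nonzerodivisor modulo a, so that no unique
   factorization is needed.

   The initial seed consists of three chains theta, phi, psi of minors, and every
   exchange relation, up to a common factor, says that the minor f11 of a matrix divides
   f10 f01 f22 + f12 f21 f00, where f_rc denotes the contiguous minor starting at (r,c):
   this follows from the Desnanot-Jacobi identity.  For suitable weights of the matrix
   entries the leading form of each contiguous minor of U(X,X) is the product of its
   diagonal.  The diagonals of the three chains involve disjoint sets of variables,
   whence coprimality across chains; inside a chain it follows from the relation
   g_p g'_p = alpha_p g_(p-1) + beta_p g_(p+1).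

   Finally there is a matrix of determinant 1 at which all initial functions, hence all
   cluster variables, are positive.  Therefore no cluster variable vanishes on SL_n, and
   mutation commutes with the restriction to SL_n. *)

Set Implicit Arguments. Unset Strict Implicit. Unset Printing Implicit Defensive.
Import Order.TTheory GRing.Theory Num.Theory.
Local Open Scope ring_scope.

(** * Coprimality and condensation *)

(** The proof of the Laurent phenomenon needs coprime exchange polynomials, hence linearly
    independent mutable rows of the exchange matrix. Instead of computing the rank of the quiver, a
    seed is first given principal coefficients, for which independence is immediate, and the new
    variables are set to 1 afterwards. This substitution is not defined on all fractions; along
    mutations it is legitimate because all values stay positive at one point. Only mutable variables
    are ever inverted, so stable variables cause no denominators.

    Inside a chain the leading monomial of [g_a] divides that of [g_b] for [a < b], so leading forms
    alone cannot separate the two. Modulo [g_a] a multiple of [g_b] is a continuant times [g_(a+1)],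
    and the leading monomial of this continuant avoids the variables of [g_a].

    The matrices fed to the condensation identity are completed by extra rows or columns, chosen so
    that all seven minors factor into initial functions and a minor that cancels.

    The positive point has entries [T^w], with [w] the weights and [T] a large integer, so that
    leading monomials decide the signs; it is rescaled by an n-th root of its determinant. *)

Section Coprime.
Variable R : idomainType.
Implicit Types a b c d : R.

Definition rdvd a b := exists q, b = a * q.

(* In a unique factorization domain this says that [a] and [b] have no common factor. *)
Definition cop a b := forall c, rdvd a (b * c) -> rdvd a c.

Lemma rdvdMr a b c : rdvd a b -> rdvd a (b * c).
Proof. by case=> q ->; exists (q * c); rewrite mulrA. Qed.

Lemma rdvdMl a b c : rdvd a b -> rdvd a (c * b).
Proof. by rewrite mulrC; apply: rdvdMr. Qed.

Lemma rdvdD a b c : rdvd a b -> rdvd a c -> rdvd a (b + c).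
Proof. by case=> q -> [q' ->]; exists (q + q'); rewrite mulrDr. Qed.

Lemma rdvdN a b : rdvd a b -> rdvd a (- b).
Proof. by case=> q ->; exists (- q); rewrite mulrN. Qed.

Lemma rdvdB a b c : rdvd a b -> rdvd a c -> rdvd a (b - c).
Proof. by move=> h1 h2; apply: rdvdD => //; apply: rdvdN. Qed.

Lemma rdvd_refl a : rdvd a a.
Proof. by exists 1; rewrite mulr1. Qed.

Lemma rdvd_mull a b : rdvd a (a * b).
Proof. by exists b. Qed.

Lemma copC a b : a != 0 -> cop a b -> cop b a.
Proof.
move=> a0 h c [d e].
have [q dE] : rdvd a d by apply: h; exists c; rewrite e.
by exists q; apply: (mulfI a0); rewrite e dE mulrCA.
Qed.

Lemma copMr a b c : cop a b -> cop a c -> cop a (b * c).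
Proof. by move=> hb hc x; rewrite -mulrA => /hb /hc. Qed.

Lemma copXr a b n : cop a b -> cop a (b ^+ n).
Proof.
move=> h; elim: n => [|n IH]; first by move=> c; rewrite expr0 mul1r.
by rewrite exprS; apply: copMr.
Qed.

Lemma copr1 a : cop a 1.
Proof. by move=> c; rewrite mul1r. Qed.

Lemma cop1r a : cop 1 a.
Proof. by move=> c _; exists c; rewrite mul1r. Qed.

Lemma copNr a b : cop a b -> cop a (- b).
Proof. by move=> h c [q e]; apply: h; exists (- q); rewrite mulrN -e mulNr opprK. Qed.

Lemma cop_prodr (I : Type) (r : seq I) (P : pred I) a (F : I -> R) :
  (forall i, P i -> cop a (F i)) -> cop a (\prod_(i <- r | P i) F i).
Proof.
move=> h; elim/big_rec: _ => [|i x Pi hx]; first exact: copr1.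
by apply: copMr => //; apply: h.
Qed.

Lemma copMl a b c : a != 0 -> b != 0 -> cop a c -> cop b c -> cop (a * b) c.
Proof.
move=> a0 b0 ha hb x [q e].
have [y xE] : rdvd a x by apply: ha; exists (b * q); rewrite e mulrA.
have [w yE] : rdvd b y.
  by apply: hb; exists q; apply: (mulfI a0); rewrite [RHS]mulrA -e xE mulrCA.
by exists w; rewrite xE yE mulrA.
Qed.

Lemma copXl a b n : a != 0 -> cop a b -> cop (a ^+ n) b.
Proof.
move=> a0 h; elim: n => [|n IH]; first by rewrite expr0; apply: cop1r.
by rewrite exprS; apply: copMl => //; rewrite expf_neq0.
Qed.

(** Lets a complicated second argument be traded, modulo the first, for a monomial or for one term
    of an exchange relation. *)
Lemma cop_eqmod a b b' : rdvd a (b - b') -> cop a b' -> cop a b.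
Proof.
move=> h hb c hc; apply: hb.
have -> : b' * c = b * c - (b - b') * c by ring.
by apply: rdvdB => //; apply: rdvdMr.
Qed.

Lemma cop_factorr a b c : cop a (b * c) -> cop a c.
Proof.
move=> h x hx; apply: h; rewrite -mulrA; exact: rdvdMl.
Qed.

End Coprime.

Section Condensation.
Variable R : comNzRingType.

Definition mn (M : nat -> nat -> R) (r c p : nat) : R :=
  \det (\matrix_(a < p, b < p) M (r + a)%N (c + b)%N).

Lemma eq_mn (M M' : nat -> nat -> R) r c r' c' p :
  (forall a b, (a < p)%N -> (b < p)%N -> M (r + a)%N (c + b)%N = M' (r' + a)%N (c' + b)%N) ->
  mn M r c p = mn M' r' c' p.
Proof. by move=> h; congr (\det _); apply/matrixP=> a b; rewrite !mxE h. Qed.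

Lemma mn0 M r c : mn M r c 0 = 1.
Proof. exact: det_mx00. Qed.

Lemma mn_lblock M r c p q :
  (forall a b, (a < p)%N -> (b < q)%N -> M (r + a)%N (c + (p + b))%N = 0) ->
  mn M r c (p + q) = mn M r c p * mn M (r + p) (c + p) q.
Proof.
move=> h; rewrite /mn.
rewrite -(submxK (\matrix_(a < p + q, b < p + q) M (r + a)%N (c + b)%N)).
rewrite [ursubmx _](_ : _ = 0) ?det_lblock; last first.
  by apply/matrixP=> a b; rewrite !mxE /= h.
by congr (_ * _); congr (\det _); apply/matrixP=> a b; rewrite !mxE /= ?addnA.
Qed.

Lemma mn_ublock M r c p q :
  (forall a b, (a < q)%N -> (b < p)%N -> M (r + (p + a))%N (c + b)%N = 0) ->
  mn M r c (p + q) = mn M r c p * mn M (r + p) (c + p) q.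
Proof.
move=> h; rewrite /mn.
rewrite -(submxK (\matrix_(a < p + q, b < p + q) M (r + a)%N (c + b)%N)).
rewrite [dlsubmx _](_ : _ = 0) ?det_ublock; last first.
  by apply/matrixP=> a b; rewrite !mxE /= h.
by congr (_ * _); congr (\det _); apply/matrixP=> a b; rewrite !mxE /= ?addnA.
Qed.

(** Division-free Schur complement: multiplying on the right by the block matrix with rows
    [(det G, 0)] and [(- adj G * C, 1)] clears the lower left block, so that [G] need not be
    invertible. *)
Lemma schur_det m k (A : 'M[R]_k) (B : 'M_(k, m)) (C : 'M_(m, k)) (G : 'M_m) :
  \det (block_mx A B C G) * \det G ^+ k =
  \det (\det G *: A - B *m \adj G *m C) * \det G.
Proof.
have := det_mulmx (block_mx A B C G) (block_mx (\det G)%:M 0 (- (\adj G *m C)) 1%:M).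
rewrite mulmx_block !mulmx0 !mulmx1 add0r add0r.
rewrite det_lblock det_scalar det1 mulr1 => <-.
rewrite !mulmxN !mulmxA mul_mx_adj !mul_mx_scalar mul_scalar_mx subrr.
by rewrite det_ublock.
Qed.

End Condensation.

(** * Condensation of contiguous minors *)

Section Hexagon.
Variable R : idomainType.

Lemma det2 (A : 'M[R]_2) :
  \det A = A ord0 ord0 * A ord_max ord_max - A ord0 ord_max * A ord_max ord0.
Proof.
rewrite (expand_det_row _ ord0) !big_ord_recl big_ord0 addr0 /cofactor !det_mx11 !mxE.
have -> : lift ord0 ord0 = ord_max :> 'I_2 by apply: val_inj.
have -> : lift ord_max ord0 = ord0 :> 'I_2 by apply: val_inj.
by rewrite /= expr0 expr1 mul1r mulN1r mulrN.
Qed.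

(* Desnanot-Jacobi; [b] selects rows, [d] columns of the border of the core [G]. *)
Lemma desnanot_jacobi m (A : 'M[R]_2) (B : 'M_(2, m)) (C : 'M_(m, 2)) (G : 'M_m) :
  let h i j := \det (block_mx (A i j)%:M (row i B) (col j C) G) in
  \det G != 0 ->
  \det G * \det (block_mx A B C G) =
    h ord0 ord0 * h ord_max ord_max - h ord0 ord_max * h ord_max ord0.
Proof.
move=> h g0.
have hE i j : h i j = (\det G *: A - B *m \adj G *m C) i j.
  apply: (mulIf g0); rewrite /h -[X in _ * X]expr1 schur_det.
  congr (_ * _); rewrite det_mx11 -row_mul !mxE /= mulr1n; congr (_ - _).
  by apply: eq_bigr => x _; rewrite !mxE.
have := schur_det A B C G.
rewrite expr2 mulrA => /(mulIf g0); rewrite [_ * \det G]mulrC => ->.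
by rewrite !hE det2.
Qed.

Definition lastfirst (p a : nat) := if a is a'.+1 then a' else p.

(** Moving the last row to the top is a cycle of sign [(-1)^p]; both expansions run along the moved
    row and meet the same cofactor minors. *)
Lemma det_lastrow p (F : nat -> nat -> R) :
  \det (\matrix_(a < p.+1, b < p.+1) F a b) =
  (-1) ^+ p * \det (\matrix_(a < p.+1, b < p.+1) F (lastfirst p a) b).
Proof.
rewrite (expand_det_row _ ord_max) [in RHS](expand_det_row _ ord0) mulr_sumr.
apply: eq_bigr => j _; rewrite !mxE /= /cofactor /= add0n exprD mulrCA !mulrA.
congr (_ * _); first by rewrite mulrAC.
congr (\det _); apply/matrixP => a b; rewrite !mxE /=.
by rewrite /bump leqNgt ltn_ord add0n.
Qed.

Lemma det_lastcol p (F : nat -> nat -> R) :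
  \det (\matrix_(a < p.+1, b < p.+1) F a b) =
  (-1) ^+ p * \det (\matrix_(a < p.+1, b < p.+1) F a (lastfirst p b)).
Proof.
rewrite -det_tr -[in RHS]det_tr.
have trE (G : nat -> nat -> R) : (\matrix_(a < p.+1, b < p.+1) G a b)^T =
    \matrix_(a < p.+1, b < p.+1) G b a by apply/matrixP => a b; rewrite !mxE.
by rewrite (trE F) (trE (fun a b => F a (lastfirst p b))) (det_lastrow p (fun a b => F b a)).
Qed.

Section HexagonIdentity.
Variables (M : nat -> nat -> R) (m : nat).

(** Index lists of the core [2, ..., m + 1] preceded by one border index ([border1]) or by two
    ([border2]); the border indices used below are [0], [1] and [m + 2]. *)
Definition border1 (r a : nat) := if a is a'.+1 then a'.+2 else r.
Definition border2 (r r' a : nat) :=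
  match a with 0%N => r | 1%N => r' | a'.+2 => a'.+2 end.

Let bd r c := \det (\matrix_(a < m.+1, b < m.+1) M (border1 r a) (border1 c b)).
Let bd2 r r' c c' :=
  \det (\matrix_(a < m.+2, b < m.+2) M (border2 r r' a) (border2 c c' b)).

Lemma border_DJ r r' c c' : mn M 2 2 m != 0 ->
  mn M 2 2 m * bd2 r r' c c' = bd r c * bd r' c' - bd r c' * bd r' c.
Proof.
move=> g0.
pose X : 'M_(2 + m) := \matrix_(a, b) M (border2 r r' a) (border2 c c' b).
have := @desnanot_jacobi m (ulsubmx X) (ursubmx X) (dlsubmx X) (drsubmx X).
rewrite /= submxK.
have -> : drsubmx X = \matrix_(a < m, b < m) M (2 + a)%N (2 + b)%N.
  by apply/matrixP => a b; rewrite !mxE.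
move=> /(_ g0); rewrite -/(mn M 2 2 m) => ->.
have hE (i j : 'I_2) : \det (block_mx (ulsubmx X i j)%:M (row i (ursubmx X))
    (col j (dlsubmx X)) (\matrix_(a < m, b < m) M (2 + a)%N (2 + b)%N)) =
    bd (border2 r r' i) (border2 c c' j).
  congr (\det _); apply/matrixP => a b.
  rewrite -[a](@splitK 1 m) -[b](@splitK 1 m).
  case: (@split 1 m a) => a'; case: (@split 1 m b) => b' /=.
  - by rewrite block_mxEul !mxE /= !ord1 mulr1n.
  - by rewrite block_mxEur !mxE /= !ord1.
  - by rewrite block_mxEdl !mxE /= !ord1.
  - by rewrite block_mxEdr !mxE.
by rewrite !hE.
Qed.

(* Write [h r c] for the core minor bordered by row [r] and column [c]; times the
   core minor every 2-bordered minor is a 2x2 determinant in the [h r c], and the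
   terms not divisible by [h 1 1] cancel. *)
Lemma hexagon : mn M 2 2 m != 0 ->
  rdvd (mn M 1 1 m.+1)
      (mn M 1 0 m.+2 * mn M 0 1 m.+2 * mn M 2 2 m +
       mn M 1 2 m.+1 * mn M 2 1 m.+1 * mn M 0 0 m.+2).
Proof.
move=> g0.
have F : mn M 1 1 m.+1 = bd 1 1.
  by congr (\det _); apply/matrixP => [[[|a] la] [[|b] lb]]; rewrite !mxE.
have NW : mn M 0 0 m.+2 = bd2 0 1 0 1.
  by congr (\det _); apply/matrixP => [[[|[|a]] la] [[|[|b]] lb]]; rewrite !mxE.
(* In the four off-diagonal minors the border index [m + 2] comes last and has to be moved to the
   front. The resulting signs occur in pairs in the two products and cancel. *)
have E : mn M 1 2 m.+1 = (-1) ^+ m * bd 1 m.+2.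
  rewrite /mn (det_lastcol m (fun a b => M (1 + a)%N (2 + b)%N)); congr (_ * \det _).
  by apply/matrixP => [[[|a] la] [[|b] lb]]; rewrite !mxE.
have S : mn M 2 1 m.+1 = (-1) ^+ m * bd m.+2 1.
  rewrite /mn (det_lastrow m (fun a b => M (2 + a)%N (1 + b)%N)); congr (_ * \det _).
  by apply/matrixP => [[[|a] la] [[|b] lb]]; rewrite !mxE.
have N : mn M 0 1 m.+2 = (-1) ^+ m.+1 * bd2 0 1 m.+2 1.
  rewrite /mn (det_lastcol m.+1 (fun a b => M (0 + a)%N (1 + b)%N)); congr (_ * \det _).
  by apply/matrixP => [[[|[|a]] la] [[|[|b]] lb]]; rewrite !mxE.
have W : mn M 1 0 m.+2 = (-1) ^+ m.+1 * bd2 m.+2 1 0 1.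
  rewrite /mn (det_lastrow m.+1 (fun a b => M (1 + a)%N (0 + b)%N)); congr (_ * \det _).
  by apply/matrixP => [[[|[|a]] la] [[|[|b]] lb]]; rewrite !mxE.
exists (bd m.+2 0 * bd2 0 1 m.+2 1 + bd m.+2 1 * bd2 0 1 0 m.+2).
rewrite F NW E S N W.
have sq k : (-1) ^+ k * (-1) ^+ k = 1 :> R by rewrite -expr2 sqrr_sign.
set g := mn M 2 2 m in g0 *.
apply: (mulfI g0).
transitivity ((-1) ^+ m.+1 * (-1) ^+ m.+1 * (g * bd2 m.+2 1 0 1) * (g * bd2 0 1 m.+2 1)
  + (-1) ^+ m * (-1) ^+ m * bd 1 m.+2 * bd m.+2 1 * (g * bd2 0 1 0 1)); first by ring.
transitivity (bd 1 1 * (bd m.+2 0 * (g * bd2 0 1 m.+2 1) + bd m.+2 1 * (g * bd2 0 1 0 m.+2)));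
  last by ring.
by rewrite !border_DJ // !sq; ring.
Qed.

End HexagonIdentity.
End Hexagon.

(** * Multivariate polynomials and leading forms *)

Section MPolyHom.
Variable K : fieldType.

Fixpoint mconst_rmorphism m : {rmorphism K -> mpoly K m} :=
  match m return {rmorphism K -> mpoly K m} with
  | 0%N => (idfun : {rmorphism K -> K})
  | m'.+1 => ((polyC \o mconst_rmorphism m') : {rmorphism K -> {poly mpoly K m'}})
  end.

Lemma mconst_rmorphismE m a : mconst_rmorphism m a = mconst m a.
Proof. by elim: m => //= m ->. Qed.

Lemma mvarE m : mvar K m.+1 m = 'X :> {poly mpoly K m}.
Proof. by rewrite /= eqxx. Qed.

Lemma mvar_lt m i : (i < m)%N -> mvar K m.+1 i = (mvar K m i)%:P :> {poly mpoly K m}.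
Proof. by move=> lim; rewrite /= ltn_eqF. Qed.

(** Generation by constants and variables; most later arguments use this induction and ignore the
    nesting of univariate polynomial rings. *)
Lemma mpoly_ind m (P : mpoly K m -> Prop) :
  (forall a, P (mconst m a)) -> (forall i, (i < m)%N -> P (mvar K m i)) ->
  (forall p q, P p -> P q -> P (p + q)) -> (forall p q, P p -> P q -> P (p * q)) ->
  forall p, P p.
Proof.
elim: m P => [|m IH] P Pc Pv PD PM; first by move=> a; apply: Pc.
have PC (c : mpoly K m) : P (c%:P : {poly mpoly K m}).
  elim/IH: c => [a|i lim|c d Pc' Pd|c d Pc' Pd].
  - exact: (Pc a).
  - by have := Pv i (ltnW lim); rewrite mvar_lt.
  - by rewrite polyCD; apply: PD.
  - by rewrite polyCM; apply: PM.
move=> p; elim/poly_ind: (p : {poly mpoly K m}) => [|q c Pq]; first exact: (PC 0).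
apply: PD => //; apply: PM => //.
by have := Pv m (ltnSn m); rewrite mvarE.
Qed.

Section Hom.
Variables (S : comNzRingType) (c : {rmorphism K -> S}) (e : nat -> S).

Fixpoint mhom m : {rmorphism mpoly K m -> S} :=
  match m return {rmorphism mpoly K m -> S} with
  | 0%N => c
  | m'.+1 => ((horner_eval (e m') \o map_poly (mhom m'))
             : {rmorphism {poly mpoly K m'} -> S})
  end.

Lemma mhom_const m a : mhom m (mconst m a) = c a.
Proof. by elim: m => //= m IH; rewrite /horner_eval map_polyC hornerC /=. Qed.

Lemma mhom_var m i : (i < m)%N -> mhom m (mvar K m i) = e i.
Proof.
elim: m => // m IH lim; rewrite /=.
case: eqVneq => [->|nim]; first by rewrite /horner_eval map_polyX hornerX.
by rewrite /horner_eval map_polyC hornerC /= IH // ltn_neqAle nim -ltnS.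
Qed.

End Hom.

Lemma mhom_eq (S : comNzRingType) m (f g : {rmorphism mpoly K m -> S}) :
  (forall a, f (mconst m a) = g (mconst m a)) ->
  (forall i, (i < m)%N -> f (mvar K m i) = g (mvar K m i)) -> f =1 g.
Proof.
move=> hc hv; elim/mpoly_ind => // p q hp hq; first by rewrite !rmorphD hp hq.
by rewrite !rmorphM hp hq.
Qed.

Lemma meval_mhom (F : fieldType) (c : {rmorphism K -> F}) (e : nat -> F) m p :
  meval c e p = mhom c e m p.
Proof.
elim: m p => [//|m IH] p /=.
rewrite /horner_eval (horner_coef_wide _ (size_poly _ _)).
by apply: eq_bigr => i _; rewrite coef_map IH.
Qed.

Section Subst.
Variable m : nat.
Local Notation A := (mpoly K m).

Definition msubst (e : nat -> A) : {rmorphism A -> A} := mhom (mconst_rmorphism m) e m.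

Lemma msubst_const e a : msubst e (mconst m a) = mconst m a.
Proof. by rewrite /msubst mhom_const mconst_rmorphismE. Qed.

Lemma msubst_var e i : (i < m)%N -> msubst e (mvar K m i) = e i.
Proof. exact: mhom_var. Qed.

Definition mkill (i : nat) := msubst (fun j => if j == i then 0 else mvar K m j).

Lemma rdvd_sub_mkill i (p : A) : rdvd (mvar K m i) (p - mkill i p).
Proof.
elim/mpoly_ind: p => [a|j ltjm|p q hp hq|p q hp hq].
- by rewrite msubst_const subrr; exists 0; rewrite mulr0.
- rewrite msubst_var //; case: eqP => [->|_]; first by rewrite subr0; apply: rdvd_refl.
  by rewrite subrr; exists 0; rewrite mulr0.
- by rewrite rmorphD opprD addrACA; apply: rdvdD.
- rewrite rmorphM.
  have -> : p * q - mkill i p * mkill i q = (p - mkill i p) * q + mkill i p * (q - mkill i q).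
    by ring.
  by apply: rdvdD; [apply: rdvdMr|apply: rdvdMl].
Qed.

Lemma mkill_rdvd i (p : A) : mkill i p = 0 -> rdvd (mvar K m i) p.
Proof. by move=> h; have := rdvd_sub_mkill i p; rewrite h subr0. Qed.

Lemma rdvd_mkill i (p : A) : (i < m)%N -> rdvd (mvar K m i) p -> mkill i p = 0.
Proof. by move=> lim [q ->]; rewrite rmorphM msubst_var // eqxx mul0r. Qed.

Lemma mvar_neq0 i : (i < m)%N -> mvar K m i != 0.
Proof.
move=> lim; apply/eqP => h.
have := mhom_var (idfun : {rmorphism K -> K}) (fun=> 1) lim.
by rewrite h rmorph0 => /esym/eqP; rewrite oner_eq0.
Qed.

(** The kernel of [mkill i] is generated by the variable and its target is a domain, so the variable
    is prime. *)
Lemma cop_mvarl i (p : A) : (i < m)%N -> mkill i p != 0 -> cop (mvar K m i) p.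
Proof.
move=> lim p0 c /(rdvd_mkill lim); rewrite rmorphM => /eqP.
by rewrite mulf_eq0 (negPf p0) => /eqP /mkill_rdvd.
Qed.

Lemma cop_mvarr i (p : A) : (i < m)%N -> mkill i p != 0 -> cop p (mvar K m i).
Proof. by move=> lim p0; apply: copC; [apply: mvar_neq0|apply: cop_mvarl]. Qed.

Lemma cop_mvar i j : (i < m)%N -> (j < m)%N -> i != j -> cop (mvar K m i) (mvar K m j).
Proof.
move=> lim ljm nij; apply: cop_mvarl => //.
by rewrite msubst_var // [j == i]eq_sym (negPf nij) mvar_neq0.
Qed.

End Subst.

(** A Gauss lemma looking only at leading coefficients: [P] divides the leading coefficient of [c],
    and subtracting that term lowers the size of [c]. *)
Lemma polyC_strip (A : idomainType) (P : A) (b c d : {poly A}) :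
  P != 0 -> cop P (lead_coef b) -> b * c = P%:P * d -> exists d', c = P%:P * d'.
Proof.
move=> P0 hb; have [n] := ubnP (size c); elim: n c d => // n IH c d szc e.
have [->|c0] := eqVneq c 0; first by exists 0; rewrite mulr0.
have [q qE] : rdvd P (lead_coef c).
  by apply: hb; exists (lead_coef d); rewrite -lead_coefM e lead_coefM lead_coefC.
pose t := P%:P * (q *: 'X^((size c).-1)).
have szt : (size (c - t)%R < size c)%N.
  rewrite -[X in (_ < X)%N]prednK ?size_poly_gt0 // ltnS.
  apply/leq_sizeP => j; rewrite leq_eqVlt => /predU1P[<-|ltj].
    by rewrite coefB /t coefCM coefZ coefXn eqxx mulr1 -qE lead_coefE subrr.
  rewrite coefB nth_default ?sub0r; last by rewrite -[size c]prednK ?size_poly_gt0.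
  by rewrite /t coefCM coefZ coefXn gtn_eqF // !mulr0 oppr0.
have [||d' d'E] := IH (c - t) (d - b * (q *: 'X^((size c).-1))).
- exact: leq_trans szt szc.
- by rewrite mulrBr e /t; ring.
by exists (d' + q *: 'X^((size c).-1)); rewrite mulrDr -d'E /t subrK.
Qed.

Lemma expf_div_cancel (F : fieldType) (y t : F) p q a : t != 0 ->
  (y * t ^+ p / t ^+ q) ^+ a * t ^+ (q * a) = y ^+ a * t ^+ (p * a).
Proof. by move=> t0; rewrite !exprM -!exprMn divfK // expf_neq0. Qed.

(** * Gradings by weights of either sign *)

Section Grading.
Variables (m : nat) (wp wn : nat -> nat).
Local Notation A := (mpoly K m).
Local Notation S := {fraction {poly A}}.
Let s : S := ('X : {poly A})%:F.

Let s0 : s != 0.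
Proof. by rewrite /s tofrac_eq0 polyX_eq0. Qed.

(** Scales variable [i] by [s^(wp i - wn i)]. Negative weights occur, hence the two natural parts
    and the values in a fraction field. *)
Definition torus : {rmorphism A -> S} :=
  mhom ((@tofrac _ \o (polyC \o mconst_rmorphism m)) : {rmorphism K -> S})
       (fun i => ((mvar K m i)%:P)%:F * s ^+ wp i / s ^+ wn i) m.

(** Setting [s = 1] in the cleared polynomial recovers [c]; this brings a quotient found over [A[s]]
    back to [A]. *)
Lemma torus_rep (c : A) :
  exists N (g : {poly A}), torus c * s ^+ N = g%:F /\ g.[1] = c.
Proof.
elim/mpoly_ind: c => [a|i lim|p q [N [g [gE g1]]] [N' [g' [gE' g1']]]
                     |p q [N [g [gE g1]]] [N' [g' [gE' g1']]]].
- exists 0%N, (mconst m a)%:P; rewrite hornerC mulr1; split=> //.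
  by rewrite /torus mhom_const /= mconst_rmorphismE.
- exists (wn i), ((mvar K m i)%:P * 'X^(wp i)); split.
    by rewrite /torus mhom_var // divfK ?expf_neq0 // rmorphM rmorphXn.
  by rewrite hornerM hornerC hornerXn expr1n mulr1.
- exists (N + N')%N, (g * 'X^N' + g' * 'X^N); split.
    rewrite !rmorphD /= !rmorphM !rmorphXn /= -gE -gE' -/s exprD; ring.
  by rewrite hornerD !hornerM !hornerXn !expr1n !mulr1 g1 g1'.
exists (N + N')%N, (g * g'); split; last by rewrite hornerM g1 g1'.
by rewrite !rmorphM /= -gE -gE' exprD; ring.
Qed.

(** Applied to [b * c = P * d], the torus multiplies [P] by a power of [s] only. So [P], as a
    constant of [A[s]], divides [g] times the image of [c]; its coprimality with the leading
    coefficient of [g] strips [g] off, and [s = 1] concludes. *)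
Lemma cop_graded (P b : A) (e f N : nat) (g : {poly A}) :
  P != 0 -> torus P * s ^+ f = P%:P%:F * s ^+ e ->
  torus b * s ^+ N = g%:F -> cop P (lead_coef g) -> cop P b.
Proof.
move=> P0 hP hb hg c [d hcd].
have [Nc [gc [gcE gc1]]] := torus_rep c.
have [Nd [gd [gdE gd1]]] := torus_rep d.
have [||d' d'E] := @polyC_strip A P (g * 'X^(f + Nd)) gc (gd * 'X^(e + N + Nc)) P0.
- by rewrite lead_coefM lead_coefXn mulr1.
- apply/eqP; rewrite -tofrac_eq !rmorphM !rmorphXn /= -/s -hb -gcE -gdE; apply/eqP.
  transitivity (torus (b * c) * (s ^+ N * s ^+ Nc * s ^+ (f + Nd))).
    by rewrite rmorphM; ring.
  rewrite hcd rmorphM !exprD.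
  transitivity (torus P * s ^+ f * (torus d * s ^+ N * s ^+ Nc * s ^+ Nd)); first by ring.
  by rewrite hP; ring.
by exists d'.[1]; rewrite -gc1 d'E hornerM hornerC.
Qed.

Lemma torus_prod (I : finType) (ix : I -> nat) (a : I -> nat) :
  (forall i, (ix i < m)%N) ->
  torus (\prod_i mvar K m (ix i) ^+ a i) * s ^+ (\sum_i wn (ix i) * a i) =
  (\prod_i mvar K m (ix i) ^+ a i)%:P%:F * s ^+ (\sum_i wp (ix i) * a i).
Proof.
move=> ltm; rewrite !rmorph_prod /= -!prodrXr -!big_split /=.
apply: eq_bigr => i _; rewrite !rmorphXn /= {1}/torus mhom_var //.
exact: expf_div_cancel.
Qed.

End Grading.
End MPolyHom.

Lemma size_sub_lead (A : idomainType) (p q : {poly A}) :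
  p != 0 -> size p = size q -> lead_coef p = lead_coef q ->
  (size (p - q)%R < size p)%N.
Proof.
move=> p0 es el; rewrite -[X in (_ < X)%N]prednK ?size_poly_gt0 // ltnS.
apply/leq_sizeP => j; rewrite leq_eqVlt => /predU1P[<-|ltj]; rewrite coefB.
  by rewrite -lead_coefE el lead_coefE -es subrr.
by rewrite !nth_default ?subrr // -?es -[size p]prednK ?size_poly_gt0.
Qed.

(** * Leading forms for nonnegative weights *)

Section LeadingForm.
Variables (K : fieldType) (m : nat) (w : nat -> nat).
Local Notation A := (mpoly K m).

Definition wgr : {rmorphism A -> {poly A}} :=
  mhom ((polyC \o mconst_rmorphism K m) : {rmorphism K -> {poly A}})
       (fun i => (mvar K m i)%:P * 'X^(w i)) m.

Definition lform (f : A) : A := lead_coef (wgr f).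

Lemma wgr_const a : wgr (mconst m a) = (mconst m a)%:P.
Proof. by rewrite /wgr mhom_const /= mconst_rmorphismE. Qed.

Lemma wgr_var i : (i < m)%N -> wgr (mvar K m i) = (mvar K m i)%:P * 'X^(w i).
Proof. exact: mhom_var. Qed.

Lemma wgr1 f : (wgr f).[1] = f.
Proof.
elim/mpoly_ind: f => [a|i lim|p q hp hq|p q hp hq].
- by rewrite wgr_const hornerC.
- by rewrite wgr_var // hornerM hornerC hornerXn expr1n mulr1.
- by rewrite rmorphD hornerD hp hq.
- by rewrite rmorphM hornerM hp hq.
Qed.

Lemma wgr_eq0 f : (wgr f == 0) = (f == 0).
Proof.
apply/eqP/eqP => [h|->]; last exact: rmorph0.
by rewrite -(wgr1 f) h horner0.
Qed.

(** The coefficients of [wgr f] are the homogeneous components of [f]. In particular leading forms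
    are homogeneous, and so is a quotient of two of them. *)
Lemma wgr_homog f i : wgr (wgr f)`_i = (wgr f)`_i *: 'X^i.
Proof.
elim/mpoly_ind: f i => [a|j ltj|p q hp hq|p q hp hq] i.
- rewrite wgr_const coefC; case: eqP => [->|_]; last by rewrite rmorph0 scale0r.
  by rewrite wgr_const expr0 alg_polyC.
- rewrite wgr_var // coefCM coefXn; case: eqP => [->|_].
    by rewrite mulr1 wgr_var // mul_polyC.
  by rewrite mulr0 rmorph0 scale0r.
- by rewrite rmorphD coefD rmorphD hp hq scalerDl.
- rewrite rmorphM coefM rmorph_sum scaler_suml; apply: eq_bigr => j _.
  rewrite rmorphM hp hq -!mul_polyC polyCM.
  have -> : 'X^i = 'X^j * 'X^(i - j) :> {poly A} by rewrite -exprD subnKC // -ltnS.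
  by ring.
Qed.

Lemma lformM f g : lform (f * g) = lform f * lform g.
Proof. by rewrite /lform rmorphM lead_coefM. Qed.

Lemma lform_eq0 f : (lform f == 0) = (f == 0).
Proof. by rewrite /lform lead_coef_eq0 wgr_eq0. Qed.

Lemma lform1 : lform 1 = 1.
Proof. by rewrite /lform rmorph1 lead_coef1. Qed.

(** Division by leading forms: the leading form of [c] is that of [a] times some [x], and
    [c - a * x] has lower weight than [c]. *)
Lemma cop_lform a b : a != 0 -> cop (lform a) (lform b) -> cop a b.
Proof.
move=> a0 hab c; have [n] := ubnP (size (wgr c)); elim: n c => // n IH c szc [d e].
have [->|c0] := eqVneq c 0; first by exists 0; rewrite mulr0.
have [x xE] : rdvd (lform a) (lform c).
  by apply: hab; exists (lform d); rewrite -lformM e lformM.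
have lc0 : lform c != 0 by rewrite lform_eq0.
have la0 : lform a != 0 by rewrite lform_eq0.
have x0 : x != 0 by apply: contraNneq lc0 => x0; rewrite xE x0 mulr0.
have wc0 : wgr c != 0 by rewrite wgr_eq0.
have wa0 : wgr a != 0 by rewrite wgr_eq0.
(* Both leading forms are homogeneous, which forces the quotient [x] to be homogeneous and hence
   equal to its own leading form. *)
have wx : 'X^((size (wgr a)).-1) * wgr x = x%:P * 'X^((size (wgr c)).-1).
  have laP : (lform a)%:P != 0 by rewrite polyC_eq0.
  apply: (mulfI laP).
  transitivity (wgr (lform a) * wgr x); first by rewrite wgr_homog mul_polyC scalerAl.
  by rewrite -rmorphM -xE wgr_homog -lead_coefE -/(lform c) xE -!mul_polyC polyCM mulrA.
have wx0 : wgr x != 0 by rewrite wgr_eq0.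
have lx : lead_coef (wgr x) = x.
  by have := congr1 lead_coef wx; rewrite !lead_coefM lead_coefC !lead_coefXn mul1r mulr1.
have sx : ((size (wgr a)).-1 + size (wgr x) = size (wgr c))%N.
  have : size ('X^((size (wgr a)).-1) * wgr x) = size (x%:P * 'X^((size (wgr c)).-1)).
    by rewrite wx.
  have X0 k : 'X^k != 0 :> {poly A} by rewrite monic_neq0 ?monicXn.
  rewrite size_Cmul // size_mul // !size_polyXn addSn /= => ->.
  by rewrite prednK // size_poly_gt0.
have [||y yE] := IH (c - a * x).
- have := @size_sub_lead _ (wgr c) (wgr (a * x)) wc0.
  rewrite rmorphB => h; apply: leq_trans (h _ _) _; last by rewrite -ltnS.
    by rewrite rmorphM size_mul // -sx; move: wa0; rewrite -size_poly_gt0; lia.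
  by rewrite rmorphM lead_coefM lx -/(lform c) xE.
- by exists (d - b * x); rewrite mulrBr e; ring.
by exists (x + y); rewrite mulrDr -yE addrC subrK.
Qed.

Definition wdeg (f : A) : nat := (size (wgr f)).-1.

Lemma wdegM f g : f != 0 -> g != 0 -> wdeg (f * g) = (wdeg f + wdeg g)%N.
Proof.
rewrite -!wgr_eq0 /wdeg => f0 g0; rewrite rmorphM size_mul //.
by move: f0 g0; rewrite -!size_poly_gt0; lia.
Qed.

(** The case [g = 0] is separate because [wdeg 0 = 0] is not below [wdeg f] when [f] has weight
    zero. *)
Lemma lformDl f g : g = 0 \/ (wdeg g < wdeg f)%N -> lform (f + g) = lform f.
Proof.
case=> [->|h]; first by rewrite addr0.
rewrite /lform rmorphD lead_coefDl //; move: h; rewrite /wdeg.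
by case: (size (wgr f)) => //= n; lia.
Qed.

Lemma wdegDl f g : g = 0 \/ (wdeg g < wdeg f)%N -> wdeg (f + g) = wdeg f.
Proof.
case=> [->|h]; first by rewrite addr0.
rewrite /wdeg rmorphD size_polyDl //; move: h; rewrite /wdeg.
by case: (size (wgr f)) => //= n; lia.
Qed.

End LeadingForm.

(** * Seeds and the Laurent phenomenon *)

(** Positive part of an integer as a natural number, for use as an exponent. *)
Definition pe (z : int) : nat := if z is Posz n then n else 0%N.

Lemma intposE z : intpos z = (pe z)%:Z.
Proof. by case: z. Qed.

Lemma peB z : z = (pe z)%:Z - (pe (- z))%:Z.
Proof. by case: z => [[|n]|n] //=; lia. Qed.

Lemma pe_min z : pe z = 0%N \/ pe (- z) = 0%N.
Proof. by case: z => [[|n]|n]; [left|right|left]. Qed.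

Section SeedMutation.
Variable V : finType.
Implicit Types (B : V -> V -> int) (k i j : V).

Definition skewB B := forall i j, B i j = - B j i.

(** Linear independence of the rows indexed by mutable vertices: the full rank condition under which
    distinct exchange polynomials are coprime. *)
Definition rows_free (mut : pred V) B := forall c : V -> int,
  (forall i, ~~ mut i -> c i = 0) -> (forall j, \sum_i c i * B i j = 0) -> forall i, c i = 0.

Lemma skew_diag B i : skewB B -> B i i = 0.
Proof. by move=> sk; have := sk i i; lia. Qed.

Lemma mutBE B k i j : mutB B k i j =
  if (i == k) || (j == k) then - B i j
  else B i j + (pe (B i k))%:Z * (pe (B k j))%:Z - (pe (- B i k))%:Z * (pe (- B k j))%:Z.
Proof. by rewrite /mutB !intposE. Qed.

Lemma mutB_skew B k : skewB B -> skewB (mutB B k).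
Proof.
move=> sk i j; rewrite !mutBE [in RHS]orbC; case: ifP => _; first by rewrite sk.
by rewrite (sk i j) (sk i k) (sk k j) !opprK; ring.
Qed.

Lemma mutBK B k : skewB B -> mutB (mutB B k) k = B.
Proof.
move=> sk; apply: functional_extensionality => i; apply: functional_extensionality => j.
rewrite mutBE; case: ifP => h; first by rewrite mutBE h opprK.
by rewrite !mutBE h !eqxx orbT /= !opprK; ring.
Qed.

Lemma mutB_opp B k : mutB (fun i j => - B i j) k = (fun i j => - mutB B k i j).
Proof.
apply: functional_extensionality => i; apply: functional_extensionality => j.
rewrite !mutBE; case: ifP => _ //; rewrite !opprK; ring.
Qed.

Lemma mutB_rows_free (mut : pred V) B k : skewB B -> mut k -> rows_free mut B -> rows_free mut (mutB B k).
Proof.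
move=> sk mk free c c0 cB.
pose al := \sum_(i | i != k) c i * (pe (B i k))%:Z.
pose be := \sum_(i | i != k) c i * (pe (- B i k))%:Z.
have abE : al = be.
  apply/eqP; rewrite -subr_eq0 -sumrB; apply/eqP.
  have := cB k; rewrite (bigD1 k) //= mutBE eqxx skew_diag // oppr0 mulr0 add0r => h.
  rewrite -[RHS]oppr0 -[in RHS]h -sumrN; apply: eq_bigr => i _.
  by rewrite mutBE eqxx orbT mulrN opprK -mulrBr -peB.
(* A relation [c] among the rows of the mutated matrix becomes one among the rows of [B] when its
   coefficient at [k] is replaced by [al - c k]; the relation in column [k] gives [al = be]. *)
have h i : (if i == k then al - c k else c i) = 0.
  move: i; apply: free => [i ni|j].
    by case: eqP ni => [->|_ /c0 //]; rewrite mk.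
  rewrite (bigD1 k) //= eqxx.
  under eq_bigr => i ni do rewrite (negPf ni).
  have [->|njk] := eqVneq j k.
    rewrite skew_diag // mulr0 add0r; have := cB k.
    rewrite (bigD1 k) //= mutBE eqxx skew_diag // oppr0 mulr0 add0r => h.
    rewrite -[RHS]oppr0 -[in RHS]h -sumrN; apply: eq_bigr => i _.
    by rewrite mutBE eqxx orbT mulrN opprK.
  have := cB j; rewrite (bigD1 k) //= mutBE eqxx /=.
  under eq_bigr => i ni do rewrite mutBE (negPf ni) (negPf njk) /=.
  move=> e; rewrite -[RHS]e.
  transitivity (c k * - B k j + (\sum_(i | i != k) c i * B i j
      + al * (pe (B k j))%:Z - be * (pe (- B k j))%:Z)).
    by rewrite -abE -addrA -mulrBr -peB; ring.
  congr (_ + _); rewrite /al /be !mulr_suml -big_split -sumrB /=.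
  by apply: eq_bigr => i _; ring.
have ci i : i != k -> c i = 0 by move=> ni; have := h i; rewrite (negPf ni).
move=> i; case: (eqVneq i k) => [->|/ci //].
have := h k; rewrite eqxx /al big1 ?sub0r => [/eqP|i' ni]; first by rewrite oppr_eq0 => /eqP.
by rewrite ci // mul0r.
Qed.

Section Values.
Variable F : fieldType.
Implicit Types x : V -> F.

Definition exch B x k : F := \prod_j x j ^+ pe (B k j) + \prod_j x j ^+ pe (- B k j).

Lemma mutxE B x k i : mutx B x k i = if i == k then exch B x k / x k else x i.
Proof.
rewrite /mutx; case: eqP => // _; congr ((_ + _) / _).
  rewrite [RHS](bigID (fun j => 0 < B k j)) /= [X in _ = _ * X]big1 ?mulr1 => [|j].
    by apply: eq_bigr => j; case: (B k j).
  by rewrite -leNgt; case: (B k j) => [[|n]|n].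
rewrite [RHS](bigID (fun j => B k j < 0)) /= [X in _ = _ * X]big1 ?mulr1 => [|j].
  by apply: eq_bigr => j; case: (B k j) => // n; rewrite NegzE opprK.
by rewrite -leNgt; case: (B k j) => [[|n]|n].
Qed.

Lemma mutate_opp B x k :
  mutate ((fun i j => - B i j), x) k = ((fun i j => - mutB B k i j), mutx B x k).
Proof.
rewrite /mutate /= mutB_opp; congr pair; apply: functional_extensionality => i.
rewrite !mutxE; case: eqP => // _; rewrite /exch addrC.
by under [X in X + _]eq_bigr => j _ do rewrite opprK.
Qed.

Lemma mutateK B x k : skewB B -> x k != 0 -> exch B x k != 0 ->
  mutate (mutate (B, x) k) k = (B, x).
Proof.
move=> sk xk0 e0; rewrite /mutate /= mutBK //; congr pair.
apply: functional_extensionality => i; rewrite mutxE.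
case: eqP => [->|/eqP nik]; last by rewrite mutxE (negPf nik).
have eE : exch (mutB B k) (mutx B x k) k = exch B x k.
  rewrite /exch addrC; congr (_ + _); apply: eq_bigr => j _.
    rewrite mutBE eqxx opprK mutxE; case: eqP => // ->.
    by rewrite skew_diag.
  rewrite mutBE eqxx mutxE; case: eqP => // ->.
  by rewrite skew_diag.
by rewrite eE mutxE eqxx invf_div mulrCA mulfV // mulr1.
Qed.

Lemma mutseq_cons B x k s : mutseq (B, x) (k :: s) = mutseq (mutB B k, mutx B x k) s.
Proof. by []. Qed.

Lemma mutseq_rcons S s k : mutseq S (rcons s k) = mutate (mutseq S s : seed V F) k.
Proof. by rewrite /mutseq foldl_rcons. Qed.

(* Mutations of a seed with values in such a set never divide by zero. *)
Record semifield (C : F -> Prop) : Prop := Semifield {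
  semifield1 : C 1;
  semifieldD : forall u v, C u -> C v -> C (u + v);
  semifieldM : forall u v, C u -> C v -> C (u * v);
  semifieldV : forall u, C u -> C u^-1;
  semifield_neq0 : forall u, C u -> u != 0 }.

Variables (C : F -> Prop) (HC : semifield C).

Lemma semifield_prod x (a : V -> nat) : (forall v, C (x v)) -> C (\prod_v x v ^+ a v).
Proof.
case: (HC) => C1 _ CM _ _ h.
have CX v n : C (x v ^+ n) by elim: n => [|n IH]; rewrite ?expr0 // exprS; apply: CM.
by elim/big_rec: _ => // i u _ Cu; apply: CM.
Qed.

Lemma semifield_exch B x k : (forall v, C (x v)) -> C (exch B x k).
Proof. by move=> h; case: (HC) => _ CD _ _ _; apply: CD; apply: semifield_prod. Qed.

Lemma semifield_mutx B x k : (forall v, C (x v)) -> forall v, C (mutx B x k v).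
Proof.
case: (HC) => _ _ CM CV _ h v; rewrite mutxE; case: eqP => // _.
by apply: CM; [apply: semifield_exch|apply: CV].
Qed.

Lemma semifield_mutseq B x s : (forall v, C (x v)) -> forall v, C ((mutseq (B, x) s).2 v).
Proof. by elim: s B x => //= k s IH B x h; apply: IH; apply: semifield_mutx. Qed.

End Values.
End SeedMutation.

(** A fraction has no value at [f] in general. Having some representative with positive numerator
    and denominator is enough, and survives sums, products and inverses. *)
Lemma semifield_frac (R : idomainType) (K : numFieldType) (f : {rmorphism R -> K}) :
  semifield (fun u : {fraction R} => exists p q, [/\ 0 < f p, 0 < f q & u * q%:F = p%:F]).
Proof.
have nz p : 0 < f p -> p%:F != 0.
  by move=> h; rewrite tofrac_eq0; apply: contraTneq h => ->; rewrite rmorph0 ltxx.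
split.
- by exists 1, 1; rewrite rmorph1 ltr01 mulr1.
- move=> u v [p [q [p0 q0 e]]] [p' [q' [p0' q0' e']]].
  exists (p * q' + p' * q), (q * q'); split.
  + by rewrite rmorphD !rmorphM addr_gt0 // mulr_gt0.
  + by rewrite rmorphM mulr_gt0.
  + by rewrite rmorphD !rmorphM /= -e -e'; ring.
- move=> u v [p [q [p0 q0 e]]] [p' [q' [p0' q0' e']]].
  exists (p * p'), (q * q'); split; rewrite ?rmorphM ?mulr_gt0 //=.
  by rewrite -e -e'; ring.
- move=> u [p [q [p0 q0 e]]]; exists q, p; split=> //.
  have u0 : u != 0 by apply: contraTneq (nz _ p0) => u0; rewrite -e u0 mul0r eqxx.
  by rewrite -e mulKf.
- move=> u [p [q [p0 q0 e]]].
  by apply: contraTneq (nz _ p0) => u0; rewrite -e u0 mul0r eqxx.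
Qed.

(** * Laurent polynomials in the initial cluster and exchange polynomials *)

Section Laurent.
Variables (K : numFieldType) (V : finType) (mut : pred V).
Local Notation A := (mpoly K #|V|).
Local Notation FA := {fraction A}.
Implicit Types (B : V -> V -> int) (u v w : FA) (a b : V -> nat) (i j k : V).

Definition X i : A := mvar K #|V| (enum_rank i).
Definition Xf i : FA := (X i)%:F.
Definition mon a : A := \prod_i X i ^+ a i.

Lemma XfE i : Xf i = (X i)%:F. Proof. by []. Qed.

Lemma X_neq0 i : X i != 0. Proof. exact: mvar_neq0. Qed.

Lemma Xf_neq0 i : Xf i != 0. Proof. by rewrite tofrac_eq0 X_neq0. Qed.

Lemma monM a b : mon a * mon b = mon (fun i => a i + b i)%N.
Proof. by rewrite /mon -big_split; apply: eq_bigr => i _; rewrite exprD. Qed.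

Lemma monX a n : mon a ^+ n = mon (fun i => a i * n)%N.
Proof. by rewrite /mon -prodrXl; apply: eq_bigr => i _; rewrite exprM. Qed.

Lemma mon_neq0 a : mon a != 0.
Proof. by apply/prodf_neq0 => i _; rewrite expf_neq0 ?X_neq0. Qed.

Lemma eq_mon a b : a =1 b -> mon a = mon b.
Proof. by move=> h; apply: eq_bigr => i _; rewrite h. Qed.

Lemma X_mon k : X k = mon (fun i => nat_of_bool (i == k)).
Proof.
rewrite /mon (bigD1 k) //= eqxx expr1 big1 ?mulr1 // => i /negPf ->.
by rewrite expr0.
Qed.

Lemma Xf_prod a : \prod_i Xf i ^+ a i = (mon a)%:F.
Proof. by rewrite rmorph_prod; apply: eq_bigr => i _; rewrite rmorphXn. Qed.

Definition Loc u := exists d (p : A), u * (\prod_(i | mut i) Xf i) ^+ d = p%:F.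

Let T0 : \prod_(i | mut i) Xf i != 0.
Proof. by apply/prodf_neq0 => i _; apply: Xf_neq0. Qed.

Lemma Loc_tofrac (p : A) : Loc p%:F.
Proof. by exists 0%N, p; rewrite mulr1. Qed.

Lemma Loc1 : Loc 1.
Proof. by rewrite -tofrac1; apply: Loc_tofrac. Qed.

Lemma LocD u v : Loc u -> Loc v -> Loc (u + v).
Proof.
move=> [d [p e]] [d' [p' e']].
exists (d + d')%N, (p * (\prod_(i | mut i) X i) ^+ d' + p' * (\prod_(i | mut i) X i) ^+ d).
rewrite rmorphD !rmorphM !rmorphXn /= rmorph_prod /= -e -e' exprD mulrDl.
by congr (_ + _); ring.
Qed.

Lemma LocM u v : Loc u -> Loc v -> Loc (u * v).
Proof.
move=> [d [p e]] [d' [p' e']]; exists (d + d')%N, (p * p').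
by rewrite rmorphM /= -e -e' exprD; ring.
Qed.

Lemma LocXfV i : mut i -> Loc (Xf i)^-1.
Proof.
move=> mi; exists 1%N, (\prod_(j | mut j && (j != i)) X j).
by rewrite (bigD1 i) //= expr1 mulKf ?Xf_neq0 // rmorph_prod.
Qed.

Definition Locunit u := u != 0 /\ Loc u /\ Loc u^-1.

Lemma LocunitV u : Locunit u -> Locunit u^-1.
Proof. by case=> u0 [h h']; split; rewrite ?invr_neq0 // invrK. Qed.

Lemma LocunitM u v : Locunit u -> Locunit v -> Locunit (u * v).
Proof.
case=> u0 [h h'] [v0 [k k']]; split; first by rewrite mulf_neq0.
by rewrite invfM; split; apply: LocM.
Qed.

Lemma Locunit1 : Locunit 1.
Proof. by rewrite /Locunit oner_eq0 invr1; split=> //; split; apply: Loc1. Qed.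

Lemma LocunitX u n : Locunit u -> Locunit (u ^+ n).
Proof.
by move=> h; elim: n => [|n IH]; [rewrite expr0; apply: Locunit1|rewrite exprS; apply: LocunitM].
Qed.

Lemma LocunitXf i : mut i -> Locunit (Xf i).
Proof.
by move=> mi; split; [apply: Xf_neq0|split; [apply: Loc_tofrac|apply: LocXfV]].
Qed.

Lemma Locunit_prod (P : pred V) (x : V -> FA) :
  (forall i, P i -> Locunit (x i)) -> Locunit (\prod_(i | P i) x i).
Proof.
move=> h; elim/big_rec: _ => [|i u Pi hu]; first exact: Locunit1.
by apply: LocunitM => //; apply: h.
Qed.

Lemma Loc_cancel u v : Locunit v -> Loc (u * v) -> Loc u.
Proof. by move=> [v0 [_ h]] h'; rewrite -(mulfK v0 u); apply: LocM. Qed.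

(** Powers of [P] and [Q] remain coprime. Comparing the two expressions of [u], the power of [P]
    divides its numerator up to a monomial in the mutable variables. *)
Lemma Loc_cop u (P Q : A) d e : P != 0 -> Q != 0 -> cop P Q ->
  Loc (u * P%:F ^+ d) -> Loc (u * Q%:F ^+ e) -> Loc u.
Proof.
move=> P0 Q0 c [n [p hp]] [n' [q hq]].
have [r rE] : rdvd (P ^+ d) (p * (\prod_(i | mut i) X i) ^+ n').
  apply: (copXl (n := d) P0 (copXr (n := e) c)).
  exists (q * (\prod_(i | mut i) X i) ^+ n); apply/eqP; rewrite -tofrac_eq.
  rewrite !rmorphM !rmorphXn /= rmorph_prod /= -hp -hq; apply/eqP; ring.
have rF : P%:F ^+ d * r%:F = p%:F * (\prod_(i | mut i) Xf i) ^+ n'.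
  by rewrite -[P%:F ^+ d]rmorphXn -rmorphM /= -rE rmorphM rmorphXn /= rmorph_prod.
exists (n + n')%N, r; apply: (@mulfI _ (P%:F ^+ d)); first by rewrite expf_neq0 ?tofrac_eq0.
by rewrite rF -hp exprD; ring.
Qed.

Definition exchP B k : A := mon (fun i => pe (B k i)) + mon (fun i => pe (- B k i)).

Lemma exchPE B k : exchP B k = mon (fun i => pe (B k i)) + mon (fun i => pe (- B k i)).
Proof. by []. Qed.

Lemma exch_Xf B k : exch B Xf k = (exchP B k)%:F.
Proof. by rewrite /exch !Xf_prod -rmorphD. Qed.

(** Subtraction-free expressions are positive at the point [(1, ..., 1)], which shows that they do
    not vanish. *)
Definition ev1 : {rmorphism A -> K} := mhom (idfun : {rmorphism K -> K}) (fun=> 1) #|V|.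

Lemma ev1_X i : ev1 (X i) = 1.
Proof. exact: mhom_var. Qed.

Lemma ev1_mon a : ev1 (mon a) = 1.
Proof. by rewrite rmorph_prod big1 // => i _; rewrite rmorphXn /= ev1_X expr1n. Qed.

Lemma semifield_ev1 : semifield
  (fun u : FA => exists p q, [/\ 0 < ev1 p, 0 < ev1 q & u * q%:F = p%:F]).
Proof. exact: semifield_frac. Qed.

Lemma semifield_Xf i : exists p q, [/\ 0 < ev1 p, 0 < ev1 q & Xf i * q%:F = p%:F].
Proof. by exists (X i), 1; rewrite ev1_X rmorph1 ltr01 mulr1. Qed.

Lemma exchP_neq0 B k : exchP B k != 0.
Proof.
apply/eqP => /(congr1 ev1); rewrite rmorphD !ev1_mon rmorph0 => /eqP.
by rewrite -(natrD _ 1 1) pnatr_eq0.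
Qed.

Lemma kill_mon k a : mkill K #|V| (enum_rank k) (mon a) = if a k == 0%N then mon a else 0.
Proof.
rewrite rmorph_prod /=; case: eqP => [ak0|/eqP ak0].
  apply: eq_bigr => i _; rewrite rmorphXn /=; have [->|ni] := eqVneq i k.
    by rewrite ak0 !expr0.
  by rewrite msubst_var // (inj_eq (inj_comp val_inj enum_rank_inj)) (negPf ni).
rewrite (bigD1 k) //= rmorphXn /= msubst_var // eqxx expr0n (negPf ak0).
by rewrite mul0r.
Qed.

(** The two monomials of an exchange polynomial share no variable, so setting [X i] to zero leaves
    at least one of them. *)
Lemma cop_exchP_X B k i : cop (exchP B k) (X i).
Proof.
apply: cop_mvarr; first exact: ltn_ord.
rewrite rmorphD !kill_mon /=.
case: (pe_min (B k i)) => -> /=; case: ifP => _; rewrite ?addr0 ?add0r ?mon_neq0 //.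
all: exact: (exchP_neq0 B k).
Qed.

Lemma cop_exchP_mon B k a : cop (exchP B k) (mon a).
Proof. by apply: cop_prodr => i _; apply: copXr; apply: cop_exchP_X. Qed.

Let wt (w : V -> nat) (n : nat) : nat :=
  if insub n is Some r then w (enum_val (r : 'I_#|V|)) else 0%N.

Lemma wtE (f : V -> nat) i : wt f (enum_rank i) = f i.
Proof. by rewrite /wt valK enum_rankK. Qed.

(* Weights [wp - wn] for which the first binomial is homogeneous. *)
Lemma cop_exchP_graded B k (wp wn : V -> nat) (b1 b2 : V -> nat) c :
  (\sum_i wp i * pe (B k i) + \sum_i wn i * pe (- B k i) =
   \sum_i wp i * pe (- B k i) + \sum_i wn i * pe (B k i))%N ->
  (\sum_i wp i * b1 i + \sum_i wn i * b2 i != \sum_i wp i * b2 i + \sum_i wn i * b1 i)%N ->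
  c = mon b1 + mon b2 -> cop (exchP B k) c.
Proof.
move=> hP hb ->.
have tp a : torus K #|V| (wt wp) (wt wn) (mon a) * ('X : {poly A})%:F ^+ (\sum_i wn i * a i) =
    (mon a)%:P%:F * ('X : {poly A})%:F ^+ (\sum_i wp i * a i).
  have := @torus_prod K #|V| (wt wp) (wt wn) V (fun i => enum_rank i) a (fun i => ltn_ord _).
  have wE f : (\sum_i wt f (enum_rank i) * a i = \sum_i f i * a i)%N.
    by apply: eq_bigr => i _; rewrite wtE.
  by rewrite !wE.
pose e1 := (\sum_i wp i * b1 i + \sum_i wn i * b2 i)%N.
pose e2 := (\sum_i wp i * b2 i + \sum_i wn i * b1 i)%N.
apply: (@cop_graded _ _ (wt wp) (wt wn) _ _
  (\sum_i wp i * pe (B k i) + \sum_i wn i * pe (- B k i))%N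
  (\sum_i wn i * pe (B k i) + \sum_i wn i * pe (- B k i))%N
  (\sum_i wn i * b1 i + \sum_i wn i * b2 i)%N
  ((mon b1)%:P * 'X^e1 + (mon b2)%:P * 'X^e2)).
- exact: exchP_neq0.
- rewrite /exchP !rmorphD /=.
  set t := 'X%:F; set t1 := torus _ _ _ _ _; set t2 := torus _ _ _ _ _.
  set p1 := (\sum_i wp i * pe (B k i))%N; set n1 := (\sum_i wn i * pe (B k i))%N.
  set p2 := (\sum_i wp i * pe (- B k i))%N; set n2 := (\sum_i wn i * pe (- B k i))%N.
  transitivity (t1 * t ^+ n1 * t ^+ n2 + t2 * t ^+ n2 * t ^+ n1); first by rewrite exprD; ring.
  rewrite /t1 /t2 !tp -!mulrA -!exprD -/p1 -/p2.
  by rewrite [(p1 + n2)%N]hP mulrDl.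
- rewrite !rmorphD /= !rmorphM !rmorphXn /=.
  set t := 'X%:F; set t1 := torus _ _ _ _ _; set t2 := torus _ _ _ _ _.
  set n1 := (\sum_i wn i * b1 i)%N; set n2 := (\sum_i wn i * b2 i)%N.
  transitivity (t1 * t ^+ n1 * t ^+ n2 + t2 * t ^+ n2 * t ^+ n1); first by rewrite exprD; ring.
  by rewrite /t1 /t2 !tp -!mulrA -!exprD.
(* The two monomials of [c] have different weights, so the top component of [c] is a single
   monomial, and monomials are coprime to exchange polynomials. *)
have [lt|lt|e] := ltngtP e1 e2; last by rewrite /e1 /e2 in e; rewrite e eqxx in hb.
  rewrite addrC lead_coefDl; first last.
    by rewrite !size_Cmul ?mon_neq0 // !size_polyXn.
  by rewrite lead_coefM lead_coefXn lead_coefC mulr1; apply: cop_exchP_mon.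
rewrite lead_coefDl; first last.
  by rewrite !size_Cmul ?mon_neq0 // !size_polyXn.
by rewrite lead_coefM lead_coefXn lead_coefC mulr1; apply: cop_exchP_mon.
Qed.

End Laurent.

Lemma sum_peE (V : finType) (w g : V -> int) :
  ((\sum_i pe (w i) * pe (g i) + \sum_i pe (- w i) * pe (- g i))%N)%:Z -
  ((\sum_i pe (w i) * pe (- g i) + \sum_i pe (- w i) * pe (g i))%N)%:Z = \sum_i w i * g i.
Proof.
rewrite !PoszD !(big_morph Posz PoszD (erefl _)) -!big_split -sumrB /=.
apply: eq_bigr => i _; rewrite [w i in RHS]peB [g i in RHS]peB !PoszM.
by ring.
Qed.

Lemma field_aux1 (F : fieldType) (r p s t x : F) : t != 0 -> x != 0 ->
  (r * (p / t) + s) / x = (r * p + s * t) * (t * x)^-1.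
Proof. by move=> t0 x0; field; rewrite t0 x0. Qed.

Lemma field_aux2 (F : fieldType) (p q y t x u : F) : t != 0 -> x != 0 -> u != 0 ->
  u * ((p * (y / t) + q) / (u / x)) = (p * y + q * t) * (x / t).
Proof. by move=> t0 x0 u0; field; rewrite t0 x0 u0. Qed.

(** * Mutations in two directions *)

Section RankTwo.
Variables (K : numFieldType) (V : finType) (mut : pred V).
Local Notation A := (mpoly K #|V|).
Local Notation FA := {fraction A}.
Local Notation mon := (@mon K V).
Local Notation X := (@X K V).
Local Notation Xf := (@Xf K V).
Local Notation exchP := (@exchP K V).
Local Notation Locunit := (@Locunit K V mut).
Implicit Types (B : V -> V -> int) (i j k : V).

(** If all these minors vanish, [B j a] times row [k] minus [B k a] times row [j] is a relation for
    every [a]; independence makes row [k] zero, which again contradicts independence. *)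
Lemma rows_free_minor B k j : rows_free mut B -> mut k -> mut j -> k != j ->
  exists a b, B k a * B j b != B k b * B j a.
Proof.
move=> free mk mj nkj.
suff /existsP[a /existsP[b h]] : [exists a, exists b, B k a * B j b != B k b * B j a].
  by exists a, b.
apply: contraT; rewrite negb_exists => /forallP h; exfalso.
have {h}eqB a b : B k a * B j b = B k b * B j a.
  by have := h a; rewrite negb_exists => /forallP/(_ b); rewrite negbK => /eqP.
have Bk0 a : B k a = 0.
  pose c i : int := if i == k then B j a else if i == j then - B k a else 0.
  have := free c; rewrite /c => /(_ _ _ j); rewrite eq_sym (negPf nkj) eqxx => h.
  apply/eqP; rewrite -oppr_eq0; apply/eqP; apply: h => [i ni|b].
    case: eqP => [e|_]; first by rewrite e mk in ni.
    by case: eqP => // e; rewrite e mj in ni.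
  rewrite (bigD1 k) //= eqxx (bigD1 j) /= ?[j == k]eq_sym ?(negPf nkj) 1?eq_sym // eqxx.
  rewrite big1 ?addr0 => [|i /andP[/negPf -> /negPf ->]]; last by rewrite mul0r.
  by rewrite mulNr (eqB a b) mulrC subrr.
have := free (fun i => (i == k)%:Z) => /(_ _ _ k); rewrite eqxx => h.
suff : 1 = 0 :> int by [].
apply: h => [i ni|b]; first by case: eqP => // e; rewrite e mk in ni.
rewrite (bigD1 k) //= big1 ?Bk0 ?mulr0 ?addr0 // => i /negPf ->.
by rewrite mul0r.
Qed.

Lemma cop_exchP_free B k j : rows_free mut B -> mut k -> mut j -> k != j ->
  cop (exchP B k) (exchP B j).
Proof.
move=> free mk mj nkj; have [a [b hab]] := rows_free_minor free mk mj nkj.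
have nab : a != b by apply: contraNneq hab => ->.
(* The weight [w] is orthogonal to row [k], so the exchange polynomial at [k] is homogeneous; its
   pairing with row [j] is the nonzero minor. *)
pose w i : int := if i == a then B k b else if i == b then - B k a else 0.
have sw g : \sum_i w i * g i = B k b * g a - B k a * g b.
  rewrite (bigD1 a) //= (bigD1 b) 1?eq_sym //= /w eqxx [b == a]eq_sym (negPf nab) eqxx.
  rewrite big1 ?addr0 ?mulNr // => i /andP[/negPf -> /negPf ->]; exact: mul0r.
apply: (@cop_exchP_graded K V B k (fun i => pe (w i)) (fun i => pe (- w i))
          (fun i => pe (B j i)) (fun i => pe (- B j i))) => //.
  have := sum_peE w (B k); rewrite sw [B k b * _]mulrC subrr => /eqP.
  by rewrite subr_eq0 => /eqP [].
apply: contraNneq hab => e; have := sum_peE w (B j); rewrite e subrr sw => /esym/eqP.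
by rewrite subr_eq0 eq_sym.
Qed.

Definition off k (a : V -> nat) i := if i == k then 0%N else a i.

Lemma prod_off k (y : V -> FA) (a : V -> nat) : (forall i, i != k -> a i = 0%N \/ y i = Xf i) ->
  \prod_i y i ^+ a i = y k ^+ a k * (mon (off k a))%:F.
Proof.
move=> h; rewrite (bigD1 k) //=; congr (_ * _).
rewrite rmorph_prod [in RHS](bigD1 k) //= /off eqxx expr0 rmorph1 mul1r.
apply: eq_bigr => i nik; rewrite (negPf nik) rmorphXn.
by case: (h i nik) => ->; rewrite ?expr0.
Qed.

Lemma mutseq3 B k j i : i != k -> i != j -> (mutseq (B, Xf) [:: k; j; k]).2 i = Xf i.
Proof. by move=> ik ij; rewrite /= !mutxE (negPf ik) (negPf ij). Qed.

(* With [P] the exchange polynomial at [k], the variables of [mu_k mu_j mu_k] are, up to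
   monomials, [Y = r P^b + s X_k^b] and [Z = h X_k^(b^2)] modulo [P] (for [b > 1]). *)
Lemma rank2_pos B k j (be : nat) : skewB B -> mut k -> mut j -> k != j ->
  B k j = be.+1%:Z ->
  exists Y Z uY uZ, let x3 := (mutseq (B, Xf) [:: k; j; k]).2 in
    [/\ x3 j = Y%:F * uY, x3 k = Z%:F * uZ, Locunit uY & Locunit uZ] /\
    cop (exchP B k) Y /\ cop (exchP B k) Z.
Proof.
move=> sk mk mj nkj Bkj; have njk : j != k by rewrite eq_sym.
set P := exchP B k; set b := be.+1 in Bkj *.
pose c := mutB B k j.
have ck : c k = b%:Z by rewrite /c mutBE eqxx orbT sk opprK.
have cj : c j = 0 by rewrite /c skew_diag //; apply: mutB_skew.
pose d := mutB (mutB B k) j k.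
have sk1 := mutB_skew k sk.
have dk : d k = 0 by apply: skew_diag; apply: mutB_skew.
have dj : d j = b%:Z by rewrite /d mutBE eqxx orbT sk1 opprK.
have dE i : i != k -> i != j -> d i = - (B k i + (b * pe (- c i))%:Z).
  move=> ik ij; rewrite /d mutBE (negPf nkj) (negPf ij) /= -/c.
  by rewrite !mutBE eqxx /= Bkj opprK /= mul0r addr0 PoszM opprD.
(* [c] is row [j] after the mutation at [k], and [d] is row [k] after those at [k] and [j]. The
   monomials of the second exchange relation without the variable of [k] are [r], [s]; those of the
   third without the variable of [j] are [p'], [q']. *)
pose r := mon (off k (fun i => pe (c i))); pose s := mon (off k (fun i => pe (- c i))).
pose p' := mon (off j (fun i => pe (d i))); pose q' := mon (off j (fun i => pe (- d i))).
pose h := mon (fun i => if (i == j) || (i == k) then 0%N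
                 else pe (B k i + (b * pe (- c i))%:Z) - pe (B k i))%N.
(* [E1] and [E2] add up to [p' * s^b + q' * X j^b = h * P]; this identity makes the third exchange
   numerator divisible by [P]. *)
have E1 : p' * s ^+ b = h * mon (fun i => pe (- B k i)).
  rewrite /p' /s /h monX !monM; apply: eq_mon => i; rewrite /off.
  have [->|ij] := eqVneq i j; first by rewrite (negPf njk) cj Bkj.
  have [->|ik] := eqVneq i k; first by rewrite dk skew_diag.
  rewrite dE //=; set t := (b * _)%:Z; have := peB (B k i); have := pe_min (B k i).
  have := peB (B k i + t); have := pe_min (B k i + t).
  have : t = (pe (- c i) * b)%N :> int by rewrite mulnC.
  by lia.
have E2 : q' * X j ^+ b = h * mon (fun i => pe (B k i)).
  rewrite X_mon /q' /h monX !monM; apply: eq_mon => i; rewrite /off.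
  have [->|ij] := eqVneq i j; first by rewrite Bkj /=; lia.
  have [->|ik] := eqVneq i k; first by rewrite dk skew_diag.
  rewrite dE //= opprK; set t := (b * _)%:Z.
  have := peB (B k i); have := pe_min (B k i).
  have := peB (B k i + t); have := pe_min (B k i + t).
  have : 0 <= t by [].
  by lia.
pose x1 := mutx B Xf k; pose x2 := mutx (mutB B k) x1 j.
have x1k : x1 k = P%:F / Xf k by rewrite /x1 mutxE eqxx exch_Xf.
have x1E i : i != k -> x1 i = Xf i by move=> ik; rewrite /x1 mutxE (negPf ik).
have x2j : x2 j = (r%:F * (P%:F / Xf k) ^+ b + s%:F) / Xf j.
  rewrite /x2 mutxE eqxx /exch -/c x1E //.
  rewrite !(@prod_off k x1) => [|i /x1E|i /x1E]; [|by right|by right].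
  by rewrite ck x1k /b /= expr0 mul1r [r%:F * _]mulrC.
have x2k : x2 k = P%:F / Xf k by rewrite /x2 mutxE (negPf nkj).
have x2E i : i != k -> i != j -> x2 i = Xf i.
  by move=> ik ij; rewrite /x2 mutxE (negPf ij) x1E.
have x3k : (mutseq (B, Xf) [:: k; j; k]).2 k =
    (p'%:F * x2 j ^+ b + q'%:F) / (P%:F / Xf k).
  rewrite /= mutxE eqxx /exch -/d -/x1 -/x2 x2k.
  have dX (f : int -> int) i : f 0 = 0 -> i != j -> pe (f (d i)) = 0%N \/ x2 i = Xf i.
    by move=> f0 ij; case: (eqVneq i k) => [->|/x2E ->]; [left; rewrite dk f0|right|].
  rewrite (prod_off (fun i => dX id i (erefl _))).
  rewrite (prod_off (fun i => dX -%R i (oppr0 _))).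
  by rewrite dj /b /= expr0 mul1r [p'%:F * _]mulrC.
pose Y := r * P ^+ b + s * X k ^+ b.
have [k0 j0] := (Xf_neq0 K k, Xf_neq0 K j).
have P0 : P%:F != 0 by rewrite tofrac_eq0 exchP_neq0.
have YF : Y%:F = r%:F * P%:F ^+ b + s%:F * Xf k ^+ b.
  by rewrite [LHS](tofracD (r * P ^+ b)) !tofracM !tofracXn.
have x2jY : x2 j = Y%:F * (Xf k ^+ b * Xf j)^-1.
  rewrite x2j YF [(P%:F / Xf k) ^+ b]expr_div_n.
  exact: (field_aux1 _ _ _ (expf_neq0 b k0) j0).
pose G := \sum_(i < b) (Y ^+ (b.-1 - i) * (s * X k ^+ b) ^+ i).
pose Z := p' * r * P ^+ be * G + X k ^+ (b * b) * h.
(* [Y^b] differs from [(s X_k^b)^b] by [r P^b G], and what remains is [P X_k^(b^2) h] by [E1] and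
   [E2]. The definition of [Z] is the sum of these parts divided by [P]. *)
have PZ : P * Z = p' * Y ^+ b + q' * (X j * X k ^+ b) ^+ b.
  have -> : Y ^+ b = r * P ^+ b * G + (s * X k ^+ b) ^+ b.
    apply/eqP; rewrite -subr_eq subrXX; apply/eqP; congr (_ * _).
    by rewrite /Y addrK.
  have E3 : P * (X k ^+ (b * b) * h) = p' * (s * X k ^+ b) ^+ b + q' * (X j * X k ^+ b) ^+ b.
    rewrite !exprMn -exprM !mulrA E1 E2 /P /exchP; ring.
  rewrite [p' * (_ + _)]mulrDr -[RHS]addrA -E3 [LHS]mulrDr; congr (_ + _).
  by rewrite (exprS P be : P ^+ b = _); ring.
exists Y, Z, (Xf k ^+ b * Xf j)^-1, (Xf k / (Xf j * Xf k ^+ b) ^+ b); split.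
  have [uk uj] : Locunit (Xf k) /\ Locunit (Xf j) by split; apply: LocunitXf.
  split.
  - by rewrite -x2jY /= mutxE (negPf njk).
  - rewrite x3k x2jY; apply: (mulfI P0).
    rewrite [RHS]mulrA -tofracM PZ (tofracD (p' * Y ^+ b)) !(tofracM, tofracXn).
    rewrite expr_div_n [(Xf k ^+ b * _) in LHS]mulrC.
    exact: (field_aux2 _ _ _ (expf_neq0 b (mulf_neq0 j0 (expf_neq0 b k0))) k0 P0).
  - exact: (LocunitV (LocunitM (LocunitX b uk) uj)).
  - exact: (LocunitM uk (LocunitV (LocunitX b (LocunitM uj (LocunitX b uk))))).
have copP := @cop_exchP_mon K V B k; have copX := @cop_exchP_X K V B k.
split.
  apply: (@cop_eqmod _ _ _ (s * X k ^+ b)); last first.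
    by apply: copMr; [apply: copP|apply: copXr; apply: copX].
  by rewrite /Y addrK /b exprS; exists (r * P ^+ be); ring.
have [be0|be0] := posnP be; last first.
  apply: (@cop_eqmod _ _ _ (X k ^+ (b * b) * h)); last first.
    by apply: copMr; [apply: copXr; apply: copX|apply: copP].
  by rewrite /Z addrK -(prednK be0) exprS; exists (p' * r * P ^+ be.-1 * G); ring.
(* For [b = 1] the term with [G] carries no power of [P], so reduction modulo [P] says nothing.
   Instead, [P] does not involve [X k], and the two monomials of [Z] have different degrees in
   [X k]. *)
have ZE : Z = X k * h + p' * r.
  by rewrite /Z /G /b be0 big_ord1 !expr0 !mulr1 expr1 addrC.
have sumk (f : V -> nat) : (\sum_i (i == k) * f i = f k)%N.
  by rewrite (bigD1 k) //= eqxx mul1n big1 ?addn0 // => i /negPf ->.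
have sum0 (f : V -> nat) : (\sum_(i : V) 0 * f i = 0)%N.
  by rewrite big1.
rewrite ZE X_mon /h /p' /r !monM.
apply: (cop_exchP_graded (wp := fun i => nat_of_bool (i == k)) (wn := fun=> 0%N) _ _ (erefl _)).
  by rewrite !sumk !sum0 skew_diag.
by rewrite !sumk !sum0 /off dk !eqxx orbT if_same.
Qed.

End RankTwo.

(** * Specialization of seeds *)

Section Transfer.
Variables (K : numFieldType) (V : finType).
Local Notation A := (mpoly K #|V|).
Local Notation FA := {fraction A}.
Variables (F : fieldType) (phi : {rmorphism A -> F}).

(** A morphism [phi] with a kernel does not extend to the fraction field, so its effect on fractions
    is recorded as a relation. *)
Definition specializes (u : FA) (w : F) :=
  exists p q, [/\ phi q != 0, u * q%:F = p%:F & w * phi q = phi p].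

Lemma specializesD u w u' w' :
  specializes u w -> specializes u' w' -> specializes (u + u') (w + w').
Proof.
move=> [p [q [q0 e f]]] [p' [q' [q0' e' f']]].
exists (p * q' + p' * q), (q * q'); rewrite !rmorphM !rmorphD !rmorphM /= -e -e' -f -f'.
by split; [rewrite mulf_neq0|ring|ring].
Qed.

Lemma specializesM u w u' w' :
  specializes u w -> specializes u' w' -> specializes (u * u') (w * w').
Proof.
move=> [p [q [q0 e f]]] [p' [q' [q0' e' f']]].
exists (p * p'), (q * q'); rewrite !rmorphM /= -e -e' -f -f'.
by split; [rewrite mulf_neq0|ring|ring].
Qed.

Lemma specializes_neq0 u w : specializes u w -> w != 0 -> u != 0.
Proof.
move=> [p [q [q0 e f]]] w0; apply/eqP => u0; move: e; rewrite u0 mul0r => /esym/eqP.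
rewrite tofrac_eq0 => /eqP p0; move: f; rewrite p0 rmorph0 => /eqP.
by rewrite mulf_eq0 (negPf w0) (negPf q0).
Qed.

Lemma specializesV u w : w != 0 -> specializes u w -> specializes u^-1 w^-1.
Proof.
move=> w0 h; have u0 := specializes_neq0 h w0; case: h => p [q [q0 e f]].
by exists q, p; rewrite -e -f !mulKf //; split=> //; rewrite mulf_neq0.
Qed.

Lemma specializes_tofrac p : specializes p%:F (phi p).
Proof. by exists p, 1; rewrite !rmorph1 !mulr1 oner_neq0. Qed.

Lemma specializes_prod (x : V -> FA) (y : V -> F) (a : V -> nat) :
  (forall i, specializes (x i) (y i)) ->
  specializes (\prod_i x i ^+ a i) (\prod_i y i ^+ a i).
Proof.
have s1 : specializes 1 1 by have := specializes_tofrac 1; rewrite !rmorph1.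
move=> h; apply: big_ind2 => // [u w u' w'|i _]; first exact: specializesM.
by elim: (a i) => [|n IH]; [rewrite !expr0|rewrite !exprS; apply: specializesM].
Qed.

Variables (C : F -> Prop) (HC : semifield C).

(** A mutation divides by a cluster variable only, and the specialized value of that variable lies
    in [C], hence is nonzero. *)
Lemma specializes_mutseq B (x : V -> FA) (y : V -> F) s :
  (forall i, C (y i)) -> (forall i, specializes (x i) (y i)) ->
  forall i, specializes ((mutseq (B, x) s).2 i) ((mutseq (B, y) s).2 i).
Proof.
elim: s B x y => [//|k s IH] B x y hC h; rewrite !mutseq_cons.
apply: IH => [i|i]; first exact: semifield_mutx.
rewrite !mutxE; case: eqP => _; last exact: h.
apply: specializesM; last by apply: specializesV => //; apply: semifield_neq0 (hC k).
by apply: specializesD; apply: specializes_prod.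
Qed.

Lemma Loc_specializes (mut : pred V) u w : Loc mut u -> specializes u w ->
  exists d p, w * (\prod_(i | mut i) phi (X K i)) ^+ d = phi p.
Proof.
move=> [d [r hr]] [p [q [q0 e f]]]; exists d, r; apply: (mulIf q0).
rewrite mulrAC f -[\prod_(i | _) _]rmorph_prod -[_ ^+ d]rmorphXn -!rmorphM.
congr (phi _); apply/eqP; rewrite -tofrac_eq !rmorphM rmorphXn rmorph_prod /= -e -hr.
by apply/eqP; ring.
Qed.

End Transfer.

(** * The Laurent phenomenon for independent rows *)

Section LaurentPhenomenon.
Variables (K : numFieldType) (V : finType) (mut : pred V).
Local Notation A := (mpoly K #|V|).
Local Notation FA := {fraction A}.
Local Notation Xf := (@Xf K V).
Local Notation exchP := (@exchP K V).
Local Notation Loc := (@Loc K V mut).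
Local Notation Locunit := (@Locunit K V mut).
Implicit Types (B : V -> V -> int) (i j k : V).

Lemma mutseq_opp (F : fieldType) B (x : V -> F) s :
  (mutseq (fun i j => - B i j, x) s).2 = (mutseq (B, x) s).2.
Proof.
elim: s B x => [//|k s IH] B x.
by rewrite /mutseq /= mutate_opp -!/(mutseq _ _) IH.
Qed.

(** Changing the sign of [B] leaves the clusters unchanged and reduces a negative entry to
    [rank2_pos]. If [B k j = 0], the mutations at [k] and [j] commute; the required coprimality is
    then that of two exchange polynomials, and this is where the independence of rows enters. *)
Lemma rank2 B k j : skewB B -> rows_free mut B -> mut k -> mut j -> k != j ->
  exists Y Z uY uZ, let x3 := (mutseq (B, Xf) [:: k; j; k]).2 in
    [/\ x3 j = Y%:F * uY, x3 k = Z%:F * uZ, Locunit uY & Locunit uZ] /\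
    cop (exchP B k) Y /\ cop (exchP B k) Z.
Proof.
move=> sk free mk mj nkj.
case E : (B k j) => [[|be]|be]; first last.
- have := @rank2_pos K V mut (fun i j => - B i j) k j be.
  rewrite E mutseq_opp; have -> : exchP (fun i j => - B i j) k = exchP B k.
    rewrite !exchPE addrC; congr (_ + _); apply: eq_mon => i /=.
    by rewrite opprK.
  by apply=> //= i i'; rewrite sk.
- exact: (rank2_pos K sk mk mj nkj E).
have njk : j != k by rewrite eq_sym.
exists (exchP B j), (X K k), (Xf j)^-1, 1; split; last first.
  by split; [apply: cop_exchP_free free _ _ _|apply: cop_exchP_X].
have dE i : i != k -> mutB B k j i = B j i.
  by move=> ik; rewrite mutBE (negPf njk) (negPf ik) /= [B j k]sk E /= !mul0r addr0 subr0.
have dk : mutB B k j k = 0 by rewrite mutBE eqxx orbT sk opprK E.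
have x2j : (mutseq (B, Xf) [:: k; j]).2 j = (exchP B j)%:F / Xf j.
  rewrite /= mutxE eqxx mutxE (negPf njk) -exch_Xf; congr (_ / _); rewrite /exch.
  have Bjk : B j k = 0 by rewrite sk E.
  by congr (_ + _); apply: eq_bigr => i _; rewrite mutxE;
    have [->|ik] := eqVneq i k; rewrite ?dk ?Bjk ?dE // !expr0.
split.
- by rewrite -x2j /= mutxE (negPf njk).
- rewrite /= mutxE eqxx; set x2 := mutx _ _ j.
  have x2k : x2 k = (exchP B k)%:F / Xf k.
    by rewrite /x2 mutxE (negPf nkj) mutxE eqxx exch_Xf.
  have -> : exch (mutB (mutB B k) j) x2 k = (exchP B k)%:F.
    rewrite -exch_Xf /exch addrC.
    have fE i : mutB (mutB B k) j k i = - B k i.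
      rewrite mutBE (negPf nkj) /=; case: eqP => [->|_].
        by rewrite mutBE eqxx orTb E.
      by rewrite !mutBE eqxx /= E oppr0 /= !mul0r addr0 subr0.
    have x2E i : i != k -> i != j -> x2 i = Xf i.
      by move=> ik ij; rewrite /x2 mutxE (negPf ij) mutxE (negPf ik).
    have Bkk := skew_diag k sk.
    by congr (_ + _); apply: eq_bigr => i _; rewrite fE ?opprK;
      (have [->|ik] := eqVneq i k; first by rewrite Bkk ?oppr0 !expr0);
      (have [->|ij] := eqVneq i j; first by rewrite E ?oppr0 !expr0); rewrite x2E.
  rewrite x2k invf_div mulrCA mulfV; first by rewrite XfE mulr1.
  by rewrite tofrac_eq0 exchP_neq0.
- exact: (LocunitV (LocunitXf K mj)).
- exact: Locunit1.
Qed.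

Lemma Loc_hom (phi : {rmorphism A -> FA}) :
  (forall a, phi (mconst _ a) = (mconst _ a)%:F) -> (forall i, Loc (phi (X K i))) ->
  forall p, Loc (phi p).
Proof.
move=> hc hX; elim/mpoly_ind => [a|n ltn|p q hp hq|p q hp hq].
- by rewrite hc; apply: Loc_tofrac.
- by have := hX (enum_val (Ordinal ltn)); rewrite /X enum_valK.
- by rewrite rmorphD; apply: LocD.
- by rewrite rmorphM; apply: LocM.
Qed.

Local Notation CA := (fun u : FA => exists p q, [/\ 0 < ev1 K V p, 0 < ev1 K V q & u * q%:F = p%:F]).

(** The Laurent expression in the variables of another seed is evaluated at [x], whose entries are
    Laurent in the initial variables; only the mutable [x j] remain as denominators. *)
Lemma Loc_from B' (x : V -> FA) s i :
  (forall j, CA (x j)) -> (forall j, Loc (x j)) -> Loc ((mutseq (B', Xf) s).2 i) ->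
  exists d, Loc ((mutseq (B', x) s).2 i * (\prod_(j | mut j) x j) ^+ d).
Proof.
move=> xC xL hL.
pose e n := if insub n is Some r then x (enum_val (r : 'I_#|V|)) else 0.
pose phi := mhom ((@tofrac _ \o mconst_rmorphism K #|V|) : {rmorphism K -> FA}) e #|V|.
have phiX j : phi (X K j) = x j.
  by rewrite /phi mhom_var // /e valK enum_rankK.
have phic a : phi (mconst _ a) = (mconst _ a)%:F.
  by rewrite /phi mhom_const /= mconst_rmorphismE.
have sp := specializes_mutseq (phi := phi) (semifield_ev1 K V) B' (x := Xf) s xC.
have [|d [p hp]] := Loc_specializes hL (sp _ i).
  by move=> j; rewrite -phiX; apply: specializes_tofrac.
exists d; have -> : \prod_(j | mut j) x j = \prod_(j | mut j) phi (X K j).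
  by apply: eq_bigr => j _; rewrite phiX.
by rewrite hp; apply: Loc_hom => // j; rewrite phiX.
Qed.

(** Seen from [mu_k], the only denominator besides monomials is a power of the exchange polynomial
    at [k]; seen from [mu_k mu_j mu_k], it is a power of [Y * Z]. These are coprime. *)
Theorem laurent B s i : skewB B -> rows_free mut B -> all mut s ->
  Loc ((mutseq (B, Xf) s).2 i).
Proof.
have [n] := ubnP (size s); elim: n B s i => // n IH B s i.
have CX := semifield_Xf K (V := V); have HC := semifield_ev1 K V.
case: s => [_ _ _ _|k s]; first exact: Loc_tofrac.
rewrite /= ltnS => szs sk free /andP[mk ms].
have x1C : forall j, CA (mutx B Xf k j) := semifield_mutx HC B k CX.
have P0 := exchP_neq0 K B k.
have x1k : mutx B Xf k k = (exchP B k)%:F / Xf k by rewrite mutxE eqxx exch_Xf.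
have x1E j : j != k -> mutx B Xf k j = Xf j by move=> jk; rewrite mutxE (negPf jk).
have uk := LocunitXf K mk.
have x1L j : Loc (mutx B Xf k j).
  have [->|jk] := eqVneq j k; last by rewrite x1E //; apply: Loc_tofrac.
  by rewrite x1k; apply: LocM; [apply: Loc_tofrac|case: uk => _ []].
have L1 : exists d, Loc ((mutseq (B, Xf) (k :: s)).2 i * (exchP B k)%:F ^+ d).
  have [d hd] := Loc_from x1C x1L (IH _ s i szs (mutB_skew k sk) (mutB_rows_free sk mk free) ms).
  exists d; rewrite mutseq_cons.
  have uE : Locunit ((Xf k)^-1 * \prod_(j | mut j && (j != k)) mutx B Xf k j).
    apply: LocunitM; first exact: LocunitV.
    by apply: Locunit_prod => j /andP[mj jk]; rewrite x1E //; apply: LocunitXf.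
  apply: (Loc_cancel (LocunitX d uE)).
  by rewrite -mulrA -exprMn mulrA -x1k; move: hd; rewrite (bigD1 k).
case: s szs ms L1 => [|j s] szs.
  move=> _ _; exact: x1L.
move=> /= /andP[mj ms] [d L1].
have [jk|jk] := eqVneq j k.
  have hK : mutate (mutate (B, Xf) k) k = (B, Xf).
    by apply: mutateK => //; [apply: Xf_neq0|rewrite exch_Xf tofrac_eq0].
  rewrite jk /mutseq /= hK; apply: (IH _ s) => //; exact: ltnW.
have kj : k != j by rewrite eq_sym.
have [Y [Z [uY [uZ [[x3j x3k hY hZ] [cY cZ]]]]]] := rank2 sk free mk mj kj.
pose S2 := mutseq (B, Xf) [:: k; j]; pose S3 := mutseq (B, Xf) [:: k; j; k].
have S2C : forall l, CA (S2.2 l) := semifield_mutseq HC B [:: k; j] CX.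
have S3C : forall l, CA (S3.2 l) := semifield_mutseq HC B [:: k; j; k] CX.
have S3E l : l != k -> l != j -> S3.2 l = Xf l by apply: mutseq3.
have S3L l : Loc (S3.2 l).
  have [->|lk] := eqVneq l k.
    by rewrite /S3 x3k; apply: LocM; [apply: Loc_tofrac|case: hZ => _ []].
  have [->|lj] := eqVneq l j.
    by rewrite /S3 x3j; apply: LocM; [apply: Loc_tofrac|case: hY => _ []].
  by rewrite S3E //; apply: Loc_tofrac.
have sk2 : skewB S2.1 by apply: mutB_skew; apply: mutB_skew.
have free2 : rows_free mut S2.1.
  by apply: mutB_rows_free => //; [apply: mutB_skew|apply: mutB_rows_free].
(* One more mutation at [k] returns from [S3] to [S2], so the target is reached from [S3] by
   [k :: s], which is shorter by one and falls under the induction hypothesis. *)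
have S32 : mutate S3 k = S2.
  rewrite /S3 -[[:: k; j; k]]/(rcons [:: k; j] k) mutseq_rcons -/S2 [S2]surjective_pairing.
  apply: mutateK => //; first exact: (semifield_neq0 HC (S2C k)).
  exact: (semifield_neq0 HC (semifield_exch HC _ _ S2C)).
have S31 : S3.1 = mutB S2.1 k by [].
have h3 : Loc ((mutseq (S3.1, Xf) (k :: s)).2 i).
  rewrite S31; apply: IH; [exact: szs|exact: mutB_skew|exact: mutB_rows_free|].
  by rewrite /= mk.
have [e he] := Loc_from S3C S3L h3.
have L3 : Loc ((mutseq (B, Xf) [:: k, j & s]).2 i * (Y * Z)%:F ^+ e).
  have uE : Locunit (uY * uZ * \prod_(l | mut l && (l != k) && (l != j)) Xf l).
    apply: LocunitM; first exact: LocunitM.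
    by apply: Locunit_prod => l /andP[/andP[ml _] _]; apply: LocunitXf.
  apply: (Loc_cancel (LocunitX e uE)); rewrite -[_ * _ * _ ^+ e]mulrA -exprMn.
  have <- : (mutseq (S3.1, S3.2) (k :: s)).2 i = (mutseq (B, Xf) [:: k, j & s]).2 i.
    by rewrite -[(S3.1, S3.2)]surjective_pairing -[LHS]/((mutseq (mutate S3 k) s).2 i) S32.
  move: he; rewrite (bigD1 k) // [in X in Loc X -> _](bigD1 j) ?mj // x3j x3k.
  rewrite (eq_bigr Xf) => [|l /andP[/andP[_ lk] lj]]; last exact: S3E.
  congr (Loc (_ * _ ^+ _)).
  by rewrite tofracM /=; ring.
have YZ0 : Y * Z != 0.
  have := semifield_neq0 HC (S3C j); have := semifield_neq0 HC (S3C k).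
  rewrite /S3 x3k x3j !mulf_eq0 !negb_or !tofrac_eq0 => /andP[-> _] /andP[-> _].
  by [].
exact: (Loc_cop P0 YZ0 (copMr cY cZ) L1 L3).
Qed.

End LaurentPhenomenon.

(** * Principal coefficients *)

Section PrincipalCoefficients.
Variables (V : finType) (mut : pred V).
Implicit Types B : V -> V -> int.

(** The identity block makes the rows of the first copy independent whatever [B] is. *)
Definition principal B (u v : V + V) : int :=
  match u, v with
  | inl i, inl j => B i j
  | inl i, inr j => (i == j)%:Z
  | inr i, inl j => - (i == j)%:Z
  | inr _, inr _ => 0
  end.

Definition mut_inl (u : V + V) := if u is inl i then mut i else false.

Lemma principal_skew B : skewB B -> skewB (principal B).
Proof. by move=> sk [i|i] [j|j] /=; rewrite ?opprK ?oppr0 // eq_sym. Qed.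

Lemma principal_free B : rows_free mut_inl (principal B).
Proof.
move=> c c0 cB [i|i]; last exact: c0.
have := cB (inr i); rewrite big_sumType /= [X in _ + X]big1 => [|j _]; last exact: mulr0.
rewrite addr0 (bigD1 i) //= eqxx mulr1 big1 ?addr0 // => j /negPf ->.
exact: mulr0.
Qed.

(** The second copy is never mutated, so its variables keep the value 1 and drop out of every
    exchange relation; hence [B2] is constrained on the first copy only. *)
Lemma mutseq_principal (F : fieldType) B (B2 : (V + V)%type -> (V + V)%type -> int)
    (x : V -> F) (x2 : (V + V)%type -> F) s i :
  (forall i j, B2 (inl i) (inl j) = B i j) ->
  (forall i, x2 (inl i) = x i) -> (forall i, x2 (inr i) = 1) ->
  (mutseq (B2, x2) (map inl s)).2 (inl i) = (mutseq (B, x) s).2 i.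
Proof.
elim: s B B2 x x2 => [|k s IH] B B2 x x2 hB hl hr; first exact: hl.
rewrite map_cons !mutseq_cons; apply: IH => [i' j|i'|i'].
- by rewrite !mutBE !hB.
- rewrite !mutxE /exch !big_sumType /=.
  rewrite ![X in _ * X + _]big1 => [|j _]; last by rewrite hr expr1n.
  rewrite ![X in _ + _ * X]big1 => [|j _]; last by rewrite hr expr1n.
  rewrite !mulr1 !hl -[inl i' == inl k]/(i' == k); congr (if _ then (_ + _) / _ else _).
    by apply: eq_bigr => j _; rewrite hl hB.
  by apply: eq_bigr => j _; rewrite hl hB.
- by rewrite mutxE hr.
Qed.

End PrincipalCoefficients.

(** * From Laurent expressions at neighbouring seeds to regularity *)

Section Starfish.
Variables (K : numFieldType) (V : finType) (mut : pred V).
Variables (R : idomainType) (kap : {rmorphism K -> R}) (eps : {rmorphism R -> K}).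
Local Notation C := (fun u : {fraction R} =>
  exists p q, [/\ 0 < eps p, 0 < eps q & u * q%:F = p%:F]).

(** Principal coefficients supply the rank condition, and positivity at [eps] keeps the
    specialization to [g] and to 1 defined along all mutations. *)
Lemma laurent_spec (B : V -> V -> int) (g : V -> R) s i :
  skewB B -> (forall j, 0 < eps (g j)) -> all mut s ->
  exists d p, (mutseq (B, fun j => (g j)%:F) s).2 i * (\prod_(j | mut j) g j)%:F ^+ d = p%:F.
Proof.
move=> sk gpos ms; pose W : finType := (V + V)%type.
pose g2 (u : W) : R := if u is inl j then g j else 1.
pose e n := if insub n is Some r then g2 (enum_val (r : 'I_#|W|)) else 0.
pose phiR := mhom kap e #|W|.
have phiX u : phiR (X K u) = g2 u by rewrite /phiR mhom_var // /e valK enum_rankK.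
pose phi : {rmorphism mpoly K #|W| -> {fraction R}} := (@tofrac R \o phiR).
have HC := semifield_frac eps.
have g2C u : C (g2 u)%:F.
  exists (g2 u), 1; rewrite rmorph1 ltr01 mulr1; split=> //.
  by case: u => j /=; rewrite ?rmorph1.
have ms2 : all (mut_inl mut) (map inl s) by rewrite all_map.
have L := laurent K (inl i) (principal_skew sk) (@principal_free V mut B) ms2.
have sp := specializes_mutseq (phi := phi) HC (principal B) (x := @Xf K W)
  (y := fun u => (g2 u)%:F) (map inl s) g2C.
have [|d [p hp]] := Loc_specializes L (sp _ (inl i)).
  move=> u; have := specializes_tofrac phi (X K u).
  by rewrite /phi /= phiX.
exists d, (phiR p); move: hp.
rewrite (@mutseq_principal V _ B _ (fun j => (g j)%:F)) //.
rewrite big_sumType /= big_pred0_eq mulr1 => <-.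
rewrite rmorph_prod /=; congr (_ * _ ^+ _).
by apply: eq_bigr => j _; rewrite phiX.
Qed.

Variables (B : V -> V -> int) (f f' : V -> R).
Hypothesis Bskew : skewB B.
Hypothesis fpos : forall i, 0 < eps (f i).
Hypothesis exchange : forall k, mut k ->
  f k * f' k = \prod_j f j ^+ pe (B k j) + \prod_j f j ^+ pe (- B k j).
Hypothesis fcop : forall i j, mut i -> mut j -> i != j -> cop (f i) (f j).
Hypothesis f'cop : forall k, mut k -> cop (f k) (f' k).

Let x (i : V) : {fraction R} := (f i)%:F.

Let f0 i : f i != 0.
Proof. by apply: contraTneq (fpos i) => ->; rewrite rmorph0 ltxx. Qed.

Let eps_prod (a : V -> nat) : 0 < eps (\prod_j f j ^+ a j).
Proof. by rewrite rmorph_prod prodr_gt0 // => j _; rewrite rmorphXn exprn_gt0. Qed.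

Lemma exch_f k : mut k -> exch B x k = (f k * f' k)%:F.
Proof.
move=> mk; rewrite exchange // rmorphD !rmorph_prod.
by congr (_ + _); apply: eq_bigr => j _; rewrite rmorphXn.
Qed.

Lemma mutate_f k : mut k ->
  mutx B x k = fun i => (if i == k then f' k else f i)%:F.
Proof.
move=> mk; apply: functional_extensionality => i; rewrite mutxE; case: eqP => // _.
by rewrite exch_f // rmorphM mulrAC mulfV ?mul1r // tofrac_eq0.
Qed.

Theorem starfish s i : all mut s ->
  exists P, (mutseq (B, x) s).2 i = P%:F /\ 0 < eps P.
Proof.
move=> ms; set z := (mutseq (B, x) s).2 i.
have [P hP] : exists P, z = P%:F.
  (* Expansion at the seed adjacent in direction [k]: the first mutation of [k :: s] leads back to
     the initial seed, and the denominator now contains [f' k] in place of [f k]. *)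
  have near k : mut k -> exists d p,
      z * (f' k * \prod_(j | mut j && (j != k)) f j)%:F ^+ d = p%:F.
    move=> mk; pose g j := if j == k then f' k else f j.
    have [j||d [p hp]] := @laurent_spec (mutB B k) g (k :: s) i (mutB_skew k Bskew); last 1 first.
    - exists d, p; rewrite -hp -mutate_f // mutseq_cons.
      rewrite -[(mutB (mutB B k) k, _)]/(mutate (mutate (B, x) k) k) mutateK ?tofrac_eq0 //.
        congr (_ * _%:F ^+ _); rewrite [in RHS](bigD1 k) //= /g eqxx; congr (_ * _).
        by apply: eq_bigr => j /andP[_ /negPf ->].
      rewrite exch_f // tofrac_eq0 exchange //; apply/eqP => h.
      have := addr_gt0 (eps_prod (fun j => pe (B k j))) (eps_prod (fun j => pe (- B k j))).
      by rewrite -rmorphD h rmorph0 ltxx.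
    - rewrite /g; case: eqP => // _; rewrite -(pmulr_rgt0 _ (fpos k)) -rmorphM exchange //.
      by rewrite rmorphD addr_gt0.
    - by rewrite /= mk.
  have [d [p hp]] := laurent_spec i Bskew fpos ms.
  (* Denominators are removed one vertex at a time: [f k] is coprime to every factor of the
     denominator obtained at its neighbour. *)
  have clear (r : seq V) : all mut r ->
      forall q, z * (\prod_(j <- r) f j ^+ d)%:F = q%:F -> exists P, z = P%:F.
    elim: r => [_ q|k r IH /= /andP[mk mr] q].
      by rewrite big_nil rmorph1 mulr1; exists q.
    rewrite big_cons => hq; have [e [p' hp']] := near k mk.
    set y := \prod_(j <- r) _ in hq; set h := f' k * _ in hp'.
    have ch : cop (f k) h.
      apply: copMr; first exact: f'cop.
      by apply: cop_prodr => j /andP[mj jk]; apply: fcop; rewrite // eq_sym.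
    have [w wE] : rdvd (f k ^+ d) q.
      apply: (copXl (n := d) (f0 k) (copXr (n := e) ch)); exists (p' * y).
      apply/eqP; rewrite -tofrac_eq !tofracM !tofracXn -hq -hp' !tofracM !tofracXn; apply/eqP.
      by ring.
    apply: (IH mr w); apply: (@mulfI _ ((f k ^+ d)%:F)).
      by rewrite tofrac_eq0 expf_neq0.
    by rewrite mulrCA -tofracM hq wE tofracM.
  apply: (clear (enum mut) _ p); first by apply/allP => j; rewrite mem_enum.
  by rewrite big_enum /= prodrXl tofracXn; exact: hp.
exists P; split=> //.
have HC := semifield_frac eps.
have xC j : C (x j).
  by exists (f j), 1; rewrite rmorph1 ltr01 mulr1.
(* The same element is also a quotient of two elements positive at [eps], which determines the sign
   of [P] there. *)
have [p [q [p0 q0]]] := semifield_mutseq HC B s xC i.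
rewrite -/z hP -tofracM => /eqP; rewrite tofrac_eq => /eqP e.
by rewrite -(pmulr_lgt0 _ q0) -rmorphM e.
Qed.

End Starfish.

(** * Leading terms of the minors *)

Section DetLeadingForm.
Variables (K : fieldType) (m : nat) (w : nat -> nat).
Local Notation A := (mpoly K m).
Variables (p : nat) (E : nat -> nat -> option nat).
Hypothesis E_lt : forall a b e, E a b = Some e -> (e < m)%N.
Hypothesis E_diag : forall a, (a < p)%N -> E a a.
(* The weights are strictly supermodular and the support is closed under sorting, so
   the diagonal term of the determinant is heavier than all the others. *)
Hypothesis E_monge : forall a a' b b' e1 e2, (a < a' < p)%N -> (b < b' < p)%N ->
  E a b' = Some e1 -> E a' b = Some e2 ->
  exists e3 e4, [/\ E a b = Some e3, E a' b' = Some e4 & (w e1 + w e2 < w e3 + w e4)%N].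

Let ent a b : A := if E a b is Some e then mvar K m e else 0.
Let we a b : nat := if E a b is Some e then w e else 0%N.
Let W (s : 'S_p) := (\sum_(a < p) we a (s a))%N.
Let good (s : 'S_p) := [forall a : 'I_p, isSome (E a (s a))].

(** With [a] the smallest moved index, the positions [(a, s a)] and [(s^-1 a, a)] form an inversion;
    exchanging the two values keeps the support and increases the weight by [E_monge]. *)
Let good_improve s : good s -> s != 1%g -> exists2 s', good s' & (W s < W s')%N.
Proof.
move=> /forallP gs s1.
have [a0 sa0] : exists a, s a != a.
  apply/existsP; apply: contraNT s1; rewrite negb_exists => /forallP h.
  by apply/eqP/permP => a; rewrite perm1; apply/eqP; rewrite -[_ == _]negbK h.
case: (@arg_minnP _ a0 (fun a => s a != a) (fun a => val a) sa0) => a sa amin.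
have fixlt (b : 'I_p) : (b < a)%N -> s b = b.
  by move=> ltb; apply/eqP; apply: contraTT ltb => /amin; rewrite -leqNgt.
have gta (c : 'I_p) : c != a -> s c != c -> (a < c)%N.
  by move=> ca /amin le; rewrite ltn_neqAle eq_sym ca.
pose a' := (s^-1)%g a; have sa' : s a' = a by rewrite /a' permKV.
have a'a : a' != a by apply: contraNneq sa => e; rewrite -{1}e sa'.
have lta' : (a < a')%N by apply: gta => //; rewrite sa' eq_sym.
have ltb : (a < s a)%N.
  rewrite ltn_neqAle eq_sym sa leqNgt; apply/negP => lt.
  by have := perm_inj (fixlt _ lt) => e; rewrite e eqxx in sa.
have := gs a; have := gs a'; rewrite sa'.
case e2 : (E a' a) => [e2'|//] _; case e1 : (E a (s a)) => [e1'|//] _.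
have [||e3 [e4 [h3 h4 hw]]] := E_monge _ _ e1 e2; first by rewrite lta' ltn_ord.
  by rewrite ltb ltn_ord.
exists (tperm a a' * s)%g.
  apply/forallP => c; rewrite permM; case: tpermP => [->|->|ca ca'].
  - by rewrite sa' h3.
  - by rewrite h4.
  - exact: gs.
rewrite /W (bigD1 a) //= [X in (_ < X)%N](bigD1 a) //=.
rewrite (bigD1 a') //= [X in (_ < _ + X)%N](bigD1 a') //=.
rewrite !permM tpermL tpermR sa'.
under [X in (_ < _ + (_ + X))%N]eq_bigr => c /andP[ca ca'] do
  rewrite permM tpermD 1?eq_sym //.
by rewrite /we e1 e2 h3 h4 !addnA ltn_add2r.
Qed.

Let good1 : good 1%g.
Proof. by apply/forallP => a; rewrite perm1; apply: E_diag. Qed.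

Let good_max s : good s -> s != 1%g -> (W s < W 1%g)%N.
Proof.
move=> gs s1; have [s' gs' lt] := good_improve gs s1.
case: (arg_maxnP W good1) => t gt tmax.
have [e|t1] := eqVneq t 1%g; first by rewrite -e; exact: leq_trans lt (tmax _ gs').
have [t' gt' lt'] := good_improve gt t1.
by have := leq_trans lt' (tmax t' gt'); rewrite ltnn.
Qed.

Let term (s : 'S_p) := \prod_(a < p) ent a (s a).

Let term0 s : ~~ good s -> term s = 0.
Proof.
rewrite negb_forall => /existsP[a ha]; rewrite /term (bigD1 a) //= /ent.
by case: (E a (s a)) ha => //; rewrite mul0r.
Qed.

Let wgr_term s : good s -> wgr K m w (term s) = (term s)%:P * 'X^(W s).
Proof.
move=> /forallP gs; rewrite /term /W rmorph_prod /= rmorph_prod -prodrXr -big_split /=.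
apply: eq_bigr => a _; rewrite /ent /we; have := gs a.
by case e : (E a (s a)) => [i|//] _; rewrite wgr_var // (E_lt e).
Qed.

Let term_neq0 s : good s -> term s != 0.
Proof.
move=> /forallP gs; apply/prodf_neq0 => a _; rewrite /ent; have := gs a.
by case e : (E a (s a)) => [i|//] _; rewrite mvar_neq0 // (E_lt e).
Qed.

Lemma lform_det :
  lform w (\det (\matrix_(a < p, b < p) ent a b)) = \prod_(a < p) ent a a /\
  \det (\matrix_(a < p, b < p) ent a b) != 0.
Proof.
have dE : \det (\matrix_(a < p, b < p) ent a b) =
    term 1%g + \sum_(s : 'S_p | s != 1%g) (-1) ^+ s * term s.
  rewrite /determinant (bigD1 1%g) //= odd_perm1 expr0 mul1r.
  congr (_ + _); first by apply: eq_bigr => a _; rewrite mxE.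
  by apply: eq_bigr => s _; congr (_ * _); apply: eq_bigr => a _; rewrite mxE.
have s1 : size (wgr K m w (term 1%g)) = (W 1%g).+1.
  by rewrite wgr_term // size_Cmul ?term_neq0 // size_polyXn.
have szr : (size (wgr K m w (\sum_(s : 'S_p | s != 1%g) (-1) ^+ s * term s)%R) <= W 1%g)%N.
  rewrite rmorph_sum; elim/big_rec: _ => [|s q s1' IH]; first by rewrite size_poly0.
  apply: (leq_trans (size_polyD _ _)); rewrite geq_max IH andbT.
  have [gs|/term0 ->] := boolP (good s); last by rewrite mulr0 rmorph0 size_poly0.
  rewrite rmorphM rmorphXn rmorphN rmorph1 -signr_odd mulr_sign.
  case: ifP => _; rewrite ?size_polyN wgr_term // size_Cmul ?term_neq0 // size_polyXn;
    exact: good_max.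
have lf : lform w (\det (\matrix_(a < p, b < p) ent a b)) = \prod_(a < p) ent a a.
  rewrite dE /lform rmorphD lead_coefDl ?s1 ?ltnS // wgr_term //.
  rewrite lead_coefM lead_coefXn lead_coefC mulr1 /term.
  by apply: eq_bigr => a _; rewrite perm1.
split=> //; rewrite -(lform_eq0 w) lf.
have := term_neq0 good1; congr (_ != _).
by apply: eq_bigr => a _; rewrite perm1.
Qed.

End DetLeadingForm.

Section Lattice.
Variable n : nat.
Hypothesis n1 : (1 < n)%N.
Local Open Scope nat_scope.

Lemma UposE b a bc d : a < n.-1 -> d < n.+1 ->
  Upos n (b * n.-1 + a) (bc * n.+1 + d) =
  if bc == b then (if d == 0 then None else Some (a, d.-1))
  else if bc == b.+1 then (if d == n then None else Some (a.+1, d)) else None.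
Proof.
move=> la ld; rewrite /Upos !divnMDl // ?modnMDl; last by lia.
by rewrite (divn_small la) (divn_small ld) (modn_small la) (modn_small ld) !addn0.
Qed.

Variant Upos_spec r c i j : Prop :=
| UposY b of i < n.-1 & r = b * n.-1 + i & c = b * n.+1 + j.+1
| UposX b a of a < n.-1 & i = a.+1 & r = b * n.-1 + a & c = b.+1 * n.+1 + j.

Lemma UposP r c i j : Upos n r c = Some (i, j) -> j < n /\ Upos_spec r c i j.
Proof.
have n0 : 0 < n.-1 by lia.
rewrite {1}(divn_eq r n.-1) {1}(divn_eq c n.+1) UposE ?ltn_mod //.
case: eqP => [e|_].
  case: eqP => // d0 [<- <-]; have dn : c %% n.+1 < n.+1 by rewrite ltn_mod.
  split; first by lia.
  have cE := divn_eq c n.+1; rewrite e in cE.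
  apply: (UposY (b := r %/ n.-1)); [by rewrite ltn_mod|exact: divn_eq|].
  by rewrite {1}cE prednK // lt0n; apply/eqP.
case: eqP => // e; case: eqP => // dn [<- <-].
have dn' : c %% n.+1 < n.+1 by rewrite ltn_mod.
split; first by lia.
have cE := divn_eq c n.+1; rewrite e in cE.
apply: (UposX (b := r %/ n.-1) (a := r %% n.-1)) => //; [by rewrite ltn_mod|exact: divn_eq].
Qed.

Lemma Upos_Y b i j : i < n.-1 -> j < n -> Upos n (b * n.-1 + i) (b * n.+1 + j.+1) = Some (i, j).
Proof. by move=> li lj; rewrite UposE // eqxx. Qed.

Lemma Upos_X b a j : a < n.-1 -> j < n ->
  Upos n (b * n.-1 + a) (b.+1 * n.+1 + j) = Some (a.+1, j).
Proof.
by move=> la lj; rewrite UposE ?ltnS ?(ltnW lj) // gtn_eqF // eqxx ltn_eqF.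
Qed.

(** [Upos] is defined for all indices, so U continues periodically beyond its borders; border cases
    of the exchange relations use this. *)
Lemma Upos_shift r c : Upos n (r + n.-1) (c + n.+1) = Upos n r c.
Proof.
have n0 : 0 < n.-1 by lia.
rewrite [r](divn_eq r n.-1) [c](divn_eq c n.+1).
rewrite [X in Upos n X _](_ : _ = (r %/ n.-1).+1 * n.-1 + r %% n.-1); last by rewrite mulSn; lia.
rewrite [X in Upos n _ X](_ : _ = (c %/ n.+1).+1 * n.+1 + c %% n.+1); last by rewrite mulSn; lia.
by rewrite !UposE ?ltn_mod.
Qed.

Definition Uidx r c : option nat := if Upos n r c is Some (i, j) then Some (i * n + j) else None.

(* [i^2] and [- j^2] make the weights of two diagonally adjacent blocks of [U]
   supermodular, [i j] those inside a block. *)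
Definition wU (e : nat) : nat :=
  let i := e %/ n in let j := e %% n in n * (i * i) + n * (n * n - j * j) + i * j.

(** Moving [n j^2] to the left removes the truncated subtraction, so that weights can be compared as
    polynomials. *)
Lemma wUE i j : j < n -> wU (i * n + j) + n * (j * j) = n * (i * i) + n * (n * n) + i * j.
Proof.
move=> lj; rewrite /wU divnMDl ?modnMDl; last by lia.
rewrite (divn_small lj) (modn_small lj) addn0.
have : j * j <= n * n by apply: leq_mul; apply: ltnW.
by rewrite mulnBr; have := leq_mul2l n (j * j) (n * n); lia.
Qed.

Lemma Uidx_lt r c e : Uidx r c = Some e -> e < n * n.
Proof.
rewrite /Uidx; case E : (Upos n r c) => [[i j]|//] [<-].
have [lj sp] := UposP E; have li : i < n by case: sp; lia.
by have := leq_mul2r n i.+1 n; rewrite li orbT; lia.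
Qed.

Lemma ltn_block b a b' a' q : a < q -> a' < q -> b * q + a < b' * q + a' -> b <= b'.
Proof.
move=> la la' h; rewrite leqNgt; apply/negP => hb.
by have := leq_mul2r q b'.+1 b; rewrite hb orbT mulSn; lia.
Qed.

(** The entries at [(r, c')] and [(r', c)] lie in one block, or the former lies in an X block and
    the latter in the Y block to its left or below it. The gain comes from [i j] in one block, from
    [i^2] for Y to the left and from [- j^2] for Y below; the opposite order of X and Y is
    impossible. *)
Lemma Uidx_monge r r' c c' e1 e2 : r < r' -> c < c' ->
  Uidx r c' = Some e1 -> Uidx r' c = Some e2 ->
  exists e3 e4, [/\ Uidx r c = Some e3, Uidx r' c' = Some e4 & wU e1 + wU e2 < wU e3 + wU e4].
Proof.
move=> lr lc; rewrite {1 2}/Uidx.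
case E1 : (Upos n r c') => [[i1 j1]|//] [<-]; case E2 : (Upos n r' c) => [[i2 j2]|//] [<-].
have [lj1 s1] := UposP E1; have [lj2 s2] := UposP E2; rewrite /Uidx.
case: s1 => [b h1 h2 h3|b a h1 h2 h3 h4]; case: s2 => [b' h1' h2' h3'|b' a' h1' h2' h3' h4'].
- have bb' : b <= b' by apply: (@ltn_block b i1 b' i2 n.-1); rewrite // -h2 -h2'.
  have b'b : b' <= b by apply: (@ltn_block b' j2.+1 b j1.+1 n.+1); rewrite // -h3 -h3'.
  have e : b' = b by apply/eqP; rewrite eqn_leq b'b bb'.
  rewrite {}e in h2' h3'; rewrite h2 h2' h3 h3' !Upos_Y //.
  exists (i1 * n + j2), (i2 * n + j1); split=> //.
  have [x xE] : exists x, i2 = i1 + x.+1 by exists (i2 - i1).-1; lia.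
  have [y yE] : exists y, j1 = j2 + y.+1 by exists (j1 - j2).-1; lia.
  have := wUE i1 lj1; have := wUE i2 lj2; have := wUE i1 lj2; have := wUE i2 lj1.
  by rewrite xE yE; lia.
- have bb' : b <= b' by apply: (@ltn_block b i1 b' a' n.-1); rewrite // -h2 -h3'.
  have : b'.+1 <= b by apply: (@ltn_block b'.+1 j2 b j1.+1 n.+1); rewrite -?h4' -?h3 //; lia.
  by lia.
- have bb' : b <= b' by apply: (@ltn_block b a b' i2 n.-1); rewrite // -h3 -h2'.
  have b'b : b' <= b.+1.
    by apply: (@ltn_block b' j2.+1 b.+1 j1 n.+1); rewrite -?h4 -?h3' //; lia.
  have [e|e] : b' = b \/ b' = b.+1 by lia.
    rewrite {}e in h2' h3'; rewrite h3 h2' h4 h3' Upos_Y // Upos_X //.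
    exists (a * n + j2), (i2.+1 * n + j1); split=> //.
    have [x xE] : exists x, i2 = a + x.+1 by exists (i2 - a).-1; lia.
    have := wUE i1 lj1; have := wUE i2 lj2; have := wUE a lj2; have := wUE i2.+1 lj1.
    have := leq_mul2l x.+1 j2.+1 n; rewrite lj2 orbT.
    by rewrite h2 xE; lia.
  rewrite {}e in h2' h3'.
  have lj : j2.+1 < j1 by move: lc; rewrite h4 h3'; lia.
  have -> : Upos n r c = Some (a.+1, j2.+1) by rewrite h3 h3' Upos_X //; lia.
  have -> : Upos n r' c' = Some (i2, j1.-1).
    by rewrite h2' h4 -(prednK (ltn_trans (ltn0Sn _) lj)) Upos_Y //=; lia.
  exists (a.+1 * n + j2.+1), (i2 * n + j1.-1); split=> //.
  have lj2' : j2.+1 < n by lia.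
  have lj1' : j1.-1 < n by lia.
  have [y yE] : exists y, j1 = j2 + y.+2 by exists (j1 - j2).-2; lia.
  have := wUE i1 lj1; have := wUE i2 lj2; have := wUE a.+1 lj2'; have := wUE i2 lj1'.
  have := leq_mul2l y.+1 i1 n; have li : i1 <= n by lia.
  rewrite li orbT.
  have -> : j1.-1 = j2 + y.+1 by lia.
  have : 0 < n * y.+1 by rewrite muln_gt0; lia.
  by rewrite h2 yE; lia.
- have bb' : b <= b' by apply: (@ltn_block b a b' a' n.-1); rewrite // -h3 -h3'.
  have b'b : b'.+1 <= b.+1.
    by apply: (@ltn_block b'.+1 j2 b.+1 j1 n.+1); rewrite -?h4 -?h4' //; lia.
  have e : b' = b by lia.
  rewrite {}e in h3' h4'; rewrite h3 h4 h3' h4' !Upos_X //.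
  exists (a.+1 * n + j2), (a'.+1 * n + j1); split=> //.
  have [x xE] : exists x, a' = a + x.+1 by exists (a' - a).-1; lia.
  have [y yE] : exists y, j1 = j2 + y.+1 by exists (j1 - j2).-1; lia.
  have := wUE i1 lj1; have := wUE i2 lj2; have := wUE a.+1 lj2; have := wUE a'.+1 lj1.
  by rewrite h2 h2' xE yE; lia.
Qed.

End Lattice.

(** * Exchange relations of the initial seed *)

Section Arrows.
Variable n : nat.
Hypothesis n1 : (1 < n)%N.
Local Open Scope nat_scope.

(** All arrows, the wrap-around ones included, are steps to the West, North or South-East on a grid
    glued along its borders. In the index [i n + j], West is always [- 1]. *)
Definition hasW i j i' j' := [|| (i == i') && (j == j'.+1) | [&& j == 0, j' == n.-1 & i == i'.+1]].
Definition hasN i j i' j' := [|| (i == i'.+1) && (j == j') | [&& i == 0, i' == n.-1 & j' == j.+1]].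
Definition hasSE i j i' j' :=
  [|| (i' == i.+1) && (j' == j.+1), [&& i == n.-1, i' == 0, j == j', 0 < j & j < n.-1]
    | [&& j == n.-1, j' == 0 & i' == i.+2]].

Definition frozen3 i j := [|| (i == 0) && (j == 0), (i == 0) && (j == n.-1) | (i == 1) && (j == 0)].

Let or2 (a b x y : bool) : a = x -> b = y -> ~~ (x && y) -> a + b = (x || y).
Proof. by move=> -> ->; case: x; case: y. Qed.

Let or3 (a b c x y z : bool) : a = x -> b = y -> c = z ->
  ~~ (x && y) -> ~~ (x && z) -> ~~ (y && z) -> a + b + c = [|| x, y | z].
Proof. by move=> -> -> ->; case: x; case: y; case: z. Qed.

Let regroup (a b c d e f g : nat) :
  a + b + c + d + e + f + g = (a + g) + (b + e) + (c + d + f).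
Proof. by lia. Qed.

Lemma narr_out i j i' j' : i < n -> j < n -> i' < n -> j' < n -> ~~ frozen3 i j ->
  narr n i.+1 j.+1 i'.+1 j'.+1 = hasW i j i' j' + hasN i j i' j' + hasSE i j i' j'.
Proof.
move=> li lj li' lj' fr; have [f1 f2 f3] : [/\ ~~ ((i == 0) && (j == 0)),
    ~~ ((i == 0) && (j == n.-1)) & ~~ ((i == 1) && (j == 0))].
  by move: fr; rewrite /frozen3 !negb_or => /and3P.
rewrite /narr regroup /hasW /hasN /hasSE; congr (_ + _ + _).
- by apply: or2; [apply/idP/idP; lia|apply/idP/idP; lia|lia].
- by apply: or2; [apply/idP/idP; lia|apply/idP/idP; lia|lia].
- by apply: or3; [apply/idP/idP; lia|apply/idP/idP; lia|apply/idP/idP; lia|lia|lia|lia].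
Qed.

(** The two exclusions are the steps from [(1, n)] to [(1, n - 1)] and from [(1, 1)] to [(n, 2)], in
    1-based coordinates. They are absent from the quiver and start at frozen vertices, hence do not
    show in [narr_out]. *)
Lemma narr_in i j i' j' : i < n -> j < n -> i' < n -> j' < n -> ~~ frozen3 i j ->
  narr n i'.+1 j'.+1 i.+1 j.+1 =
  (hasW i' j' i j && ~~ ((i == 0) && (j == n.-2)))
  + (hasN i' j' i j && ~~ ((i == n.-1) && (j == 1))) + hasSE i' j' i j.
Proof.
move=> li lj li' lj' fr; have [f1 f2 f3] : [/\ ~~ ((i == 0) && (j == 0)),
    ~~ ((i == 0) && (j == n.-1)) & ~~ ((i == 1) && (j == 0))].
  by move: fr; rewrite /frozen3 !negb_or => /and3P.
rewrite /narr regroup /hasW /hasN /hasSE !andb_orl; congr (_ + _ + _).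
- by apply: or2; [apply/idP/idP; lia|apply/idP/idP; lia|lia].
- by apply: or2; [apply/idP/idP; lia|apply/idP/idP; lia|lia].
- by apply: or3; [apply/idP/idP; lia|apply/idP/idP; lia|apply/idP/idP; lia|lia|lia|lia].
Qed.

(** Naming the difference and splitting off its small values brings comparisons of products such as
    [i * n] and [i' * n] within linear arithmetic. *)
Let offset (i i' : nat) : exists d, i = i' + d \/ i' = i + d.
Proof. by case: (leqP i i') => h; [exists (i' - i); right|exists (i - i'); left]; lia. Qed.

Let offset3 (d : nat) : [\/ d = 0, d = 1 | exists d', d = d'.+2].
Proof. by case: d => [|[|d]]; [constructor 1|constructor 2|constructor 3; exists d]. Qed.

Let offset4 (d : nat) : [\/ d = 0, d = 1, d = 2 | exists d', d = d'.+3].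
Proof.
case: d => [|[|[|d]]]; [constructor 1|constructor 2|constructor 3|constructor 4] => //.
by exists d.
Qed.

Lemma hasWE i j i' j' : i < n -> j < n -> i' < n -> j' < n ->
  hasW i j i' j' = (i * n + j == (i' * n + j').+1).
Proof.
move=> li lj li' lj'; rewrite /hasW; have [d [->|->]] := offset i i';
  case: (offset3 d) => [->|->|[d' ->]]; apply/idP/idP; lia.
Qed.

Lemma hasNE i j i' j' : i < n -> j < n -> i' < n -> j' < n ->
  hasN i j i' j' = (i * n + j == i' * n + j' + n) || (i' * n + j' + n == i * n + j + (n * n).+1).
Proof.
move=> li lj li' lj'; rewrite /hasN; congr (_ || _).
  have [d [->|->]] := offset i i'; case: (offset3 d) => [->|->|[d' ->]]; apply/idP/idP; lia.
have [x xE] : exists x, n = i'.+1 + x by exists (n - i'.+1); lia.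
have nn : n * n = i' * n + n + x * n by rewrite {1}xE; lia.
rewrite nn; case: i li => [|i] li; case: x xE nn => [|x] xE nn; apply/idP/idP; lia.
Qed.

Lemma hasSEE i j i' j' : i < n -> j < n -> i' < n -> j' < n ->
  hasSE i j i' j' = (i' * n + j' == i * n + j + n.+1) ||
    [&& i' * n + j' + n * n == i * n + j + n, 0 < i' * n + j' & i' * n + j' < n.-1].
Proof.
move=> li lj li' lj'; rewrite /hasSE orbCA orbA orbAC -orbA orbC; congr (_ || _).
  have [d [->|->]] := offset i i'; case: (offset4 d) => [->|->|->|[d' ->]]; apply/idP/idP; lia.
have [x xE] : exists x, n = i.+1 + x by exists (n - i.+1); lia.
have nn : n * n = i * n + n + x * n by rewrite {1}xE; lia.
rewrite nn; case: i' li' => [|i'] li'; case: x xE nn => [|x] xE nn; apply/idP/idP; lia.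
Qed.

End Arrows.

Section ExchangeProducts.
Variable n : nat.
Hypothesis n1 : (1 < n)%N.

Definition vidx (v : vtx n) : nat := (v.1 * n + v.2)%N.

Lemma vidx_lt v : (vidx v < n * n)%N.
Proof.
case: v => i j; rewrite /vidx /=; have := leq_mul2r n i.+1 n.
by rewrite ltn_ord orbT; have := ltn_ord j; lia.
Qed.

Lemma vidx_div v : (vidx v %/ n = v.1)%N.
Proof. by rewrite /vidx divnMDl ?divn_small ?addn0 //; lia. Qed.

Lemma vidx_mod v : (vidx v %% n = v.2)%N.
Proof. by rewrite /vidx modnMDl modn_small. Qed.

Lemma vidx_inj : injective vidx.
Proof.
move=> u v e; rewrite [u]surjective_pairing [v]surjective_pairing; congr pair; apply: val_inj.
  by rewrite /= -[RHS]vidx_div -e vidx_div.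
by rewrite /= -[RHS]vidx_mod -e vidx_mod.
Qed.

Lemma vidx_surj t : (t < n * n)%N -> exists v, vidx v = t.
Proof.
move=> lt; have n0 : (0 < n)%N by lia.
have l1 : (t %/ n < n)%N by rewrite ltn_divLR.
have l2 : (t %% n < n)%N by rewrite ltn_mod.
by exists (Ordinal l1, Ordinal l2); rewrite /vidx /= -divn_eq.
Qed.

Variables (S : comNzRingType) (fv : nat -> S).

Lemma prod_pick (b : nat -> bool) t : (t < n * n)%N ->
  (forall s, (s < n * n)%N -> b s = (s == t)) ->
  \prod_(u : vtx n) fv (vidx u) ^+ b (vidx u) = fv t.
Proof.
move=> lt hb; have [v vE] := vidx_surj lt.
rewrite (bigD1 v) //= big1 ?mulr1 => [|u nu].
  by rewrite hb ?vidx_lt // vE eqxx.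
by rewrite hb ?vidx_lt // -vE (inj_eq vidx_inj) (negPf nu).
Qed.

Lemma prod_none (b : nat -> bool) : (forall s, (s < n * n)%N -> b s = false) ->
  \prod_(u : vtx n) fv (vidx u) ^+ b (vidx u) = 1.
Proof. by move=> hb; rewrite big1 // => u _; rewrite hb ?vidx_lt. Qed.

(* Functions at the six neighbours of the vertex [e = i n + j]; the quiver wraps around
   the borders, and a missing neighbour contributes 1. *)
Definition nbrW e := fv e.-1.
Definition nbrN e := if (n <= e)%N then fv (e - n) else fv (e + (n * n).+1 - n).
Definition nbrSE e := if (e + n.+1 < n * n)%N then fv (e + n.+1)
  else if (n * n - n < e < (n * n).-1)%N then fv (e + n - n * n) else 1.
Definition nbrE e := if (e == n.-2) || (e == (n * n).-1) then 1 else fv e.+1.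
Definition nbrS e := if (e + n < n * n)%N then fv (e + n)
  else if ((n * n - n).+1 < e)%N then fv (e + n - (n * n).+1) else 1.
Definition nbrNW e := if (n < e)%N then fv (e - n.+1) else fv (e + n * n - n).

Definition mobile e := [&& 0 < e, e != n.-1, e != n & e < n * n]%N.

Let outW (e t : nat) := (e == t.+1)%N.
Let outN (e t : nat) := ((e == t + n) || (t + n == e + (n * n).+1))%N.
Let outSE (e t : nat) := ((t == e + n.+1) || [&& t + n * n == e + n, 0 < t & t < n.-1])%N.
Let inE (e t : nat) := (outW t e && (e != n.-2))%N.
Let inS (e t : nat) := (outN t e && (e != (n * n - n).+1))%N.
Let inNW (e t : nat) := outSE t e.

Let nn2 : (n + n <= n * n)%N.
Proof. by have := leq_mul2r n 2 n; rewrite n1 orbT; lia. Qed.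

Let nn_neq : (n * n != n + n.+1)%N.
Proof.
have [->|n2] := eqVneq n 2; first by [].
have := leq_mul2r n 3 n; have -> : (2 < n)%N by lia.
by rewrite orbT; lia.
Qed.

Lemma nbr_outE v e : e = vidx v -> mobile e ->
  \prod_u fv (vidx u) ^+ outW e (vidx u) = nbrW e /\
  \prod_u fv (vidx u) ^+ outN e (vidx u) = nbrN e /\
  \prod_u fv (vidx u) ^+ outSE e (vidx u) = nbrSE e.
Proof.
move=> eE /and4P[e0 e1 e2 e3]; split; last split.
- by apply: prod_pick => [|s ls]; [|apply/idP/idP]; rewrite /outW; lia.
- rewrite /nbrN; case: leqP => h; apply: prod_pick => [|s ls]; [|apply/idP/idP| |apply/idP/idP];
    rewrite /outN; lia.
- rewrite /nbrSE; case: ltnP => h.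
    by apply: prod_pick => [|s ls]; [|apply/idP/idP]; rewrite /outSE; lia.
  case: ifP => h'.
    by apply: prod_pick => [|s ls]; [|apply/idP/idP]; rewrite /outSE; lia.
  by apply: prod_none => s ls; apply/negbTE; rewrite /outSE; lia.
Qed.

Lemma nbr_inE v e : e = vidx v -> mobile e ->
  \prod_u fv (vidx u) ^+ inE e (vidx u) = nbrE e /\
  \prod_u fv (vidx u) ^+ inS e (vidx u) = nbrS e /\
  \prod_u fv (vidx u) ^+ inNW e (vidx u) = nbrNW e.
Proof.
move=> eE /and4P[e0 e1 e2 e3]; split; last split.
- rewrite /nbrE; case: ifP => h.
    by apply: prod_none => s ls; apply/negbTE; rewrite /inE /outW; lia.
  by apply: prod_pick => [|s ls]; [|apply/idP/idP]; rewrite /inE /outW; lia.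
- rewrite /nbrS; case: ltnP => h.
    by apply: prod_pick => [|s ls]; [|apply/idP/idP]; rewrite /inS /outN; lia.
  case: ifP => h'.
    by apply: prod_pick => [|s ls]; [|apply/idP/idP]; rewrite /inS /outN; lia.
  by apply: prod_none => s ls; apply/negbTE; rewrite /inS /outN; lia.
- rewrite /nbrNW; case: ltnP => h.
    by apply: prod_pick => [|s ls]; [|apply/idP/idP]; rewrite /inNW /outSE; lia.
  by apply: prod_pick => [|s ls]; [|apply/idP/idP]; rewrite /inNW /outSE; lia.
Qed.

Lemma mobileE v : mobile (vidx v) = ~~ frozen3 n v.1 v.2.
Proof.
rewrite /mobile /frozen3 vidx_lt /vidx; case: v => i j /=.
have := ltn_ord i; have := ltn_ord j; move: (val i) (val j) => a b lb la.
by case: a la => [|[|a]] la; apply/idP/idP; lia.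
Qed.

Lemma exchange_products (v : vtx n) : ~~ frozen3 n v.1 v.2 ->
  \prod_u fv (vidx u) ^+ pe (BMat v u) =
    nbrW (vidx v) * nbrN (vidx v) * nbrSE (vidx v) /\
  \prod_u fv (vidx u) ^+ pe (- BMat v u) =
    nbrE (vidx v) * nbrS (vidx v) * nbrNW (vidx v).
Proof.
move=> fr; set e := vidx v; have me : mobile e by rewrite mobileE.
have out (u : vtx n) : narr n v.1.+1 v.2.+1 u.1.+1 u.2.+1 =
    (outW e (vidx u) + outN e (vidx u) + outSE e (vidx u))%N.
  by rewrite narr_out // hasWE // hasNE // hasSEE.
have inn (u : vtx n) : narr n u.1.+1 u.2.+1 v.1.+1 v.2.+1 =
    (inE e (vidx u) + inS e (vidx u) + inNW e (vidx u))%N.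
  rewrite narr_in // hasWE // hasNE // hasSEE //.
  rewrite /inE /inS /inNW; have := ltn_ord v.1; have := ltn_ord v.2 => lv2 lv1.
  congr ((_ && _) + (_ && _) + _)%N.
    rewrite /e /vidx; case: (val v.1) => [|a]; first by [].
    by symmetry; apply/idP/idP; lia.
  have [x xE] : exists x, n = (v.1.+1 + x)%N by exists (n - v.1.+1)%N; lia.
  have nn : (n * n = v.1 * n + n + x * n)%N by rewrite {1}xE; lia.
  rewrite /e /vidx nn; case: x xE nn => [|x] xE nn.
    by congr (~~ _); apply/idP/idP; lia.
  by congr (~~ _); apply/idP/idP; lia.
have [pW [pN pSE]] := nbr_outE (erefl e) me.
have [pE [pS pNW]] := nbr_inE (erefl e) me.
(* No vertex is joined to [v] by arrows in both directions, so nothing cancels in [BMat] and its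
   positive parts count arrows. *)
have disj (u : vtx n) : (outW e (vidx u) + outN e (vidx u) + outSE e (vidx u) = 0)%N \/
    (inE e (vidx u) + inS e (vidx u) + inNW e (vidx u) = 0)%N.
  suff : ~~ ([|| outW e (vidx u), outN e (vidx u) | outSE e (vidx u)] &&
             [|| inE e (vidx u), inS e (vidx u) | inNW e (vidx u)]).
    by case: (outW _ _) (outN _ _) (outSE _ _) (inE _ _) (inS _ _) (inNW _ _)
      => [] [] [] [] [] []; auto.
  have := vidx_lt u; case/and4P: me => e0 e1 e2 e3; move: (vidx u) => t lt.
  apply/negP => /andP[h1 h2]; move: h1 h2; rewrite /outW /outN /outSE /inE /inS /inNW /outW /outN /outSE.
  by case/or3P => h1; case/or3P => h2; lia.
split.
  rewrite -pW -pN -pSE -!big_split /=; apply: eq_bigr => u _; rewrite -!exprD.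
  by congr (_ ^+ _); rewrite /BMat out inn; case: (disj u) => ->; rewrite ?subr0 // sub0r; case: (_ + _ + _)%N.
rewrite -pE -pS -pNW -!big_split /=; apply: eq_bigr => u _; rewrite -!exprD.
by congr (_ ^+ _); rewrite /BMat out inn opprB; case: (disj u) => ->; rewrite ?subr0 // sub0r; case: (_ + _ + _)%N.
Qed.

End ExchangeProducts.

(** * Coprimality from disjoint leading monomials *)

Section MonomialLead.
Variables (K : fieldType) (m : nat) (w : nat -> nat) (fam : nat -> nat).
Local Notation R := (mpoly K m).
Local Notation y := (mvar K m).
Local Notation lf := (lform w).
Local Notation wd := (wdeg w).
Implicit Types (f g : R) (c : nat).

Definition lead_in (P : pred nat) f :=
  exists l : seq nat, lf f = \prod_(e <- l) y e /\ all (fun e => (e < m)%N && P e) l.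

Lemma lead_in1 (P : pred nat) : lead_in P 1.
Proof. by exists [::]; rewrite big_nil lform1. Qed.

Lemma lead_inM (P : pred nat) f g : lead_in P f -> lead_in P g -> lead_in P (f * g).
Proof.
move=> [l [e h]] [l' [e' h']]; exists (l ++ l').
by rewrite lformM e e' big_cat all_cat h h'.
Qed.

Lemma lead_inW (P Q : pred nat) f : (forall e, P e -> Q e) -> lead_in P f -> lead_in Q f.
Proof.
move=> PQ [l [e h]]; exists l; split=> //; apply: sub_all h => i /andP[-> /PQ ->].
by [].
Qed.

Lemma lead_in_neq0 (P : pred nat) f : lead_in P f -> f != 0.
Proof.
move=> [l [e h]]; rewrite -(lform_eq0 w) e prodf_seq_neq0.
by apply: sub_all h => i /andP[li _]; rewrite mvar_neq0.
Qed.

Lemma cop_lead_in (P Q : pred nat) f g : (forall e, P e -> ~~ Q e) ->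
  lead_in P f -> lead_in Q g -> cop f g.
Proof.
move=> PQ hf [l' [e' h']]; have f0 := lead_in_neq0 hf; case: hf => l [e h].
have lf0 : lf f != 0 by rewrite lform_eq0.
apply: (cop_lform (w := w) f0); rewrite e'; elim: l' h' {e' g} => [_|i l' IH].
  by rewrite big_nil; apply: copr1.
rewrite big_cons => /= /andP[/andP[li Qi] h']; apply: copMr; last exact: IH.
move: lf0; rewrite e; elim: l h {e} => [_ _|j l IHl /= /andP[/andP[lj Pj] h]].
  by rewrite big_nil; apply: cop1r.
rewrite big_cons mulf_eq0 negb_or => /andP[j0 l0].
apply: copMl => //; last exact: IHl.
by apply: cop_mvar => //; apply: contraL Qi => /eqP <-; apply: PQ.
Qed.

Lemma cop_mvar_lform i f : (i < m)%N -> lead_in (fun e => e != i) f -> cop (y i) (lf f).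
Proof.
move=> lim [l [-> h]]; elim: l h => [|j l IH] /= => [_|/andP[/andP[lj nj] /IH hl]].
  by rewrite big_nil; apply: copr1.
by rewrite big_cons; apply: copMr => //; apply: cop_mvar; rewrite // eq_sym.
Qed.

Lemma rdvd_mvar1 i : (i < m)%N -> ~ rdvd (y i) 1.
Proof.
by move=> lim /(rdvd_mkill lim) /eqP; rewrite rmorph1 oner_eq0.
Qed.

Lemma rdvd_coef_wgr t f D : (wd f <= D)%N -> rdvd t (lf f) -> rdvd t (wgr K m w f)`_D.
Proof.
rewrite leq_eqVlt => /predU1P[<- //|lt _]; exists 0; rewrite mulr0 nth_default //.
by move: lt; rewrite /wdeg; case: (size _).
Qed.

Lemma coef_wgr_wdeg f : (wgr K m w f)`_(wd f) = lf f.
Proof. by []. Qed.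

Lemma wdegD_leq f g D : (wd f <= D)%N -> (wd g <= D)%N -> (wd (f + g)%R <= D)%N.
Proof.
rewrite /wdeg rmorphD => hf hg; have := size_polyD (wgr K m w f) (wgr K m w g).
by move: (size _) (size _) (size _) hf hg => a b d; lia.
Qed.

End MonomialLead.

(** * Coprimality inside one chain *)

Section Chain.
Variables (K : fieldType) (m : nat) (w : nat -> nat) (fam : nat -> nat) (c L : nat).
Local Notation R := (mpoly K m).
Local Notation y := (mvar K m).
Local Notation lf := (lform w).
Local Notation wd := (wdeg w).
Variables (g g' al be : nat -> R) (xv : nat -> nat).
Let notc e := fam e != c.
Hypothesis g0 : g 0 = 1.
Hypothesis lf_g : forall p, (p < L)%N -> lf (g p.+1) = lf (g p) * y (xv p.+1).
Hypothesis xv_lt : forall p, (0 < p <= L)%N -> (xv p < m)%N.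
Hypothesis xv_fam : forall p, (0 < p <= L)%N -> fam (xv p) = c.
Hypothesis xv_inj : forall p p', (0 < p <= L)%N -> (0 < p' <= L)%N -> xv p = xv p' -> p = p'.
Hypothesis lead_al : forall p, (0 < p < L)%N -> lead_in w notc (al p).
Hypothesis lead_be : forall p, (0 < p < L)%N -> lead_in w notc (be p).
Hypothesis rel : forall p, (0 < p < L)%N ->
  g p * g' p = al p * g p.-1 + be p * g p.+1.

Let upto (p e : nat) := has (fun s => e == xv s) (iota 1 p).
Let beyond (p e : nat) := (fam e != c) || has (fun s => e == xv s) (iota p.+1 (L - p)).

Let lead_g p : (p <= L)%N -> lead_in w (upto p) (g p).
Proof.
elim: p => [_|p IH lt]; first by rewrite g0; apply: lead_in1.
have [l [e h]] := IH (ltnW lt); exists (xv p.+1 :: l).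
rewrite lf_g // e big_cons mulrC; split=> //=.
rewrite xv_lt //=; apply/andP; split.
  by rewrite /upto; apply/hasP; exists p.+1; rewrite ?mem_iota //; lia.
apply: sub_all h => i /andP[-> /hasP[s hs es]] /=.
by apply/hasP; exists s => //; move: hs; rewrite !mem_iota; lia.
Qed.

Let g_neq0 p : (p <= L)%N -> g p != 0.
Proof. by move=> /lead_g /lead_in_neq0. Qed.

Let upto_beyond p e : (p <= L)%N -> upto p e -> ~~ beyond p e.
Proof.
move=> le /hasP[s]; rewrite mem_iota => hs /eqP ->; rewrite /beyond negb_or negbK xv_fam; last by lia.
rewrite eqxx; apply/hasPn => s'; rewrite mem_iota => hs'; apply/eqP => /xv_inj h.
by have := h _ _; lia.
Qed.

Let upto_notc p e : (p <= L)%N -> upto p e -> ~~ notc e.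
Proof.
move=> le /hasP[s]; rewrite mem_iota => hs /eqP ->.
by rewrite /notc negbK xv_fam //; lia.
Qed.

Let beyond_notc p e : notc e -> beyond p e.
Proof. by rewrite /beyond /notc => ->. Qed.

(** The variable [xv p] divides the leading forms of [g p] and of [be p * g p.+1], but is coprime to
    that of [al p * g p.-1]. If the latter term had the larger or equal weight, the relation in that
    weight would make its leading form divisible by [xv p]. *)
Let dominates p : (0 < p < L)%N -> (wd (al p * g p.-1) < wd (be p * g p.+1))%N.
Proof.
move=> hp; rewrite ltnNge; apply/negP => le.
have ltp : (xv p < m)%N by apply: xv_lt; lia.
have copx : cop (y (xv p)) (lf (al p * g p.-1)).
  apply: cop_mvar_lform => //.
  apply: lead_inM.
    apply: lead_inW (lead_al hp) => e; apply: contraNneq => ->; rewrite xv_fam //; lia.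
  have lep : (p.-1 <= L)%N by lia.
  apply: lead_inW (lead_g lep) => e /hasP[s]; rewrite mem_iota => hs /eqP ->.
  by apply/eqP => /xv_inj h; have := h _ _; lia.
have gE : lf (g p) = lf (g p.-1) * y (xv p).
  by have := @lf_g p.-1; rewrite prednK; [apply; lia|lia].
have d2 : rdvd (y (xv p)) (lf (be p * g p.+1)).
  rewrite lformM lf_g; last by lia.
  by rewrite gE; exists (lf (be p) * (lf (g p.-1) * y (xv p.+1))); ring.
have d1 : rdvd (y (xv p)) (lf (al p * g p.-1)).
  rewrite -(coef_wgr_wdeg w); set D := wd _ in le *.
  rewrite -[X in wgr _ _ _ X](addrK (be p * g p.+1)) -rel // rmorphB coefB.
  apply: rdvdB; last exact: rdvd_coef_wgr.
  apply: rdvd_coef_wgr; first by rewrite rel // wdegD_leq.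
  by rewrite lformM gE; exists (lf (g p.-1) * lf (g' p)); ring.
by apply: (rdvd_mvar1 ltp); apply: copx; rewrite mulr1.
Qed.

(** The dominating term gives the leading form of the product; cancelling that of [g p] leaves the
    new variable [xv p.+1] and variables of other chains. *)
Let lead_rel p : (0 < p < L)%N -> [/\ lf (g' p) = lf (be p) * y (xv p.+1),
  (wd (g p) + wd (g' p) = wd (be p) + wd (g p.+1))%N & g' p != 0].
Proof.
move=> hp; have dom := dominates hp.
have hp1 : (p < L)%N by lia.
have [gp0 gp10 be0] : [/\ g p != 0, g p.+1 != 0 & be p != 0].
  by split; [apply: g_neq0; lia|apply: g_neq0; lia|apply: lead_in_neq0 (lead_be hp)].
have relC : g p * g' p = be p * g p.+1 + al p * g p.-1 by rewrite rel // addrC.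
have gp'0 : g' p != 0.
  apply/eqP => g'0; move: relC; rewrite g'0 mulr0 => /esym/eqP; rewrite addr_eq0 => /eqP e.
  by move: dom; rewrite e /wdeg rmorphN size_polyN ltnn.
split=> //.
  apply: (@mulfI _ (lf (g p))); first by rewrite lform_eq0.
  rewrite -lformM relC lformDl; last by right.
  by rewrite lformM lf_g // mulrCA.
by rewrite -!wdegM // relC wdegDl //; right.
Qed.

Let lead_g' p q : (0 < p < L)%N -> (q <= p)%N -> lead_in w (beyond q) (g' p).
Proof.
move=> hp lq; have [e _ _] := lead_rel hp; have [l [el h]] := lead_be hp.
exists (xv p.+1 :: l); rewrite e el big_cons mulrC /= xv_lt; last by lia.
split=> //=; rewrite {1}/beyond; apply/andP; split.
  by apply/orP; right; apply/hasP; exists p.+1 => //; rewrite mem_iota; lia.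
by apply: sub_all h => i /andP[-> /beyond_notc ->].
Qed.

Lemma chain_cop_mutated p : (0 < p < L)%N -> cop (g p) (g' p).
Proof.
move=> hp; have lp : (p <= L)%N by lia.
by apply: cop_lead_in (lead_g lp) (lead_g' hp (leqnn p)) => e; apply: upto_beyond.
Qed.

(** Euclidean descent: modulo [g p.+1] the relation turns [be * g p.+2] into [- al * g p], and [al]
    has its leading variables in other chains. *)
Let cop_next p : (p < L)%N -> cop (g p) (g p.+1).
Proof.
elim: p => [|p IH] lp; first by rewrite g0; apply: cop1r.
have hp : (0 < p.+1 < L)%N by lia.
have copn f : lead_in w notc f -> cop (g p.+1) f.
  by move=> hf; apply: cop_lead_in (lead_g (ltnW lp)) hf => e; apply: upto_notc; lia.
apply: (@cop_factorr _ _ (be p.+1)); apply: (@cop_eqmod _ _ _ (- (al p.+1 * g p))).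
  by rewrite opprK addrC -(rel hp); apply: rdvd_mull.
apply: copNr; apply: copMr; first by apply: copn; apply: lead_al.
by apply: copC; [apply: g_neq0; lia|apply: IH; lia].
Qed.

(* [cont b d] is the continuant with [cont b d * g (b+1) = (prod beta) * g (b+1+d)] mod [g b]. *)
Let cont2 b := fix cont2 d := if d is d'.+1 then
    let: (k, k') := cont2 d' in
    (g' (b.+1 + d') * k - al (b.+1 + d') * be (b + d') * k', k)
  else (1, 0).
Let cont b d := (cont2 b d).1.

Let contS b d : cont b d.+2 = g' (b.+1 + d.+1) * cont b d.+1
  - al (b.+1 + d.+1) * be (b + d.+1) * cont b d.
Proof. by rewrite /cont /=; case: (cont2 b d). Qed.

Let cont1 b : cont b 1 = g' b.+1.
Proof. by rewrite /cont /= addn0 mulr1 mulr0 subr0. Qed.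

(** By [dominates] the term with [g'] outweighs the correction with [al * be]. The leading monomial
    of the continuant is thus a product of those of [g'] from [b + 1] on, which avoid the variables
    of [g b]. *)
Let cont_lead b d : (0 < b)%N -> (b.+1 + d <= L)%N ->
  lead_in w (beyond b) (cont b d) /\
  ((b.+1 + d < L)%N -> lead_in w (beyond b) (cont b d.+1) /\
    wd (cont b d.+1) = (wd (g' (b.+1 + d)%N) + wd (cont b d))%N).
Proof.
move=> b0; elim: d => [|d IH] hd.
  split; first exact: lead_in1.
  rewrite addn0 => lt; have hb : (0 < b.+1 < L)%N by lia.
  rewrite cont1; split; first by apply: lead_g' => //.
  by rewrite /cont /= [X in (_ + X)%N](_ : _ = 0%N) ?addn0 // /wdeg rmorph1 size_poly1.
have hd' : (b.+1 + d < L)%N by lia.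
have [h0 /(_ hd') [h1 w1]] := IH (ltnW hd'); split=> // lt.
have hb : (0 < b.+1 + d.+1 < L)%N by lia.
have hb' : (0 < b.+1 + d < L)%N by lia.
have [e1 d1 n1] := lead_rel hb; have [e2 d2 n2] := lead_rel hb'.
have dom := dominates hb.
have ebd : (b + d.+1 = b.+1 + d)%N by lia.
have [al0 be0 be0'] : [/\ al (b.+1 + d.+1)%N != 0, be (b.+1 + d.+1)%N != 0 & be (b.+1 + d)%N != 0].
  by split; apply: (@lead_in_neq0 _ _ w notc); [apply: lead_al|apply: lead_be|apply: lead_be].
have gl q : (q <= L)%N -> g q != 0 by apply: g_neq0.
have [c0 c1] : cont b d != 0 /\ cont b d.+1 != 0 by split; apply: lead_in_neq0; eassumption.
have small : (wd (- (al (b.+1 + d.+1) * be (b + d.+1) * cont b d))%R <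
             wd (g' (b.+1 + d.+1) * cont b d.+1)%R)%N.
  rewrite {1}/wdeg rmorphN size_polyN -/(wdeg w _) ebd !wdegM ?mulf_neq0 // w1.
  move: dom; rewrite !wdegM //; try (apply: gl; lia).
  have -> : (b.+1 + d.+1).-1 = (b.+1 + d)%N by lia.
  move: d2; have -> : (b.+1 + d).+1 = (b.+1 + d.+1)%N by lia.
  by lia.
rewrite contS; split.
  have [l [el h]] : lead_in w (beyond b) (g' (b.+1 + d.+1) * cont b d.+1).
    by apply: lead_inM => //; apply: lead_g' => //; lia.
  by exists l; rewrite lformDl //; right.
by rewrite wdegDl; [apply: wdegM|right].
Qed.

Let cont_rel b d : (0 < b)%N -> (b.+1 + d <= L)%N ->
  rdvd (g b) (\prod_(i < d) be (b.+1 + i) * g (b.+1 + d) - cont b d * g b.+1) /\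
  ((b.+1 + d < L)%N ->
    rdvd (g b) (\prod_(i < d.+1) be (b.+1 + i) * g (b.+1 + d.+1) - cont b d.+1 * g b.+1)).
Proof.
move=> b0; elim: d => [|d IH] hd.
  split; first by rewrite big_ord0 addn0 /cont /= !mul1r subrr; exists 0; rewrite mulr0.
  rewrite addn0 addn1 => lt; have hb : (0 < b.+1 < L)%N by lia.
  rewrite big_ord1 cont1 addn0 [g' _ * _]mulrC rel //= opprD addrCA subrr addr0.
  by apply: rdvdN; apply: rdvdMl; apply: rdvd_refl.
have hd' : (b.+1 + d < L)%N by lia.
have [h0 /(_ hd') h1] := IH (ltnW hd'); split=> // lt.
have hb : (0 < b.+1 + d.+1 < L)%N by lia.
rewrite contS.
set B := \prod_(i < d.+1) _ in h1 *.
have BE : B = \prod_(i < d) be (b.+1 + i) * be (b + d.+1).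
  by rewrite /B big_ord_recr /=; congr (_ * be _); lia.
rewrite big_ord_recr /= -/B; have := rel hb.
have -> : (b.+1 + d.+1).+1 = (b.+1 + d.+2)%N by lia.
have -> : (b.+1 + d.+1).-1 = (b.+1 + d)%N by lia.
set a := al _; set x := g' _; set v := g (b.+1 + d.+1) in h1 *; set v2 := g (b.+1 + d.+2).
set v0 := g (b.+1 + d) in h0 *; move=> e.
have -> : B * be (b.+1 + d.+1) * v2 - (x * cont b d.+1 - a * be (b + d.+1) * cont b d) * g b.+1 =
    x * (B * v - cont b d.+1 * g b.+1)
    - a * be (b + d.+1) * (\prod_(i < d) be (b.+1 + i) * v0 - cont b d * g b.+1).
  have -> : B * be (b.+1 + d.+1) * v2 = B * (v * x - a * v0) by rewrite e; ring.
  by rewrite BE; ring.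
by apply: rdvdB; apply: rdvdMl.
Qed.

(** For [a < b], the factors of [cont * g a.+1] are coprime to [g a] by [cont_lead] and [cop_next];
    the product of the [be] multiplying [g b] is then dropped. *)
Lemma chain_cop a b : (0 < a <= L)%N -> (0 < b <= L)%N -> a != b -> cop (g a) (g b).
Proof.
wlog lab : a b / (a < b)%N.
  move=> h ha hb nab; have [/h|lt|e] := ltngtP a b; first by apply.
    by apply: copC; [apply: g_neq0; lia|apply: h => //; rewrite eq_sym].
  by rewrite e eqxx in nab.
move=> ha hb _; pose d := (b - a.+1)%N.
have bE : b = (a.+1 + d)%N by rewrite /d; lia.
have hd : (a.+1 + d <= L)%N by rewrite -bE; lia.
have a0 : (0 < a)%N by lia.
have aL : (a <= L)%N by lia.
have [hr _] := cont_rel a0 hd; have [hl _] := cont_lead a0 hd.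
rewrite bE; apply: cop_factorr; apply: (cop_eqmod hr).
apply: copMr; last by apply: cop_next; lia.
by apply: cop_lead_in (lead_g aL) hl => e; apply: upto_beyond.
Qed.

End Chain.

Lemma coord_subn b c q a : (0 < b)%N -> (a < q)%N ->
  ((b + c) * q - (b * q - a) = c * q + a)%N.
Proof. by case: b => // b _ la; rewrite mulnDl mulSn; lia. Qed.

Lemma coord_subC b c q a : (0 < b)%N -> (a < q)%N ->
  ((b + c) * q.+2 - (b * q - a) = c * q + a + (c.*2 + b.*2))%N.
Proof. by case: b => // b _ la; rewrite !mulnS mulnDl mulSn; lia. Qed.

Lemma coord_pos b q a : (0 < b)%N -> (a < q)%N -> (0 < b * q - a)%N.
Proof. by case: b => // b _ la; rewrite mulSn; lia. Qed.

(** * Positions of the initial functions *)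

Section Placement.
Variable n : nat.
Hypothesis n1 : (1 < n)%N.
Local Open Scope nat_scope.
Let q := n.-1.
Let k := kCG n.
Let q0 : 0 < q. Proof. by rewrite /q; lia. Qed.

Lemma NCG_E : NCG n = k * q. Proof. by []. Qed.

Lemma kCG_le : k.*2 <= n.+1. Proof. by rewrite /k /kCG; lia. Qed.
Lemma kCG_gt0 : 0 < k. Proof. by rewrite /k /kCG; lia. Qed.
Lemma kCG_odd : odd n -> k.*2 = n.+1. Proof. by rewrite /k /kCG; lia. Qed.
Lemma kCG_even : ~~ odd n -> k.*2 = n. Proof. by rewrite /k /kCG; lia. Qed.

Lemma Upos_diag b a t : a < q -> 0 < a + t <= n.*2 ->
  Upos n (b * q + a) (b * q + a + (b.*2 + t)) =
  if a + t <= n then Some (a, (a + t).-1) else Some (a.+1, a + t - n.+1).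
Proof.
move=> la ht; have bq : b * n.+1 = b * q + b.*2.
  have -> : n.+1 = q.+2 by rewrite /q; lia.
  by rewrite !mulnS; lia.
case: leqP => h.
  have -> : b * q + a + (b.*2 + t) = b * n.+1 + (a + t).-1.+1 by lia.
  by rewrite Upos_Y //; lia.
have -> : b * q + a + (b.*2 + t) = b.+1 * n.+1 + (a + t - n.+1) by rewrite mulSn; lia.
by rewrite Upos_X //; lia.
Qed.

(** One formula serves both kinds of blocks: the X block of a block row holds the row after that of
    the Y block, and linear indices run on from the end of one row to the start of the next. *)
Lemma Uidx_diag b a t : a < q -> 0 < a + t <= n.*2 ->
  Uidx n (b * q + a) (b * q + a + (b.*2 + t)) = Some (a * n + (a + t).-1).
Proof.
move=> la ht; rewrite /Uidx Upos_diag //; case: leqP => h //.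
by congr Some; rewrite mulSn; lia.
Qed.

Definition vx e := (e %/ n, e %% n).

Lemma Upos_vx r c e : Uidx n r c = Some e -> Upos n r c = Some (vx e).
Proof.
rewrite /Uidx; case E : (Upos n r c) => [[i j]|//] [<-].
have [lj _] := UposP n1 E.
by rewrite /vx divnMDl ?modnMDl ?divn_small ?modn_small ?addn0 //; lia.
Qed.

(* Position [e = a (n + 1) + rho] lies on the chain theta, phi or psi according to
   whether [rho] is zero, odd or even. *)
Definition idxCG e : cgidx :=
  let a := e %/ n.+1 in let rho := e %% n.+1 in
  if rho == 0 then Theta (n - a)
  else if odd rho then Phi ((rho.+1)./2 * q - a) else Psi (rho./2 * q - a).

Definition chain_of e := let rho := e %% n.+1 in if rho == 0 then 0 else if odd rho then 1 else 2.

Lemma divmod_CG a rho : rho <= n -> ((a * n.+1 + rho) %/ n.+1 = a) * ((a * n.+1 + rho) %% n.+1 = rho).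
Proof. by move=> h; rewrite divnMDl ?modnMDl ?divn_small ?modn_small ?addn0. Qed.

Lemma idx_theta a : idxCG (a * n.+1) = Theta (n - a).
Proof. by rewrite -[a * _]addn0 /idxCG !divmod_CG. Qed.

Lemma idx_phi a b : 0 < b -> b <= k -> idxCG (a * n.+1 + b.*2.-1) = Phi (b * q - a).
Proof.
move=> b0 bk; have := kCG_le => h; rewrite /idxCG !divmod_CG; try lia.
have -> : (b.*2.-1 == 0) = false by lia.
have -> : odd b.*2.-1 by lia.
by have -> : (b.*2.-1.+1)./2 = b by lia.
Qed.

Lemma idx_psi a b : 0 < b -> b.*2 <= n -> idxCG (a * n.+1 + b.*2) = Psi (b * q - a).
Proof.
move=> b0 bn; rewrite /idxCG !divmod_CG //.
have -> : (b.*2 == 0) = false by lia.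
have -> : odd b.*2 = false by lia.
by have -> : (b.*2)./2 = b by lia.
Qed.

(** Since [n^2 = q (n + 1) + 1], the last value [a = q] occurs only for [e = n^2 - 1]. *)
Lemma coord_CG e : e < n * n -> exists a rho,
  [/\ e = a * n.+1 + rho, rho <= n, a < n & a = q -> rho = 0].
Proof.
move=> le; exists (e %/ n.+1), (e %% n.+1).
have e1 := divn_eq e n.+1; have e2 : e %% n.+1 < n.+1 by rewrite ltn_mod.
have qn : q.+1 = n by rewrite /q; lia.
have aq : e %/ n.+1 <= q.
  rewrite leqNgt; apply/negP => h; have := leq_mul2r n.+1 q.+1 (e %/ n.+1).
  by rewrite h orbT qn; lia.
split=> //; first by lia.
move=> aE; rewrite aE in e1.
have : q * n.+1 + n.+1 = n * n + n by rewrite -qn; lia.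
by lia.
Qed.

(** A trailing minor of size [b q - a] starts in row [a] of the [b]-th block row from the bottom. *)
Lemma phi_coord p : 0 < p -> exists b a, [/\ p = b * q - a, a < q & 0 < b].
Proof.
move=> p0; exists (p.-1 %/ q).+1, (q - (p.-1 %% q).+1).
have e1 := divn_eq p.-1 q; have e2 : p.-1 %% q < q by rewrite ltn_mod.
by split=> //; rewrite ?mulSn; lia.
Qed.

Lemma MCG_E : MCG n = if odd n then k.-1 * q else k * q.
Proof.
rewrite /MCG NCG_E; case: ifP => // _.
by rewrite -[in LHS](prednK kCG_gt0) mulSn addKn.
Qed.

Lemma coord_le b a c : b * q - a <= c * q -> a < q -> b <= c.
Proof.
move=> h la; rewrite leqNgt; apply/negP => lt.
by have := leq_mul2r q c.+1 b; rewrite lt orbT mulSn; lia.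
Qed.

Lemma place_theta a : place n (Theta (n - a)) = Some (n - (n - a), n - (n - a)). Proof. by []. Qed.

Lemma Uidx_phi b a : 0 < b -> b <= k -> a < q ->
  Uidx n (NCG n - (b * q - a)) (k * n.+1 - (b * q - a)) = Some (a * n.+1 + b.*2.-1).
Proof.
move=> b0 bk la; have := kCG_le => k2.
have [c cE] : exists c, k = b + c by exists (k - b); lia.
have -> : NCG n - (b * q - a) = c * q + a by rewrite NCG_E cE coord_subn.
have -> : k * n.+1 - (b * q - a) = c * q + a + (c.*2 + b.*2).
  have n2 : n.+1 = q.+2 by rewrite /q; lia.
  by rewrite n2 cE coord_subC.
by rewrite Uidx_diag //; [congr Some; rewrite mulnS; lia|rewrite /q in la; lia].
Qed.

Lemma Uidx_psi b a : 0 < b -> b.*2 <= n -> a < q ->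
  Uidx n (NCG n - (b * q - a)) (k * n.+1 - (b * q - a) + 1) = Some (a * n.+1 + b.*2).
Proof.
move=> b0 bk la; have bk' : b <= k by rewrite /k /kCG; lia.
have [c cE] : exists c, k = b + c by exists (k - b); lia.
have -> : NCG n - (b * q - a) = c * q + a by rewrite NCG_E cE coord_subn.
have -> : k * n.+1 - (b * q - a) + 1 = c * q + a + (c.*2 + b.*2.+1).
  have n2 : n.+1 = q.+2 by rewrite /q; lia.
  by rewrite n2 cE coord_subC // addn1 -!addnS.
by rewrite Uidx_diag //; [congr Some; rewrite mulnS; lia|rewrite /q in la; lia].
Qed.

Lemma vx_theta a : a < n -> vx (a * n.+1) = (a, a).
Proof. by move=> la; rewrite /vx mulnS addnC divnMDl ?modnMDl ?divn_small ?modn_small ?addn0 //; lia. Qed.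

(** Membership is [List.In] because no equality is declared on [cgidx]. *)
Lemma idxCG_in e : e < n * n ->
  List.In (idxCG e) (cgidxs n) /\ place n (idxCG e) = Some (vx e).
Proof.
move=> /coord_CG[a [rho [-> hr la ha]]].
have In_iota x m s : s <= x < s + m -> List.In x (iota s m).
  elim: m s => [|m IH] s; first by lia.
  by rewrite /= => h; have [->|ne] := eqVneq x s; [left|right; apply: IH; lia].
have inT i : 0 < i <= n -> List.In (Theta i) (cgidxs n).
  by move=> h; apply/List.in_or_app; left; apply: List.in_map; apply: In_iota; lia.
have inF i : 0 < i <= NCG n -> List.In (Phi i) (cgidxs n).
  move=> h; apply/List.in_or_app; right; apply/List.in_or_app; left.
  by apply: List.in_map; apply: In_iota; lia.
have inP i : 0 < i <= MCG n -> List.In (Psi i) (cgidxs n).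
  move=> h; apply/List.in_or_app; right; apply/List.in_or_app; right.
  by apply: List.in_map; apply: In_iota; lia.
have [r0|r0] := posnP rho.
  rewrite r0 addn0 idx_theta; split; first by apply: inT; lia.
  by rewrite place_theta vx_theta //; congr (Some (_, _)); lia.
have laq : a < q by have := ha; rewrite /q in ha *; lia.
have [ro|re] := boolP (odd rho).
  have [b bE] : exists b, rho = b.*2.-1 by exists (rho.+1)./2; lia.
  have [b0 bk] : 0 < b /\ b <= k by split; rewrite /k /kCG; lia.
  have := leq_mul2r q b k; rewrite bk orbT => hbk.
  rewrite bE idx_phi //; split.
    by apply: inF; rewrite NCG_E coord_pos //= (leq_trans (leq_subr _ _)).
  by apply: Upos_vx; apply: Uidx_phi.
have [b bE] : exists b, rho = b.*2 by exists rho./2; lia.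
have b0 : 0 < b by lia.
have hM : b * q <= MCG n.
  rewrite MCG_E; case: ifP => o; rewrite leq_mul2r; apply/orP; right.
    by have := kCG_odd o; lia.
  by have := kCG_even (negbT o); lia.
have bn : b.*2 <= n by rewrite -bE.
rewrite bE idx_psi //; split; last by apply: Upos_vx; apply: Uidx_psi.
by apply: inP; rewrite coord_pos //= (leq_trans (leq_subr _ _)).
Qed.

Lemma In_iotaP x m s : List.In x (iota s m) -> s <= x < s + m.
Proof.
elim: m s => [//|m IH] s /= [->|/IH]; lia.
Qed.

Lemma psi_coord b a : b * q - a <= MCG n -> a < q -> b.*2 <= n.
Proof.
rewrite MCG_E; case: ifP => o h la; have := coord_le h la.
  by have := kCG_odd o; have := kCG_gt0; lia.
by have := kCG_even (negbT o); lia.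
Qed.

Lemma coord_lt a rho : a < q -> rho <= n -> a * n.+1 + rho < n * n.
Proof.
move=> la lr; have qn : q.+1 = n by rewrite /q; lia.
have := leq_mul2r n.+1 a.+1 q; rewrite la orbT.
have : q * n.+1 + 1 = n * n by rewrite -qn; lia.
by rewrite mulSn; lia.
Qed.

Lemma In_idxCG f : List.In f (cgidxs n) -> exists2 e, e < n * n & f = idxCG e.
Proof.
have In_map c m : List.In f (map c (iota 1 m)) -> exists2 p, 0 < p <= m & f = c p.
  by move=> h; have [p [<- /In_iotaP hp]] := (List.in_map_iff c (iota 1 m) f).1 h; exists p.
move=> h; case: (List.in_app_or _ _ _ h) => {h} [|h];
  last case: (List.in_app_or _ _ _ h) => {h}; move=> /In_map[p hp ->].
- exists ((n - p) * n.+1); last by rewrite idx_theta; congr Theta; lia.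
  by rewrite mulnS; have := leq_mul2r n (n - p) n.-1; have : n * n = n + n.-1 * n; [by rewrite -mulSn prednK //; lia|lia].
- have [|b [a [pE la b0]]] := @phi_coord p; first by lia.
  have bk : b <= k by apply: (@coord_le b a); rewrite // -pE -NCG_E; lia.
  have := kCG_le => k2; exists (a * n.+1 + b.*2.-1); first by apply: coord_lt; lia.
  by rewrite idx_phi // pE.
have [|b [a [pE la b0]]] := @phi_coord p; first by lia.
have bn : b.*2 <= n by apply: (@psi_coord b a); rewrite // -pE; lia.
exists (a * n.+1 + b.*2); first exact: coord_lt.
by rewrite idx_psi // pE.
Qed.

Lemma vx_inj e e' : vx e = vx e' -> e = e'.
Proof. by case=> h1 h2; rewrite (divn_eq e n) (divn_eq e' n) h1 h2. Qed.

(** [fun_at] takes the first function placed at the vertex. Every listed function is some [idxCG e']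
    and is placed at [e'] only, so there is no other candidate. *)
Lemma fun_atE e : e < n * n -> fun_at n (e %/ n) (e %% n) = Some (idxCG e).
Proof.
move=> le; have [hin hp] := idxCG_in le; rewrite /fun_at -[(_, _)]/(vx e).
have : forall f, List.In f (cgidxs n) -> place n f = Some (vx e) -> f = idxCG e.
  move=> f /In_idxCG[e' le' ->]; have [_ ->] := idxCG_in le'.
  by case=> h1 h2; rewrite (@vx_inj e' e) // /vx h1 h2.
elim: (cgidxs n) hin => [//|f s IH] /= hin hu.
case: eqP => [h|h]; first by rewrite /= (hu f) //; left.
apply: IH => [|f' hf']; last by apply: hu; right.
by case: hin => [fE|//]; rewrite fE hp in h.
Qed.

End Placement.

(** * Minors of U reaching beyond the three chains *)

Section CGMinors.
Variables (K : fieldType) (n : nat).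
Hypothesis n1 : (1 < n)%N.
Local Notation q := n.-1.
Local Notation k := (kCG n).
Local Notation N := (NCG n).
Local Notation M := (MCG n).
Local Notation C := (kCG n * n.+1)%N.
Local Notation U := (Uent K n).
Local Notation x := (xg K n).
Local Notation th i := (cgfun K n (Theta i)).
Local Notation ph p := (cgfun K n (Phi p)).
Local Notation ps p := (cgfun K n (Psi p)).

Lemma CE : C = (N + k.*2)%N.
Proof. by rewrite NCG_E (_ : n.+1 = q.+2) ?mulnS; lia. Qed.

Lemma NqE : N = (k.-1 * q + q)%N.
Proof. by rewrite NCG_E -{1}(prednK (kCG_gt0 n1)) mulSn addnC. Qed.

Lemma CqE : C = (k.-1 * n.+1 + n.+1)%N.
Proof. by rewrite -{1}(prednK (kCG_gt0 n1)) mulSn addnC. Qed.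

Lemma MCG_odd : odd n -> (M + q = N)%N.
Proof. by rewrite /MCG => ->; rewrite subnK // NqE leq_addl. Qed.

Lemma MCG_even : ~~ odd n -> M = N.
Proof. by rewrite /MCG => /negbTE ->. Qed.

Lemma UentE r c : U r c = if Uidx n r c is Some e then mvar K (n * n) e else 0.
Proof. by rewrite /Uent /Uidx; case: (Upos n r c) => [[i j]|]. Qed.

Lemma U_Y b i j : (i < q)%N -> (j < n)%N -> U (b * q + i) (b * n.+1 + j.+1) = x i j.
Proof. by move=> li lj; rewrite /Uent Upos_Y. Qed.

Lemma U_X b a j : (a < q)%N -> (j < n)%N -> U (b * q + a) (b.+1 * n.+1 + j) = x a.+1 j.
Proof. by move=> li lj; rewrite /Uent Upos_X. Qed.

Lemma U_left b i c : (c <= b * n.+1)%N -> U (b * q + i) c = 0.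
Proof.
move=> lc; rewrite /Uent; case E : (Upos _ _ _) => [[i' j]|//].
have [lj []] := UposP n1 E.
  move=> b' li' e1 e2; have : (b' < b)%N.
    by rewrite ltnNge; apply/negP => h; have := leq_mul2r n.+1 b b'; rewrite h orbT; lia.
  by move=> h; have := leq_mul2r q b'.+1 b; rewrite h orbT mulSn; lia.
move=> b' a la' _ e1 e2; have : (b' < b)%N.
  by rewrite ltnNge; apply/negP => h; have := leq_mul2r n.+1 b b'; rewrite h orbT; rewrite mulSn in e2; lia.
by move=> h; have := leq_mul2r q b'.+1 b; rewrite h orbT mulSn; lia.
Qed.

Lemma U_right r c : (r < q)%N -> (n.*2 < c)%N -> U r c = 0.
Proof.
move=> lr lc; rewrite /Uent; case E : (Upos _ _ _) => [[i' j]|//].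
have [lj []] := UposP n1 E.
  case=> [|b'] li' e1 e2; first by lia.
  by rewrite mulSn in e1; move: (b' * q)%N e1 => t; lia.
move=> [|b'] a la' _ e1 e2; first by rewrite mul1n in e2; lia.
by rewrite mulSn in e1; move: (b' * q)%N e1 => t; lia.
Qed.

Lemma U_shift r c : U (r + q) (c + n.+1) = U r c.
Proof. by rewrite /Uent Upos_shift. Qed.

Lemma minorU_mn r c p : minorU K n r c p = mn U r c p.
Proof. by []. Qed.

Lemma minorU_shift r c p : minorU K n (r + q) (c + n.+1) p = minorU K n r c p.
Proof.
by rewrite !minorU_mn; apply: eq_mn => a b _ _; rewrite addnAC [(c + _ + b)%N]addnAC U_shift.
Qed.

Lemma thE i : th i = mn x (n - i) (n - i) i. Proof. by []. Qed.
Lemma phE p : ph p = mn U (N - p) (C - p) p. Proof. by []. Qed.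
Lemma psE p : ps p = mn U (N - p) (C - p + 1) p. Proof. by []. Qed.

Lemma th0 : th 0 = 1. Proof. by rewrite thE mn0. Qed.
Lemma ph0 : ph 0 = 1. Proof. by rewrite phE mn0. Qed.
Lemma ps0 : ps 0 = 1. Proof. by rewrite psE mn0. Qed.

(** The first block row vanishes from column [2 n + 1] on, so the minor is block triangular, and its
    upper block is a trailing minor of X. *)
Lemma block_row0 s L : (s <= q)%N ->
  mn U (q - s) (n.*2.+1 - s) (s + L) = th s * mn U q n.*2.+1 L.
Proof.
move=> sq; rewrite mn_lblock => [|a b la lb]; last by apply: U_right; lia.
congr (_ * _); last by congr (mn _ _ _ _); lia.
rewrite thE; apply: eq_mn => a b la lb.
have -> : (q - s + a = 0 * q + (q - s + a))%N by [].
have -> : (n.*2.+1 - s + b = 1 * n.+1 + (n - s + b))%N by rewrite mul1n; lia.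
by rewrite U_X; [congr (x _ _); lia|lia|lia].
Qed.

Lemma psi_generic p : (p <= N)%N -> mn U (N - p) (C - p + 1) p =
  if (M <= p)%N then th (p - M) * ps M else ps p.
Proof.
move=> pN; case: leqP => // Mp.
have [o|/MCG_even e] := boolP (odd n); last first.
  have pM : p = M by lia.
  by rewrite pM subnn th0 mul1r.
have hM := MCG_odd o; have k2 := kCG_odd n1 o; have cE := CE.
rewrite psE.
have -> : (N - M = q)%N by lia.
have -> : (C - M + 1 = n.*2.+1)%N by lia.
have -> : (N - p = q - (p - M))%N by lia.
have -> : (C - p + 1 = n.*2.+1 - (p - M))%N by lia.
have pE : p = (p - M + M)%N by rewrite subnK.
by rewrite [X in mn _ _ _ X = _]pE block_row0 //; lia.
Qed.

(** The shift by one period makes room above the first block row; for even [n], minors larger than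
    [N] split there. *)
Lemma phi_generic p : (p <= N + q)%N -> ((N < p)%N -> ~~ odd n) ->
  mn U (N + q - p) (C + n.+1 - p) p =
  if (N <= p)%N then th (p - N) * ph N else ph p.
Proof.
move=> pN ev; have cE := CE; case: leqP => Np; last first.
  rewrite phE -!minorU_mn -[RHS]minorU_shift; congr (minorU _ _ _ _ _); lia.
move: Np; rewrite leq_eqVlt => /predU1P[<-|Np].
  by rewrite subnn th0 mul1r phE -!minorU_mn -[RHS]minorU_shift; congr (minorU _ _ _ _ _); lia.
have k2 := kCG_even n1 (ev Np).
have -> : (N + q - p = q - (p - N))%N by lia.
have -> : (C + n.+1 - p = n.*2.+1 - (p - N))%N by lia.
have pE : p = (p - N + N)%N by rewrite subnK // ltnW.
rewrite [X in mn _ _ _ X = _]pE block_row0; last by lia.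
by rewrite phE -!minorU_mn -[minorU _ _ (N - N) _ _]minorU_shift; congr (_ * minorU _ _ _ _ _); lia.
Qed.

(* The last block row of [U] completed by the missing row [x_n] of [Y]. *)
Definition xi c : RCG K n := if (C - n <= c < C)%N then x q (c - (C - n)) else 0.

Definition Utop (r : nat) (a b : nat) := if (a < r)%N then U (N - r + a) b else xi b.

Lemma last_block a c : (a < q)%N -> (C - n <= c < C)%N -> U (N - q + a) c = x a (c - (C - n)).
Proof.
move=> la lc; have h1 := NqE; have h2 := CqE; have h3 := leq0n (k.-1 * q); have h4 := leq0n (k.-1 * n.+1).
have -> : (N - q + a = k.-1 * q + a)%N by lia.
have -> : (c = k.-1 * n.+1 + (c - (C - n)).+1)%N by lia.
by rewrite U_Y //; [congr (x _ _); lia|lia].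
Qed.

(** With [xi] below them, the last [q] rows contain all of X in the last [n] columns and zeros to
    the left. A larger minor therefore splits off [th n], and the rest is a psi minor after a shift
    by one period. *)
Lemma tau_generic r : (0 < r)%N -> (r.-1 <= N)%N ->
  mn (Utop r.-1) 0 (C - r) r = if (r <= n)%N then th r else th n * ps (r - n).
Proof.
move=> r0 rN; have cE := CE; have h1 := NqE; have h2 := CqE; have h3 := leq0n (k.-1 * q); have h4 := leq0n (k.-1 * n.+1); have k0 := kCG_gt0 n1.
have small s : (0 < s)%N -> (s <= n)%N -> (s <= r)%N ->
    mn (Utop r.-1) (r - s) (C - s) s = th s.
  move=> s0 sn sr; rewrite thE; apply: eq_mn => a b la lb; rewrite /Utop.
  case: ltnP => h.
    have -> : (N - r.-1 + (r - s + a) = N - q + (n - s + a))%N by lia.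
    by rewrite last_block; [congr (x _ _); lia|lia|lia].
  by rewrite /xi ifT; [congr (x _ _); lia|lia].
case: leqP => rn; first by rewrite -(small r) // subnn.
have rE : r = (r - n + n)%N by rewrite subnK // ltnW.
rewrite [X in mn _ _ _ X = _]rE mn_ublock => [|a b la lb]; last first.
  rewrite /Utop; case: ltnP => h.
    have -> : (N - r.-1 + (0 + (r - n + a)) = k.-1 * q + a)%N by lia.
    by apply: U_left; lia.
  by rewrite /xi ifF //; lia.
rewrite mulrC; congr (_ * _).
  by rewrite -(small n); [congr (mn _ _ _ _); lia|lia|lia|lia].
rewrite psE.
transitivity (mn U (N - r.-1) (C - r) (r - n)).
  by apply: eq_mn => a b la lb; rewrite /Utop ifT //; lia.
by rewrite -minorU_mn -minorU_shift; congr (minorU _ _ _ _ _); lia.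
Qed.

End CGMinors.

Section CGLeads.
Variables (K : fieldType) (n : nat).
Hypothesis n1 : (1 < n)%N.
Local Notation k := (kCG n).
Local Notation N := (NCG n).
Local Notation M := (MCG n).
Local Notation C := (kCG n * n.+1)%N.
Local Notation U := (Uent K n).
Local Notation x := (xg K n).
Local Notation y := (mvar K (n * n)).
Local Notation th i := (cgfun K n (Theta i)).
Local Notation ph p := (cgfun K n (Phi p)).
Local Notation ps p := (cgfun K n (Psi p)).
Local Notation lf := (lform (wU n)).
Local Notation lead_in := (@lead_in K (n * n) (wU n)).
Local Notation fam := (chain_of n).

Lemma lform_mn (E : nat -> nat -> option nat) (X : nat -> nat -> RCG K n) r0 c0 p :
  (forall a b, X a b = if E a b is Some e then y e else 0) ->
  (forall a b e, E a b = Some e -> (e < n * n)%N) ->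
  (forall a, (a < p)%N -> E (r0 + a)%N (c0 + a)%N) ->
  (forall a a' b b' e1 e2, (a < a')%N -> (b < b')%N -> (a' < r0 + p)%N -> (b' < c0 + p)%N ->
    E a b' = Some e1 -> E a' b = Some e2 ->
    exists e3 e4, [/\ E a b = Some e3, E a' b' = Some e4 & (wU n e1 + wU n e2 < wU n e3 + wU n e4)%N]) ->
  lf (mn X r0 c0 p) = \prod_(a < p) X (r0 + a)%N (c0 + a)%N.
Proof.
move=> XE Elt Ed Em.
have [] := @lform_det K (n * n) (wU n) p (fun a b => E (r0 + a)%N (c0 + b)%N).
- by move=> a b e; apply: Elt.
- exact: Ed.
- move=> a a' b b' e1 e2 /andP[h1 h2] /andP[h3 h4]; apply: Em; lia.
move=> h _; rewrite /mn.
have -> : \matrix_(a < p, b < p) X (r0 + a)%N (c0 + b)%N =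
    \matrix_(a < p, b < p) (if E (r0 + a)%N (c0 + b)%N is Some e then y e else 0).
  by apply/matrixP => a b; rewrite !mxE XE.
by rewrite h; apply: eq_bigr => a _; rewrite XE.
Qed.

Lemma lform_U r0 c0 p : (forall a, (a < p)%N -> Uidx n (r0 + a) (c0 + a)) ->
  lf (mn U r0 c0 p) = \prod_(a < p) U (r0 + a)%N (c0 + a)%N.
Proof.
move=> h; apply: (lform_mn (E := Uidx n)) => // [a b|a b e|a a' b b' e1 e2 la lb _ _].
- exact: UentE.
- exact: Uidx_lt.
- exact: Uidx_monge.
Qed.

Lemma lform_X i0 j0 p : (i0 + p <= n)%N -> (j0 + p <= n)%N ->
  lf (mn x i0 j0 p) = \prod_(a < p) x (i0 + a)%N (j0 + a)%N.
Proof.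
move=> hi hj.
pose E i j := if (i < n)%N && (j < n)%N then Some (i * n + j)%N else None.
pose X i j : RCG K n := if E i j is Some e then y e else 0.
have XE i j : (i < n)%N -> (j < n)%N -> X i j = x i j by move=> li lj; rewrite /X /E li lj.
transitivity (lf (mn X i0 j0 p)).
  by congr lform; apply: eq_mn => a b la lb; rewrite XE //; lia.
rewrite (@lform_mn E X) => // [|a b e|a la|a a' b b' e1 e2 la lb la' lb'].
- by apply: eq_bigr => a _; rewrite XE //; have := ltn_ord a; lia.
- rewrite /E; case: ifP => // /andP[la lb] [<-].
  by have := leq_mul2r n a.+1 n; rewrite la orbT mulSn; lia.
- by rewrite /E ifT //; lia.
have [lan lbn] : (a' < n)%N /\ (b' < n)%N by lia.
rewrite /E lan lbn (ltn_trans la lan) (ltn_trans lb lbn) /= => -[<-] [<-].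
exists (a * n + b)%N, (a' * n + b')%N; split=> //.
have [u uE] : exists u, a' = (a + u.+1)%N by exists (a' - a).-1; lia.
have [v vE] : exists v, b' = (b + v.+1)%N by exists (b' - b).-1; lia.
have lb'' : (b < n)%N by lia.
have := wUE n1 a lbn; have := wUE n1 a' lb''; have := wUE n1 a lb''; have := wUE n1 a' lbn.
by rewrite uE vE; lia.
Qed.

Lemma lead_in_seq (P : pred nat) (f : RCG K n) p (F : nat -> RCG K n) :
  lf f = \prod_(a < p) F a ->
  (forall a, (a < p)%N -> exists e, [/\ F a = y e, (e < n * n)%N & P e]) -> lead_in P f.
Proof.
move=> lfE; red; rewrite {}lfE; elim: p F => [|p IH] F h.
  by exists [::]; rewrite big_ord0 big_nil.
have [l [el hl]] := IH F (fun a la => h a (ltnW la)).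
have [e [eE elt Pe]] := h p (ltnSn p).
by exists (e :: l); rewrite big_ord_recr big_cons /= el eE mulrC elt Pe.
Qed.

Lemma lead_in_U (P : pred nat) r0 c0 p :
  (forall a, (a < p)%N -> exists2 e, Uidx n (r0 + a) (c0 + a) = Some e & P e) ->
  lead_in P (mn U r0 c0 p).
Proof.
move=> h; apply: (lead_in_seq (F := fun a => U (r0 + a)%N (c0 + a)%N)).
  by apply: lform_U => a /h[e ->].
move=> a /h[e E Pe]; exists e; rewrite UentE E; split=> //.
exact: Uidx_lt E.
Qed.

Lemma lead_in_diagX i0 p : (i0 + p <= n)%N -> lead_in (fun e => fam e == 0%N) (mn x i0 i0 p).
Proof.
move=> hp; apply: (lead_in_seq (F := fun a => x (i0 + a)%N (i0 + a)%N) (lform_X hp hp)) => a la.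
exists ((i0 + a) * n.+1)%N; split.
- by rewrite /xg; congr mvar; rewrite mulnS; lia.
- have -> : ((i0 + a) * n.+1 = (i0 + a) * n + (i0 + a))%N by rewrite mulnS; lia.
  have := leq_mul2r n (i0 + a).+1 n; have -> : (i0 + a < n)%N by lia.
  by rewrite orbT mulSn; lia.
- by rewrite /chain_of -[(_ * _)%N]addn0 (divmod_CG (i0 + a) (leq0n n)).
Qed.

Lemma lead_theta i : (i <= n)%N -> lead_in (fun e => fam e == 0%N) (th i).
Proof. by move=> h; rewrite thE; apply: lead_in_diagX; lia. Qed.

(** The diagonal of [ph p] runs through the vertices of [ph p], ..., [ph 1], so each step of the
    chain adds one new variable to the leading monomial. *)
Lemma phi_pos p a : (p <= N)%N -> (a < p)%N -> exists e,
  [/\ Uidx n (N - p + a) (C - p + a) = Some e, fam e = 1%N & idxCG n e = Phi (p - a)].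
Proof.
move=> pN la; have cE := CE n1.
have [|b [c [pE lc b0]]] := @phi_coord n n1 (p - a); first by lia.
have bk : (b <= k)%N by apply: (@coord_le n n1 b c); rewrite // -pE -NCG_E; lia.
exists (c * n.+1 + b.*2.-1)%N; rewrite idx_phi //.
have k2 := kCG_le n1; split; [|rewrite /chain_of !divmod_CG; try lia|by rewrite pE].
  have -> : (N - p + a = N - (p - a))%N by lia.
  have -> : (C - p + a = C - (p - a))%N by lia.
  by rewrite pE Uidx_phi.
have -> : (b.*2.-1 == 0)%N = false by lia.
by have -> : odd b.*2.-1 by lia.
Qed.

Lemma psi_pos p a : (p <= M)%N -> (a < p)%N -> exists e,
  [/\ Uidx n (N - p + a) (C - p + 1 + a) = Some e, fam e = 2 & idxCG n e = Psi (p - a)].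
Proof.
move=> pM la; have cE := CE n1.
have [|b [c [pE lc b0]]] := @phi_coord n n1 (p - a); first by lia.
have bn : (b.*2 <= n)%N by apply: (@psi_coord n n1 b c); rewrite // -pE; lia.
have MN : (M <= N)%N by rewrite /MCG; case: ifP => _ //; apply: leq_subr.
exists (c * n.+1 + b.*2)%N; rewrite idx_psi //.
split; [|rewrite /chain_of !divmod_CG //|by rewrite pE].
  have -> : (N - p + a = N - (p - a))%N by lia.
  have -> : (C - p + 1 + a = C - (p - a) + 1)%N by lia.
  by rewrite pE Uidx_psi.
have -> : (b.*2 == 0)%N = false by lia.
by have -> : odd b.*2 = false by lia.
Qed.

Lemma lead_phi p : (p <= N)%N -> lead_in (fun e => fam e == 1%N) (ph p).
Proof.
move=> pN; rewrite phE; apply: lead_in_U => a la.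
by have [e [-> fe _]] := phi_pos pN la; exists e; rewrite ?fe.
Qed.

Lemma lead_psi p : (p <= M)%N -> lead_in (fun e => fam e == 2) (ps p).
Proof.
move=> pM; rewrite psE; apply: lead_in_U => a la.
by have [e [-> fe _]] := psi_pos pM la; exists e; rewrite ?fe.
Qed.

(* The variable entering the leading monomial at each step of a chain. *)
Definition xphi p := odflt 0%N (Uidx n (N - p) (C - p)).
Definition xpsi p := odflt 0%N (Uidx n (N - p) (C - p + 1)).
Definition xtheta p := ((n - p) * n.+1)%N.

Lemma xphiP p : (0 < p <= N)%N ->
  [/\ Uidx n (N - p) (C - p) = Some (xphi p), (xphi p < n * n)%N, fam (xphi p) = 1%N &
      idxCG n (xphi p) = Phi p].
Proof.
move=> /andP[p0 pN]; have [e [E fe ie]] := phi_pos pN p0.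
rewrite !addn0 subn0 in E ie; rewrite /xphi E; split=> //; exact: Uidx_lt E.
Qed.

Lemma xpsiP p : (0 < p <= M)%N ->
  [/\ Uidx n (N - p) (C - p + 1) = Some (xpsi p), (xpsi p < n * n)%N, fam (xpsi p) = 2 &
      idxCG n (xpsi p) = Psi p].
Proof.
move=> /andP[p0 pM]; have [e [E fe ie]] := psi_pos pM p0.
rewrite !addn0 subn0 in E ie; rewrite /xpsi E; split=> //; exact: Uidx_lt E.
Qed.

Lemma xthetaP p : (0 < p <= n)%N ->
  [/\ (xtheta p < n * n)%N, fam (xtheta p) = 0%N & idxCG n (xtheta p) = Theta p].
Proof.
move=> /andP[p0 pn]; rewrite /xtheta; have la : (n - p < n)%N by lia.
have pE : p = (n - (n - p))%N by rewrite subKn.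
split; [|by rewrite /chain_of -[(_ * _)%N]addn0 (divmod_CG (n - p) (leq0n n))|by rewrite idx_theta -pE].
move: (n - p)%N la => a la; rewrite mulnS addnC.
by have := leq_mul2r n a.+1 n; rewrite la orbT mulSn; lia.
Qed.

Lemma lform_phiS p : (p < N)%N -> lf (ph p.+1) = lf (ph p) * y (xphi p.+1).
Proof.
move=> pN; have cE := CE n1; rewrite !phE !lform_U => [|a la|a la]; first last.
- by have [e [-> _ _]] := phi_pos pN la.
- by have [e [-> _ _]] := phi_pos (ltnW pN) la.
rewrite big_ord_recl mulrC; congr (_ * _).
  by apply: eq_bigr => a _; rewrite lift0; congr (U _ _); lia.
have [|E _ _ _] := @xphiP p.+1; first by lia.
by rewrite !addn0 UentE E.
Qed.

Lemma lform_psiS p : (p < M)%N -> lf (ps p.+1) = lf (ps p) * y (xpsi p.+1).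
Proof.
move=> pM; have cE := CE n1; rewrite !psE !lform_U => [|a la|a la]; first last.
- by have [e [-> _ _]] := psi_pos pM la.
- by have [e [-> _ _]] := psi_pos (ltnW pM) la.
have MN : (M <= N)%N by rewrite /MCG; case: ifP => _ //; apply: leq_subr.
rewrite big_ord_recl mulrC; congr (_ * _).
  by apply: eq_bigr => a _; rewrite lift0; congr (U _ _); lia.
have [|E _ _ _] := @xpsiP p.+1; first by lia.
by rewrite !addn0 UentE E.
Qed.

Lemma lform_thetaS p : (p < n)%N -> lf (th p.+1) = lf (th p) * y (xtheta p.+1).
Proof.
move=> pn; rewrite !thE !lform_X; try lia.
rewrite big_ord_recl mulrC; congr (_ * _).
  by apply: eq_bigr => a _; rewrite lift0; congr (x _ _); lia.
by rewrite !addn0 /xg /xtheta; congr mvar; rewrite mulnS; lia.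
Qed.

End CGLeads.

Section CGRelations.
Variables (K : fieldType) (n : nat).
Hypothesis n1 : (1 < n)%N.
Local Notation q := n.-1.
Local Notation N := (NCG n).
Local Notation M := (MCG n).
Local Notation C := (kCG n * n.+1)%N.
Local Notation U := (Uent K n).
Local Notation th i := (cgfun K n (Theta i)).
Local Notation ph p := (cgfun K n (Phi p)).
Local Notation ps p := (cgfun K n (Psi p)).
Local Notation lead_in := (@lead_in K (n * n) (wU n)).
Local Notation fam := (chain_of n).

Lemma MN : (M <= N)%N.
Proof. by rewrite /MCG; case: ifP => _ //; apply: leq_subr. Qed.

Lemma NMq : (N - M <= q)%N.
Proof.
have [o|e] := boolP (odd n); first by have := MCG_odd n1 o; lia.
by rewrite MCG_even // subnn.
Qed.

Lemma fam_ne a b : a != b -> forall e, fam e == a -> fam e != b.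
Proof. by move=> ab e /eqP ->. Qed.

Lemma lead_th c i : (i <= n)%N -> c != 0%N -> lead_in (fun e => fam e != c) (th i).
Proof. by move=> h c0; apply: lead_inW (lead_theta K n1 h); apply: fam_ne; rewrite eq_sym. Qed.

Lemma lead_ph c p : (p <= N)%N -> c != 1%N -> lead_in (fun e => fam e != c) (ph p).
Proof. by move=> h c0; apply: lead_inW (lead_phi K n1 h); apply: fam_ne; rewrite eq_sym. Qed.

Lemma lead_ps c p : (p <= M)%N -> c != 2 -> lead_in (fun e => fam e != c) (ps p).
Proof. by move=> h c0; apply: lead_inW (lead_psi K n1 h); apply: fam_ne; rewrite eq_sym. Qed.

Lemma cop_fam c f g : lead_in (fun e => fam e == c) f -> lead_in (fun e => fam e != c) g -> cop f g.
Proof. by apply: cop_lead_in => e ->. Qed.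

(* [psi] continued along the last column and the diagonal, seen from East and North. *)
Definition EPsi p := if (M <= p)%N then th (p - M) else ps p.
Definition NPsi p := if (M < p)%N then th (p - M) else ps p.
Definition WTh p := if (p <= n)%N then th p else ps (p - n).
Definition STh p := if (p < n)%N then th p else ps (p - n).

Lemma lead_EPsi p : (p <= N)%N -> lead_in (fun e => fam e != 1%N) (EPsi p).
Proof.
move=> h; have := NMq; have := MN; rewrite /EPsi => h1 h2.
by case: ltnP => hM; [apply: lead_ps; rewrite // ltnW|apply: lead_th => //; lia].
Qed.

Lemma lead_NPsi p : (p <= N)%N -> lead_in (fun e => fam e != 1%N) (NPsi p).
Proof.
move=> h; have := NMq; have := MN; rewrite /NPsi => h1 h2.
by case: leqP => hM; [apply: lead_ps|apply: lead_th => //; lia].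
Qed.

Lemma lead_WTh p : (p <= N)%N -> lead_in (fun e => fam e != 1%N) (WTh p).
Proof.
move=> h; have := NMq; have := MN; rewrite /WTh => h1 h2.
by case: leqP => hM; [apply: lead_th|apply: lead_ps => //; lia].
Qed.

Lemma lead_STh p : (p <= N)%N -> lead_in (fun e => fam e != 1%N) (STh p).
Proof.
move=> h; have := NMq; have := MN; rewrite /STh => h1 h2.
by case: ltnP => hM; [apply: lead_th => //; apply: ltnW|apply: lead_ps => //; lia].
Qed.

(** Condensation of the last rows of U with [xi] added below: one column to the right the minors are
    of psi type, and those starting to the West or South contain [xi] and are given by
    [tau_generic]. *)
Lemma phi_relation p : (0 < p < N)%N -> exists g',
  ph p * g' = (WTh p.+1 * NPsi p.+1) * ph p.-1 + (EPsi p * STh p) * ph p.+1.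
Proof.
case: p => [//|m] /andP[_ pN]; have cE := CE n1; rewrite [_.-1]/=.
pose F a b := Utop K n m.+2 a (C - m.+2 + b)%N.
have F22 : mn F 2 2 m = ph m.
  by rewrite phE; apply: eq_mn => a b la lb; rewrite /F /Utop ifT; [congr (U _ _)|]; lia.
have F11 : mn F 1 1 m.+1 = ph m.+1.
  by rewrite phE; apply: eq_mn => a b la lb; rewrite /F /Utop ifT; [congr (U _ _)|]; lia.
have F00 : mn F 0 0 m.+2 = ph m.+2.
  by rewrite phE; apply: eq_mn => a b la lb; rewrite /F /Utop ifT; [congr (U _ _)|]; lia.
have F12 : mn F 1 2 m.+1 = if (M <= m.+1)%N then th (m.+1 - M) * ps M else ps m.+1.
  rewrite -(psi_generic K n1 (ltnW pN)); apply: eq_mn => a b la lb.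
  by rewrite /F /Utop ifT; [congr (U _ _)|]; lia.
have F01 : mn F 0 1 m.+2 = if (M <= m.+2)%N then th (m.+2 - M) * ps M else ps m.+2.
  rewrite -(psi_generic K n1 pN); apply: eq_mn => a b la lb.
  by rewrite /F /Utop ifT; [congr (U _ _)|]; lia.
have F21 : mn F 2 1 m.+1 = if (m.+1 <= n)%N then th m.+1 else th n * ps (m.+1 - n).
  rewrite -(tau_generic K n1 (r := m.+1)) //; last by rewrite /=; lia.
  apply: eq_mn => a b la lb; rewrite /F /Utop.
  have -> : (0 + a < m.+1.-1)%N = (2 + a < m.+2)%N by lia.
  by case: ifP => _; [congr (U _ _)|congr (xi _ _ _)]; lia.
have F10 : mn F 1 0 m.+2 = if (m.+1 < n)%N then th m.+2 else th n * ps (m.+2 - n).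
  rewrite -(tau_generic K n1 (r := m.+2)) //; last by rewrite /=; lia.
  apply: eq_mn => a b la lb; rewrite /F /Utop.
  have -> : (0 + a < m.+2.-1)%N = (1 + a < m.+2)%N by lia.
  by case: ifP => _; [congr (U _ _)|congr (xi _ _ _)]; lia.
have fp := lead_phi K n1 (ltnW pN).
have := @hexagon _ F m; rewrite F22 F11 F00 F12 F01 F21 F10 => -[].
  by apply: (lead_in_neq0 (lead_phi K n1 _)); lia.
(* Common factors split off at the borders; their leading variables lie on other chains, so they are
   coprime to [ph m.+1] and may be removed. *)
pose c1 := if (M <= m.+1)%N then ps M else 1; pose c2 := if (n <= m.+1)%N then th n else 1.
have h1 : cop (ph m.+1) c1.
  apply: (cop_fam fp); rewrite /c1; case: ifP => _; last exact: lead_in1.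
  exact: lead_ps.
have h2 : cop (ph m.+1) c2.
  apply: (cop_fam fp); rewrite /c2; case: ifP => _; last exact: lead_in1.
  exact: lead_th.
move=> g' e; have [] : rdvd (ph m.+1) ((WTh m.+2 * NPsi m.+2) * ph m + (EPsi m.+1 * STh m.+1) * ph m.+2).
  apply: h1; apply: h2; exists g'; rewrite -e.
  have e1 : (if (M <= m.+1)%N then th (m.+1 - M) * ps M else ps m.+1) = c1 * EPsi m.+1.
    by rewrite /c1 /EPsi; case: ifP => _; rewrite ?mul1r // mulrC.
  have e2 : (if (M <= m.+2)%N then th (m.+2 - M) * ps M else ps m.+2) = c1 * NPsi m.+2.
    rewrite /c1 /NPsi -[(M <= m.+1)%N]ltnS; case: (ltngtP M m.+2) => [_|_|hM].
    - exact: mulrC.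
    - exact: esym (mul1r _).
    - by rewrite hM subnn th0.
  have e3 : (if (m.+1 <= n)%N then th m.+1 else th n * ps (m.+1 - n)) = c2 * STh m.+1.
    rewrite /c2 /STh; case: (ltngtP m.+1 n) => // [hM|hM]; first by rewrite mul1r.
    by rewrite hM subnn ps0 mulr1.
  have e4 : (if (m.+1 < n)%N then th m.+2 else th n * ps (m.+2 - n)) = c2 * WTh m.+2.
    by rewrite /c2 /WTh; case: ltnP => _; rewrite ?mul1r.
  by rewrite e1 e2 e3 e4; ring.
by move=> g'' ->; exists g''.
Qed.

End CGRelations.

(** A unit vector as last row serves to delete a column from the interior of a contiguous minor. *)
Lemma mn_deltarow (R : comNzRingType) (F : nat -> nat -> R) r c p j : (j <= p)%N ->
  (forall b, (b <= p)%N -> F (r + p)%N (c + b)%N = (b == j)%:R) ->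
  mn F r c p.+1 = (-1) ^+ (p + j) * mn (fun a b => F (r + a)%N (c + bump j b)%N) 0 0 p.
Proof.
move=> jp h; rewrite /mn (expand_det_row _ ord_max).
have lj : (j < p.+1)%N by [].
rewrite (bigD1 (Ordinal lj)) //= big1 => [|b nb]; last first.
  rewrite mxE h; last by rewrite -ltnS.
  by rewrite (_ : (_ == _) = false) ?mul0r //; apply/negbTE.
rewrite mxE h // eqxx mul1r addr0 /cofactor; congr (_ * \det _).
by apply/matrixP => a b; rewrite !mxE /= !add0n /bump leqNgt ltn_ord add0n.
Qed.

Section CGRelations2.
Variables (K : fieldType) (n : nat).
Hypothesis n1 : (1 < n)%N.
Local Notation q := n.-1.
Local Notation N := (NCG n).
Local Notation M := (MCG n).
Local Notation C := (kCG n * n.+1)%N.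
Local Notation U := (Uent K n).
Local Notation x := (xg K n).
Local Notation th i := (cgfun K n (Theta i)).
Local Notation ph p := (cgfun K n (Phi p)).
Local Notation ps p := (cgfun K n (Psi p)).
Local Notation lead_in := (@lead_in K (n * n) (wU n)).
Local Notation fam := (chain_of n).

Definition EPhi p := if (N <= p)%N then th (p - N) else ph p.
Definition NPhi p := if (N < p)%N then th (p - N) else ph p.

Lemma lead_EPhi p : (p <= N + n)%N -> lead_in (fun e => fam e != 2) (EPhi p).
Proof.
move=> h; rewrite /EPhi.
by case: ltnP => hM; [apply: lead_ph; rewrite // ltnW|apply: lead_th => //; lia].
Qed.

Lemma lead_NPhi p : (p <= N + n)%N -> lead_in (fun e => fam e != 2) (NPhi p).
Proof.
move=> h; rewrite /NPhi.
by case: leqP => hM; [apply: lead_ph|apply: lead_th => //; lia].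
Qed.

Local Notation A := (mn U N C.+1 q).

Lemma lead_A : lead_in (fun e => fam e == 0%N) A.
Proof.
have -> : A = mn x 0 0 q.
  apply: eq_mn => a b la lb; rewrite !add0n NCG_E addSnnS U_Y //; lia.
by apply: (lead_in_diagX K n1); lia.
Qed.

Lemma NC_left r c : (N <= r)%N -> (c <= C)%N -> U r c = 0.
Proof. by move=> hr hc; rewrite -(subnKC hr) NCG_E; apply: U_left. Qed.

Lemma psi_tail s : (s <= N)%N -> mn U (N - s) (C - s + 1) (s + q) = mn U (N - s) (C - s + 1) s * A.
Proof.
move=> sN; have cE := CE n1; rewrite mn_ublock => [|a b la lb]; last by apply: NC_left; lia.
by congr (_ * mn _ _ _ _); lia.
Qed.

Lemma phi_tail s : (s <= N)%N ->
  mn (fun a b => U (N - s + a) (C - s + bump s b)) 0 0 (s + q) = ph s * A.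
Proof.
move=> sN; have cE := CE n1; rewrite mn_ublock => [|a b la lb]; last first.
  by apply: NC_left; rewrite /bump; lia.
congr (_ * _).
  by rewrite phE; apply: eq_mn => a b la lb; congr (U _ _); rewrite /bump; lia.
by apply: eq_mn => a b la lb; congr (U _ _); rewrite /bump; lia.
Qed.

(** One more block row of U multiplies the psi minors by [A] and makes the minors one column to the
    right phi minors of size larger by [q]. The unit vector as last row deletes column [C], which
    turns the West and South minors into phi minors times [A]. *)
Lemma psi_relation p : (0 < p < M)%N -> exists g',
  ps p * g' = (ph p * NPhi (p + n)) * ps p.-1 + (EPhi (p + q) * ph p.-1) * ps p.+1.
Proof.
case: p => [//|m] /andP[_ pM]; have cE := CE n1; rewrite [m.+1.-1]/=; have hMN := MN n.
have oddN : odd n -> (M + q = N)%N := @MCG_odd n n1.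
pose F a b : RCG K n := if (a <= m.+1 + q)%N then U (N - m.+2 + a) (C - m.+1 + b) else (b == m.+1)%:R.
have F22 : mn F 2 2 (m + q) = ps m * A.
  rewrite psE -psi_tail; last by lia.
  by apply: eq_mn => a b la lb; rewrite /F ifT; [congr (U _ _)|]; lia.
have F11 : mn F 1 1 (m + q).+1 = ps m.+1 * A.
  rewrite psE -psi_tail; last by lia.
  rewrite addSn; apply: eq_mn => a b la lb; rewrite /F ifT; [congr (U _ _)|]; lia.
have F00 : mn F 0 0 (m + q).+2 = ps m.+2 * A.
  rewrite psE -psi_tail; last by lia.
  rewrite !addSn; apply: eq_mn => a b la lb; rewrite /F ifT; [congr (U _ _)|]; lia.
have F12 : mn F 1 2 (m + q).+1 = if (N <= m.+1 + q)%N then th (m.+1 + q - N) * ph N else ph (m.+1 + q).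
  rewrite -(phi_generic K n1); [|by lia|move=> h; apply/negP => /oddN; lia].
  rewrite addSn; apply: eq_mn => a b la lb; rewrite /F ifT; [congr (U _ _)|]; lia.
have F01 : mn F 0 1 (m + q).+2 = if (N <= m.+1 + n)%N then th (m.+1 + n - N) * ph N else ph (m.+1 + n).
  rewrite -(phi_generic K n1); [|by lia|move=> h; apply/negP => /oddN; lia].
  have -> : (m + q).+2 = (m.+1 + n)%N by lia.
  by apply: eq_mn => a b la lb; rewrite /F ifT; [congr (U _ _)|]; lia.
have F21 : mn F 2 1 (m + q).+1 = (-1) ^+ q * (ph m * A).
  rewrite (@mn_deltarow _ _ _ _ _ m); [|by lia|move=> b lb]; last first.
    by rewrite /F ifF; [congr (nat_of_bool _)%:R; apply/idP/idP|]; lia.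
  congr (_ * _); first by rewrite -signr_odd -[RHS]signr_odd; congr (_ ^+ _); lia.
  rewrite -phi_tail; last by lia.
  by apply: eq_mn => a b la lb; rewrite /F ifT; [congr (U _ _)|]; rewrite /bump; lia.
have F10 : mn F 1 0 (m + q).+2 = (-1) ^+ q * (ph m.+1 * A).
  rewrite (@mn_deltarow _ _ _ _ _ m.+1); [|by lia|move=> b lb]; last first.
    by rewrite /F ifF; [congr (nat_of_bool _)%:R; apply/idP/idP|]; lia.
  congr (_ * _); first by rewrite -signr_odd -[RHS]signr_odd; congr (_ ^+ _); lia.
  rewrite -phi_tail; last by lia.
  by rewrite addSn; apply: eq_mn => a b la lb; rewrite /F ifT; [congr (U _ _)|]; rewrite /bump; lia.
have pM' := ltnW pM; have fp := lead_psi K n1 pM'.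
have A0 := lead_in_neq0 lead_A.
have hA : cop (ps m.+1) A.
  by apply: (cop_fam fp); apply: lead_inW lead_A; apply: fam_ne.
have := @hexagon _ F (m + q)%N; rewrite F22 F11 F00 F12 F01 F21 F10 => -[].
  by apply: mulf_neq0 => //; apply: (lead_in_neq0 (lead_psi K n1 _)); lia.
pose c1 := if (N <= m.+1 + q)%N then ph N else 1.
have h1 : cop (ps m.+1) c1.
  apply: (cop_fam fp); rewrite /c1; case: ifP => _; last exact: lead_in1.
  exact: lead_ph.
have e1 : (if (N <= m.+1 + q)%N then th (m.+1 + q - N) * ph N else ph (m.+1 + q)) = c1 * EPhi (m.+1 + q).
  by rewrite /c1 /EPhi; case: ifP => _; rewrite ?mul1r // mulrC.
have e2 : (if (N <= m.+1 + n)%N then th (m.+1 + n - N) * ph N else ph (m.+1 + n)) = c1 * NPhi (m.+1 + n).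
  have c1E : (N <= m.+1 + q)%N = (N < m.+1 + n)%N by apply/idP/idP; lia.
  rewrite /c1 /NPhi c1E; case: (ltngtP N (m.+1 + n)%N) => [_|_|hM].
  - exact: mulrC.
  - exact: esym (mul1r _).
  - by rewrite hM subnn th0.
rewrite e1 e2 => g' e.
have [] : rdvd (ps m.+1) ((ph m.+1 * NPhi (m.+1 + n)) * ps m + (EPhi (m.+1 + q) * ph m) * ps m.+2).
  apply: h1; apply: hA; exists ((-1) ^+ q * g').
  have s1 : (-1) ^+ q * (-1) ^+ q = 1 :> RCG K n by rewrite -expr2 sqrr_sign.
  apply: (mulfI A0); move: e; move: ((-1) ^+ q) s1 => s s1 e.
  rewrite [RHS](_ : _ = s * (ps m.+1 * A * g')); last by ring.
  by rewrite -e -[LHS]mul1r -s1; ring.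
by move=> g'' ->; exists g''.
Qed.

End CGRelations2.

Lemma mn_deltacol (R : comNzRingType) (F : nat -> nat -> R) r c p i : (i <= p)%N ->
  (forall a, (a <= p)%N -> F (r + a)%N (c + p)%N = (a == i)%:R) ->
  mn F r c p.+1 = (-1) ^+ (i + p) * mn (fun a b => F (r + bump i a)%N (c + b)%N) 0 0 p.
Proof.
move=> ip h; rewrite /mn (expand_det_col _ ord_max).
have li : (i < p.+1)%N by [].
rewrite (bigD1 (Ordinal li)) //= big1 => [|a na]; last first.
  rewrite mxE h; last by rewrite -ltnS.
  by rewrite (_ : (_ == _) = false) ?mul0r //; apply/negbTE.
rewrite mxE h // eqxx mul1r addr0 /cofactor; congr (_ * \det _).
by apply/matrixP => a b; rewrite !mxE /= !add0n /bump [(p <= b)%N]leqNgt ltn_ord add0n.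
Qed.

Section CGRelations3.
Variables (K : fieldType) (n : nat).
Hypothesis n1 : (1 < n)%N.
Local Notation q := n.-1.
Local Notation k := (kCG n).
Local Notation N := (NCG n).
Local Notation M := (MCG n).
Local Notation C := (kCG n * n.+1)%N.
Local Notation U := (Uent K n).
Local Notation x := (xg K n).
Local Notation th i := (cgfun K n (Theta i)).
Local Notation ph p := (cgfun K n (Phi p)).
Local Notation ps p := (cgfun K n (Psi p)).
Local Notation lead_in := (@lead_in K (n * n) (wU n)).
Local Notation fam := (chain_of n).
Local Notation M' := (N - q)%N.
Local Notation mu := (mn U q n.*2.+1 M').

(** The chain on the positions with [rho = n], just below the diagonal occupied by theta. *)
Definition chi p := if odd n then ph p else ps p.

Lemma lead_chi p : (p <= N)%N -> (odd n -> p <= N)%N -> (~~ odd n -> p <= M)%N ->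
  lead_in (fun e => fam e != 0%N) (chi p).
Proof.
by move=> h1 h2 h3; rewrite /chi; case: ifP => [o|/negbT /h3 o]; [apply: lead_ph|apply: lead_ps].
Qed.

(** Along the diagonal of [mu] one has [rho = n + 1 - 2 b] with [b < k], which never vanishes. *)
Lemma lead_mu : lead_in (fun e => fam e != 0%N) mu.
Proof.
apply: (lead_in_U K n1) => a la.
have [b [c [aE lc b0]]] : exists b c, [/\ a = (b.-1 * q + c)%N, (c < q)%N & (0 < b)%N].
  by exists (a %/ q).+1, (a %% q)%N; split; [exact: divn_eq|rewrite ltn_mod; lia|].
have lb : (b < k)%N.
  rewrite ltnNge; apply/negP => h; have := leq_mul2r q k.-1 b.-1.
  have -> : (k.-1 <= b.-1)%N by lia.
  by have := NqE n1; rewrite orbT; move: (k.-1 * q)%N (b.-1 * q)%N aE => u v; lia.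
have k2 := kCG_le n1.
have e1 : (q + a = b * q + c)%N by rewrite aE -{2}(prednK b0) mulSn; lia.
have -> : (n.*2.+1 + a = b * q + c + (b.*2 + (n.+2 - b.*2)))%N.
  by rewrite -e1; lia.
rewrite e1 Uidx_diag //; last by lia.
exists (c * n.+1 + (n.+1 - b.*2))%N; first by congr Some; rewrite mulnS; lia.
rewrite /chain_of divmod_CG; last by lia.
have -> : (n.+1 - b.*2 == 0)%N = false by lia.
by case: odd.
Qed.

(** A trailing part of X is followed by the block rows of U after the first, so the diagonal minors
    are [th * mu]. The unit column deletes the last row of X and gives phi minors times [mu]; the
    unit row deletes column [m + 1] and leaves a trailing minor of U, which is [chi]. *)
Lemma theta_relation i : (0 < i < n)%N -> exists g',
  th i * g' = (chi (M' + i) * ph i) * th i.-1 + (ph i.-1 * chi (M' + i.-1)) * th i.+1.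
Proof.
case: i => [//|i] /andP[_ iq]; have cE := CE n1; rewrite [i.+1.-1]/=.
have nE := NqE n1; have h0 := leq0n (k.-1 * q)%N.
have [m mE] : exists m, m = (i + M')%N by eexists.
pose F a b : RCG K n := if (a <= i.+1)%N then
     if (b <= i.+1)%N then x (n - i.+2 + a) (n - i.+2 + b) else ((a == i.+1) && (b == m.+2))%:R
   else if (a <= m.+1)%N then if b == m.+2 then 0 else U (q + (a - i.+2)) (n.*2 - i.+1 + b)
   else (b == m.+1)%:R.
have Fx a b : (a <= i.+1)%N -> (b <= i.+1)%N -> F a b = x (n - i.+2 + a) (n - i.+2 + b).
  by move=> la lb; rewrite /F la lb.
have F0 a b : (a <= i.+1)%N -> (i.+1 < b < m.+2)%N -> F a b = 0.
  move=> la lb; rewrite /F la (_ : (b <= _)%N = false); last by lia.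
  rewrite (_ : (b == _) = false); last by lia.
  by rewrite andbF.
have FU a b : (i.+1 < a)%N -> (a <= m.+1)%N -> (b < m.+2)%N ->
    F a b = U (q + (a - i.+2)) (n.*2 - i.+1 + b).
  move=> la la' lb; rewrite /F (_ : (a <= i.+1)%N = false); last by lia.
  rewrite la' (_ : (b == _) = false); last by lia.
  by [].
have Fc a : (a <= m.+1)%N -> F a m.+2 = (a == i.+1)%:R.
  move=> la; rewrite /F la eqxx andbT (_ : (m.+2 <= i.+1)%N = false); last by lia.
  case: leqP => h; first by [].
  by rewrite (_ : (a == _) = false); last by lia.
have Fr b : F m.+2 b = (b == m.+1)%:R.
  rewrite /F (_ : (m.+2 <= i.+1)%N = false); last by lia.
  by rewrite ltnn.
clear nE h0.
have diag j : (j <= 2)%N -> mn F j j (i.+2 - j + M') = th (i.+2 - j) * mu.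
  move=> j2; rewrite mn_lblock => [|a b la lb]; last by apply: F0; lia.
  congr (_ * _).
    by rewrite thE; apply: eq_mn => a b la lb; rewrite Fx; [congr (x _ _)| |]; lia.
  by apply: eq_mn => a b la lb; rewrite FU; [congr (U _ _)| | |]; lia.
have F22 : mn F 2 2 m = th i * mu by rewrite mE; have := diag 2 (leqnn _); rewrite !subSS subn0; apply.
have F11 : mn F 1 1 m.+1 = th i.+1 * mu by rewrite mE; have := diag 1%N (leqnSn _); rewrite !subSS subn0; apply.
have F00 : mn F 0 0 m.+2 = th i.+2 * mu by rewrite mE; have := diag 0%N (leq0n _); rewrite subn0; apply.
have up j : (j <= 1)%N ->
    mn F j j.+1 (i.+1 - j + M').+1 = (-1) ^+ M' * (ph (i.+1 - j) * mu).
  move=> j1; rewrite (@mn_deltacol _ _ _ _ _ (i.+1 - j)); [|by lia|move=> a la]; last first.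
    have -> : (j.+1 + (i.+1 - j + M') = m.+2)%N by lia.
    by rewrite Fc; [congr (nat_of_bool _)%:R; apply/idP/idP|]; lia.
  congr (_ * _); first by rewrite -signr_odd -[RHS]signr_odd; congr (_ ^+ _); lia.
  rewrite mn_lblock => [|a b la lb]; last by apply: F0; rewrite /bump; lia.
  congr (_ * _).
    rewrite phE; apply: eq_mn => a b la lb; rewrite Fx; try (rewrite /bump; lia).
    have -> : (N - (i.+1 - j) + a = N - q + (q - (i.+1 - j) + a))%N by have := NqE n1; move: (k.-1 * q)%N => t; lia.
    have hC : (n < C)%N by have := CqE n1; move: (k.-1 * _)%N => t; lia.
    by rewrite (last_block K n1); [congr (x _ _); rewrite /bump; lia|lia|lia].
  by apply: eq_mn => a b la lb; rewrite FU; [congr (U _ _)| | |]; rewrite /bump; lia.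
have F12 : mn F 1 2 m.+1 = (-1) ^+ M' * (ph i * mu) by rewrite mE; have := up 1%N (leqnn _); rewrite !subSS subn0; apply.
have F01 : mn F 0 1 m.+2 = (-1) ^+ M' * (ph i.+1 * mu) by rewrite mE; have := up 0%N (leq0n _); rewrite subn0; apply.
have low j : (j <= 1)%N -> mn F j.+1 j (i.+1 - j + M').+1 = chi (i.+1 - j + M').
  move=> j1; rewrite (@mn_deltarow _ _ _ _ _ (i.+1 - j + M')) //; last first.
    move=> b lb; have -> : (j.+1 + (i.+1 - j + M') = m.+2)%N by lia.
    by rewrite Fr; congr (nat_of_bool _)%:R; apply/idP/idP; lia.
  rewrite -signr_odd oddD addbb mul1r.
  transitivity (mn U (q - (i.+1 - j)) (n.*2.+1 - (i.+2 - j)) (i.+1 - j + M')).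
    apply: eq_mn => a b la lb; rewrite /bump [(_ <= b)%N]leqNgt lb !add0n.
    have [la1|la1] := ltnP a (i.+1 - j); last first.
      by rewrite FU; [congr (U _ _)| | |]; lia.
    have [lb1|lb1] := leqP b (i.+1 - j); last first.
      by rewrite F0 ?U_right //; lia.
    rewrite Fx; [|lia|lia].
    have -> : (q - (i.+1 - j) + a = 0 * q + (q - (i.+1 - j) + a))%N by [].
    have -> : (n.*2.+1 - (i.+2 - j) + b = 1 * n.+1 + (n - (i.+2 - j) + b))%N by rewrite mul1n; lia.
    by rewrite (U_X K n1); [congr (x _ _); lia|lia|lia].
  have := NqE n1; have := leq0n (k.-1 * q)%N => h h'.
  rewrite /chi; case: ifP => [o|/negbT o].
    by have := kCG_odd n1 o; rewrite phE => k2; congr (mn _ _ _ _); lia.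
  by have := kCG_even n1 o; rewrite psE => k2; congr (mn _ _ _ _); lia.
have F21 : mn F 2 1 m.+1 = chi (M' + i) by rewrite mE [(_ + i)%N]addnC; have := low 1%N (leqnn _); rewrite !subSS subn0; apply.
have F10 : mn F 1 0 m.+2 = chi (M' + i.+1) by rewrite mE [(_ + i.+1)%N]addnC; have := low 0%N (leq0n _); rewrite subn0; apply.
have ft := lead_theta K n1 (ltnW iq).
have mu0 := lead_in_neq0 lead_mu.
have hmu : cop (th i.+1) mu by apply: (cop_fam ft); exact: lead_mu.
have := @hexagon _ F m; rewrite F22 F11 F00 F12 F01 F21 F10 => -[].
  by apply: mulf_neq0 => //; apply: (lead_in_neq0 (lead_theta K n1 _)); lia.
move=> g' e.
have [] : rdvd (th i.+1) ((chi (M' + i.+1) * ph i.+1) * th i + (ph i * chi (M' + i)) * th i.+2).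
  apply: hmu; exists ((-1) ^+ M' * g').
  have s1 : (-1) ^+ M' * (-1) ^+ M' = 1 :> RCG K n by rewrite -expr2 sqrr_sign.
  apply: (mulfI mu0); move: e; move: ((-1) ^+ M') s1 => s s1 e.
  rewrite [RHS](_ : _ = s * (th i.+1 * mu * g')); last by ring.
  by rewrite -e -[LHS]mul1r -s1; ring.
by move=> g'' ->; exists g''.
Qed.

End CGRelations3.

(** * Neighbours in the quiver match the factors of the relations *)

Section CGNeighbours.
Variables (K : fieldType) (n : nat).
Hypothesis n1 : (1 < n)%N.
Local Notation q := n.-1.
Local Notation k := (kCG n).
Local Notation N := (NCG n).
Local Notation M := (MCG n).
Local Notation th i := (cgfun K n (Theta i)).
Local Notation ph p := (cgfun K n (Phi p)).
Local Notation ps p := (cgfun K n (Psi p)).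

Definition fv e : RCG K n := cgfun K n (idxCG n e).

Lemma fvT s a i : s = (a * n.+1)%N -> i = (n - a)%N -> fv s = th i.
Proof. by move=> -> ->; rewrite /fv idx_theta. Qed.

Lemma fvF s a b p : s = (a * n.+1 + b.*2.-1)%N -> (0 < b <= k)%N -> p = (b * q - a)%N -> fv s = ph p.
Proof. by move=> -> /andP[b0 bk] ->; rewrite /fv idx_phi. Qed.

Lemma fvP s a b p : s = (a * n.+1 + b.*2)%N -> (0 < b)%N -> (b.*2 <= n)%N -> p = (b * q - a)%N -> fv s = ps p.
Proof. by move=> -> b0 bn ->; rewrite /fv idx_psi. Qed.

Lemma nnE : (n * n = q * n.+1 + 1)%N.
Proof. by case: n n1 => // m _; rewrite /=; lia. Qed.

Lemma row_lt a : (a < q)%N -> (a * n.+1 + n.+1 <= q * n.+1)%N.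
Proof. by move=> la; have := leq_mul2r n.+1 a.+1 q; rewrite la orbT mulSn addnC. Qed.

Lemma row_last a : a.+1 = q -> (a * n.+1 + n.+1 = q * n.+1)%N.
Proof. by move=> <-; rewrite mulSn addnC. Qed.

Section Phi.
Variables (a b e p : nat).
Hypotheses (aq : (a < q)%N) (b0 : (0 < b)%N) (bk : (b <= k)%N)
  (eE : e = (a * n.+1 + b.*2.-1)%N) (pE : p = (b * q - a)%N) (pN : (p < N)%N).

(** South-East raises [a] by one and so lowers [p] by one; from [a = q - 1] the wrap-around leads to
    [a = 0] and [b - 1]. For [b = 1] there is no neighbour left, in accordance with [ph 0 = 1]. *)
Lemma phi_SE : nbrSE n fv e = ph p.-1.
Proof.
have k2 := kCG_le n1; have nn := nnE; have rl := row_lt aq.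
rewrite /nbrSE; have [h|h] := ltnP a.+1 q.
  rewrite ifT; last by have := row_lt h; rewrite mulSn; lia.
  by apply: (@fvF _ a.+1 b); lia.
have aE := @row_last a; have {h}h : a.+1 = q by lia.
have {}aE := aE h; rewrite ifF; last by lia.
case: b b0 bk eE pE => [//|[|b']] _ bk' eE' pE'.
  rewrite ifF; last by lia.
  by have -> : p.-1 = 0%N; [rewrite pE'; lia|rewrite ph0].
rewrite ifT; last by lia.
by apply: (@fvF _ 0 b'.+1); rewrite ?pE'; lia.
Qed.

Lemma phi_NW : nbrNW n fv e = ph p.+1.
Proof.
have k2 := kCG_le n1; have nn := nnE; have bq := coord_pos b0 aq.
rewrite /nbrNW; case: a aq eE pE bq => [|a'] aq' eE' pE' bq.
  rewrite ifF; last by lia.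
  have lbk : (b < k)%N.
    rewrite ltn_neqAle bk andbT; apply/eqP => h; move: pN; rewrite pE' h NCG_E; lia.
  by apply: (@fvF _ q.-1 b.+1); [|lia|]; have := @row_last q.-1; rewrite ?mulSn; lia.
rewrite ifT; last by lia.
by apply: (@fvF _ a' b); lia.
Qed.

Lemma phi_W : nbrW fv e = WTh K n p.+1.
Proof.
rewrite /nbrW /WTh; case: b b0 bk eE pE => [//|[|b']] _ bk' eE' pE'.
  by rewrite ifT; [apply: (@fvT _ a)|]; lia.
have h : (p.+1 - n = b'.+1 * q - a)%N by rewrite pE'; lia.
have := @coord_pos b'.+1 q a isT aq; have k2 := kCG_le n1.
by rewrite -h => h'; rewrite ifF; [apply: (@fvP _ a b'.+1)|]; lia.
Qed.

(** The neighbour is a psi vertex as long as its coordinate stays at most [n]. Beyond that [n] is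
    odd, the psi chain has ended, and the neighbour lies on the diagonal. *)
Lemma phi_N : e != n -> nbrN n fv e = NPsi K n p.+1.
Proof.
move=> en; have k2 := kCG_le n1; have nn := nnE; have bq := coord_pos b0 aq.
have ME := MCG_E n1; have k0 := kCG_gt0 n1.
have kq : (k * q = k.-1 * q + q)%N by rewrite -{1}(prednK k0) mulSn addnC.
rewrite /nbrN /NPsi; case: a aq eE pE bq => [|a'] aq' eE' pE' bq.
  rewrite ifF; last by lia.
  have lbk : (b < k)%N.
    rewrite ltn_neqAle bk andbT; apply/eqP => h; move: pN; rewrite pE' h NCG_E; lia.
  have rq := @row_last q.-1; rewrite prednK in rq; last by lia.
  have [h|h] := leqP b.+1.*2 n.
    have -> : (M < p.+1)%N = false.
      apply/negbTE; rewrite -leqNgt ME pE'; case: ifP => o.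
        by have := kCG_odd n1 o => k2'; have := leq_mul2r q b.+1 k.-1; rewrite (_ : (b < k.-1)%N) ?orbT ?mulSn; lia.
      by have := leq_mul2r q b.+1 k; rewrite lbk orbT mulSn; lia.
    by apply: (@fvP _ q.-1 b.+1); rewrite ?mulSn; lia.
  have o : odd n.
    by apply: contraT => o; have := kCG_even n1 o; lia.
  have k2' := kCG_odd n1 o; rewrite o in ME.
  have bE : b = k.-1 by lia.
  rewrite ME pE' bE subn0 ltnSn subSnn.
  by apply: (@fvT _ q); rewrite ?bE; lia.
have rl := row_lt aq'.
rewrite ifT; last by lia.
have [h|h] := leqP b.*2 n.
  have -> : (M < p.+1)%N = false.
    apply/negbTE; rewrite -leqNgt ME pE'; case: ifP => o.
      by have := kCG_odd n1 o => k2'; have := leq_mul2r q b k.-1; rewrite (_ : (b <= k.-1)%N) ?orbT; lia.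
    by have := leq_mul2r q b k; rewrite bk orbT; lia.
  by apply: (@fvP _ a' b); lia.
have o : odd n.
  by apply: contraT => o; have := kCG_even n1 o; lia.
have k2' := kCG_odd n1 o; rewrite o in ME.
have bE : b = k by lia.
rewrite ifT; last by rewrite ME pE' bE kq; lia.
by apply: (@fvT _ a'.+1); rewrite ?ME ?pE' ?bE ?kq; lia.
Qed.

Lemma phi_E : nbrE n fv e = EPsi K n p.
Proof.
have k2 := kCG_le n1; have nn := nnE; have bq := coord_pos b0 aq.
have ME := MCG_E n1; have k0 := kCG_gt0 n1; have rl := row_lt aq.
have kq : (k * q = k.-1 * q + q)%N by rewrite -{1}(prednK k0) mulSn addnC.
rewrite /nbrE /EPsi [(e == (n * n).-1)](_ : _ = false) ?orbF; last by lia.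
(* At [e = n - 2] the East arrow is omitted; there [p = M], and [EPsi] takes the value
   [th 0 = 1]. *)
case: eqP => [en|en].
  have a0 : a = 0%N.
    apply/eqP; rewrite -leqn0 leqNgt; apply/negP => a0.
    by have := leq_mul2r n.+1 1 a; rewrite a0 orbT; lia.
  have o : odd n by move: eE; rewrite a0; lia.
  have k2' := kCG_odd n1 o; rewrite o in ME.
  have bE : b = k.-1 by move: eE; rewrite a0; lia.
  by rewrite ME pE bE a0 subn0 leqnn subnn th0.
have [h|h] := leqP b.*2 n.
  have -> : (M <= p)%N = false.
    apply/negbTE; rewrite -ltnNge ME pE; case: ifP => o.
      have := kCG_odd n1 o => k2'; have := leq_mul2r q b k.-1; rewrite (_ : (b <= k.-1)%N) ?orbT; last by lia.
      have [a0|a0] := posnP a; last by lia.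
      have : (b < k.-1)%N by move: eE; rewrite a0; lia.
      by move=> lb _; have := leq_mul2r q b.+1 k.-1; rewrite lb orbT mulSn; lia.
    have := leq_mul2r q b k; rewrite bk orbT.
    have [a0|a0] := posnP a; last by lia.
    have lbk : (b < k)%N.
      rewrite ltn_neqAle bk andbT; apply/eqP => hb; move: pN; rewrite pE hb NCG_E; lia.
    by move=> _; have := leq_mul2r q b.+1 k; rewrite lbk orbT mulSn; lia.
  by apply: (@fvP _ a b); lia.
have o : odd n.
  by apply: contraT => o; have := kCG_even n1 o; lia.
have k2' := kCG_odd n1 o; rewrite o in ME.
have bE : b = k by lia.
rewrite ifT; last by rewrite ME pE bE kq; lia.
by apply: (@fvT _ a.+1); rewrite ?ME ?pE ?bE ?kq; lia.
Qed.

Lemma phi_S : nbrS n fv e = STh K n p.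
Proof.
have k2 := kCG_le n1; have nn := nnE; have rl := row_lt aq.
rewrite /nbrS /STh; case: b b0 bk eE pE => [//|[|b']] _ bk' eE' pE'.
  rewrite ifT; last by lia.
  by rewrite ifT; [apply: (@fvT _ a.+1)|]; lia.
rewrite [(p < n)%N](_ : _ = false); last by rewrite pE'; lia.
have [h|h] := ltnP a.+1 q.
  rewrite ifT; last by have := row_lt h; rewrite mulSn; lia.
  by apply: (@fvP _ a.+1 b'.+1); rewrite ?pE'; lia.
have aE := @row_last a; have {h}h : a.+1 = q by lia.
have {}aE := aE h; rewrite ifF; last by lia.
case: b' bk' eE' pE' => [|b''] bk' eE' pE'.
  rewrite ifF; last by lia.
  by have -> : (p - n = 0)%N; [rewrite pE'; lia|rewrite ps0].
rewrite ifT; last by lia.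
by apply: (@fvP _ 0 b''.+1); rewrite ?pE'; lia.
Qed.

End Phi.

Section Psi.
Variables (a b e p : nat).
Hypotheses (aq : (a < q)%N) (b0 : (0 < b)%N) (bn : (b.*2 <= n)%N)
  (eE : e = (a * n.+1 + b.*2)%N) (pE : p = (b * q - a)%N) (pM : (p < M)%N).

Let psi_row0 : a = 0%N -> (b.+1.*2 <= n)%N.
Proof.
move=> a0; have ME := MCG_E n1; have k0 := kCG_gt0 n1; move: pM; rewrite pE a0 subn0 ME.
case: ifP => [o|/negbT o].
  by have := kCG_odd n1 o; rewrite ltn_mul2r; lia.
by have := kCG_even n1 o; rewrite ltn_mul2r; lia.
Qed.

Lemma psi_SE : nbrSE n fv e = ps p.-1.
Proof.
have nn := nnE; have rl := row_lt aq.
rewrite /nbrSE; have [h|h] := ltnP a.+1 q.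
  rewrite ifT; last by have := row_lt h; rewrite mulSn; lia.
  by apply: (@fvP _ a.+1 b); lia.
have aE := @row_last a; have {h}h : a.+1 = q by lia.
have {}aE := aE h; rewrite ifF; last by lia.
case: b b0 bn eE pE => [//|[|b']] _ bn' eE' pE'.
  rewrite ifF; last by lia.
  by have -> : p.-1 = 0%N; [rewrite pE'; lia|rewrite ps0].
rewrite ifT; last by lia.
by apply: (@fvP _ 0 b'.+1); rewrite ?pE'; lia.
Qed.

Lemma psi_NW : nbrNW n fv e = ps p.+1.
Proof.
have nn := nnE; have bq := coord_pos b0 aq; have r0 := psi_row0.
rewrite /nbrNW; case: a aq eE pE bq r0 => [|a'] aq' eE' pE' bq r0.
  have h := r0 erefl; rewrite ifF; last by lia.
  have rq := @row_last q.-1; rewrite prednK in rq; last by lia.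
  by apply: (@fvP _ q.-1 b.+1); rewrite ?mulSn; lia.
rewrite ifT; last by lia.
by apply: (@fvP _ a' b); lia.
Qed.

Lemma psi_W : nbrW fv e = ph p.
Proof.
have k2 := kCG_le n1; have bk : (b <= k)%N by have := @kCG_odd n n1; have := @kCG_even n n1; case: odd; lia.
by apply: (@fvF _ a b); lia.
Qed.

Lemma psi_N : e != n.-1 -> e != n -> nbrN n fv e = NPhi K n (p + n).
Proof.
move=> en' en; have k2 := kCG_le n1; have nn := nnE; have bq := coord_pos b0 aq; have r0 := psi_row0.
have k0 := kCG_gt0 n1; have ke := @kCG_even n n1; have ko := @kCG_odd n n1.
rewrite /nbrN /NPhi; case: a aq eE pE bq r0 => [|a'] aq' eE' pE' bq r0.
  have {}r0 := r0 erefl; rewrite ifF; last by lia.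
  have rq := @row_last q.-1; rewrite prednK in rq; last by lia.
  have [h|h] := leqP b.+2 k.
    have -> : (N < p + n)%N = false.
      apply/negbTE; rewrite -leqNgt NCG_E pE'.
      by have := leq_mul2r q b.+2 k; rewrite h orbT !mulSn; lia.
    by apply: (@fvF _ q.-1 b.+2); rewrite ?mulSn; lia.
  have o : ~~ odd n.
    by apply/negP => o; have := ko o; lia.
  have {}ke := ke o; have bE : k = b.+1 by lia.
  have NE : N = (b * q + q)%N by rewrite NCG_E bE mulSn addnC.
  rewrite ifT; last by rewrite NE pE'; lia.
  by apply: (@fvT _ q); rewrite ?NE; lia.
have rl := row_lt aq'.
rewrite ifT; last by lia.
have [h|h] := ltnP b k.
  have -> : (N < p + n)%N = false.
    apply/negbTE; rewrite -leqNgt NCG_E pE'.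
    by have := leq_mul2r q b.+1 k; rewrite h orbT mulSn; lia.
  by apply: (@fvF _ a' b.+1); rewrite ?mulSn; lia.
have o : ~~ odd n.
  by apply/negP => o; have := ko o; lia.
have {}ke := ke o; have bE : k = b by lia.
have NE : N = (b * q)%N by rewrite NCG_E bE.
rewrite ifT; last by rewrite NE pE'; lia.
by apply: (@fvT _ a'.+1); rewrite ?NE ?pE'; lia.
Qed.

Lemma psi_E : e != n.-1 -> nbrE n fv e = EPhi K n (p + q).
Proof.
move=> en'; have k2 := kCG_le n1; have nn := nnE; have bq := coord_pos b0 aq; have r0 := psi_row0.
have k0 := kCG_gt0 n1; have ke := @kCG_even n n1; have ko := @kCG_odd n n1; have rl := row_lt aq.
rewrite /nbrE /EPhi [(e == (n * n).-1)](_ : _ = false) ?orbF; last by lia.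
case: eqP => [en|en].
  have a0 : a = 0%N.
    apply/eqP; rewrite -leqn0 leqNgt; apply/negP => a0.
    by have := leq_mul2r n.+1 1 a; rewrite a0 orbT; lia.
  have o : ~~ odd n by move: eE; rewrite a0; lia.
  have {}ke := ke o; have bE : k = b.+1 by move: eE; rewrite a0; lia.
  have NE : N = (b * q + q)%N by rewrite NCG_E bE mulSn addnC.
  by rewrite NE pE a0 subn0 leqnn subnn th0.
have [h|h] := ltnP b k.
  have -> : (N <= p + q)%N = false.
    apply/negbTE; rewrite -ltnNge NCG_E pE.
    have := leq_mul2r q b.+1 k; rewrite h orbT mulSn.
    have [a0|a0] := posnP a; last by lia.
    have lbk : (b.+1 < k)%N.
      rewrite ltn_neqAle h andbT; apply/eqP => hb; move: eE; rewrite a0.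
      by case: (boolP (odd n)) => [/ko|/ke]; lia.
    by move=> _; have := leq_mul2r q b.+2 k; rewrite lbk orbT !mulSn; lia.
  by apply: (@fvF _ a b.+1); rewrite ?mulSn; lia.
have o : ~~ odd n.
  by apply/negP => o; have := ko o; lia.
have {}ke := ke o; have bE : k = b by lia.
have NE : N = (b * q)%N by rewrite NCG_E bE.
rewrite ifT; last by rewrite NE pE; lia.
by apply: (@fvT _ a.+1); rewrite ?NE ?pE; lia.
Qed.

Lemma psi_S : nbrS n fv e = ph p.-1.
Proof.
have k2 := kCG_le n1; have nn := nnE; have rl := row_lt aq.
have bk : (b <= k)%N by have := @kCG_odd n n1; have := @kCG_even n n1; case: odd; lia.
rewrite /nbrS; have [h|h] := ltnP a.+1 q.
  rewrite ifT; last by have := row_lt h; rewrite mulSn; lia.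
  by apply: (@fvF _ a.+1 b); lia.
have aE := @row_last a; have {h}h : a.+1 = q by lia.
have {}aE := aE h; rewrite ifF; last by lia.
case: b b0 bk eE pE => [//|[|b']] _ bk' eE' pE'.
  rewrite ifF; last by lia.
  by have -> : p.-1 = 0%N; [rewrite pE'; lia|rewrite ph0].
rewrite ifT; last by lia.
by apply: (@fvF _ 0 b'.+1); rewrite ?pE'; lia.
Qed.

End Psi.

Section Theta.
Variables (a e i : nat).
Hypotheses (a0 : (0 < a)%N) (an : (a < n)%N) (eE : e = (a * n.+1)%N) (iE : i = (n - a)%N).
Local Notation M' := (N - q)%N.

Let aE : exists a', a = a'.+1. Proof. by exists a.-1; rewrite prednK. Qed.

Let row_le : (a * n.+1 <= q * n.+1)%N.
Proof. by have := leq_mul2r n.+1 a q; rewrite (_ : (a <= q)%N) ?orbT; lia. Qed.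

Lemma fv_last s r p : s = (r * n.+1 + n)%N -> (r < q)%N -> p = (N - r)%N -> fv s = chi K n p.
Proof.
move=> sE rq pE; have k0 := kCG_gt0 n1; have ke := @kCG_even n n1; have ko := @kCG_odd n n1.
rewrite /chi; case: ifP => o.
  by have {}ko := ko o; apply: (@fvF _ r k); rewrite -?NCG_E; lia.
by have {}ke := ke (negbT o); apply: (@fvP _ r k); rewrite -?NCG_E; lia.
Qed.

Lemma theta_SE : nbrSE n fv e = th i.-1.
Proof.
have nn := nnE; rewrite /nbrSE; have [h|h] := ltnP a q.
  by rewrite ifT; [apply: (@fvT _ a.+1); rewrite ?mulSn|have := row_lt h]; lia.
have aq : a = q by lia.
rewrite ifF; last by rewrite eE aq; lia.
rewrite ifF; last by rewrite eE aq; lia.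
by have -> : i.-1 = 0%N; [lia|rewrite th0].
Qed.

Lemma theta_NW : nbrNW n fv e = th i.+1.
Proof.
have [a' a'E] := aE; rewrite /nbrNW ifT; last by rewrite eE a'E mulSn; lia.
by apply: (@fvT _ a'); rewrite ?eE ?a'E ?mulSn; lia.
Qed.

Lemma theta_W : nbrW fv e = chi K n (M' + i).
Proof.
have [a' a'E] := aE; have nE := NqE n1.
by apply: (@fv_last _ a'); rewrite ?eE ?a'E ?mulSn; move: (k.-1 * q)%N nE => t; lia.
Qed.

Lemma theta_N : nbrN n fv e = ph i.
Proof.
have [a' a'E] := aE; have k0 := kCG_gt0 n1; rewrite /nbrN ifT; last by rewrite eE a'E mulSn; lia.
by apply: (@fvF _ a' 1%N); rewrite ?eE ?a'E ?mulSn; lia.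
Qed.

Lemma theta_E : nbrE n fv e = ph i.-1.
Proof.
have [a' a'E] := aE; have nn := nnE; have k0 := kCG_gt0 n1.
rewrite /nbrE [(e == n.-2)](_ : _ = false) ?orFb; last by rewrite eE a'E mulSn; lia.
have [h|h] := ltnP a q.
  by rewrite ifF; [apply: (@fvF _ a 1%N)|have := row_lt h]; lia.
have aq : a = q by lia.
rewrite ifT; last by rewrite eE aq; lia.
by have -> : i.-1 = 0%N; [lia|rewrite ph0].
Qed.

Lemma theta_S : nbrS n fv e = chi K n (M' + i.-1).
Proof.
have nn := nnE; have k0 := kCG_gt0 n1; have nE := NqE n1.
rewrite /nbrS; have [h|h] := ltnP a q.
  rewrite ifT; last by have := row_lt h; lia.
  by apply: (@fv_last _ a); move: (k.-1 * q)%N nE => t; lia.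
have aq : a = q by lia.
rewrite ifF; last by rewrite eE aq; lia.
have M'E : (M' + i.-1 = k.-1 * q)%N by move: (k.-1 * q)%N nE => t nE'; lia.
have ke := @kCG_even n n1; have ko := @kCG_odd n n1.
(* For [n = 2] there is no South neighbour here, in accordance with [chi 0 = 1]. *)
have [n2|n2] := leqP n 2.
  have k1 : k = 1%N by case: (boolP (odd n)) => [/ko|/ke]; lia.
  rewrite ifF; last by rewrite eE aq; lia.
  by rewrite M'E k1 [(_ * q)%N]mul0n /chi; case: ifP => _; rewrite ?ph0 ?ps0.
rewrite ifT; last by rewrite eE aq; lia.
rewrite M'E /chi; case: ifP => o.
  by have {}ko := ko o; apply: (@fvF _ 0 k.-1); rewrite ?eE ?aq; lia.
by have {}ke := ke (negbT o); apply: (@fvP _ 0 k.-1); rewrite ?eE ?aq; lia.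
Qed.

End Theta.
End CGNeighbours.

(** Choice over a finite range, to view the mutated functions of a chain as one function of [p]. *)
Lemma choice_below (T : Type) (P : nat -> T -> Prop) L (t0 : T) :
  (forall p, (0 < p < L)%N -> exists t, P p t) ->
  exists f, forall p, (0 < p < L)%N -> P p (f p).
Proof.
elim: L => [_|L IH h]; first by exists (fun=> t0) => p; lia.
have [f hf] : exists f, forall p, (0 < p < L)%N -> P p (f p).
  by apply: IH => p hp; apply: h; lia.
have [L0|L0] := posnP L; first by exists f => p hp; lia.
have [|t ht] := h L; first by lia.
exists (fun p => if p == L then t else f p) => p hp.
by case: eqP => [->//|ne]; apply: hf; lia.
Qed.

Section CGChains.
Variables (K : fieldType) (n : nat).
Hypothesis n1 : (1 < n)%N.
Local Notation q := n.-1.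
Local Notation k := (kCG n).
Local Notation N := (NCG n).
Local Notation M := (MCG n).
Local Notation th i := (cgfun K n (Theta i)).
Local Notation ph p := (cgfun K n (Phi p)).
Local Notation ps p := (cgfun K n (Psi p)).
Local Notation lead_in := (@lead_in K (n * n) (wU n)).
Local Notation fam := (chain_of n).
Local Notation fv := (fv K n).

Lemma theta_chain :
  (forall i, (0 < i < n)%N -> exists2 g', cop (th i) g' & th i * g' =
     (chi K n (N - q + i) * ph i) * th i.-1 + (ph i.-1 * chi K n (N - q + i.-1)) * th i.+1) /\
  (forall i j, (0 < i <= n)%N -> (0 < j <= n)%N -> i != j -> cop (th i) (th j)).
Proof.
have [g' rel] := choice_below 0 (theta_relation K n1).
have qN : (q <= N)%N by rewrite NqE // leq_addl.
have lchi i : (0 < i < n)%N -> lead_in (fun e => fam e != 0%N) (chi K n (N - q + i)).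
  by move=> hi; apply: lead_chi => // [|_|o]; rewrite ?MCG_even //; lia.
have lchi' i : (0 < i < n)%N -> lead_in (fun e => fam e != 0%N) (chi K n (N - q + i.-1)).
  by move=> hi; apply: lead_chi => // [|_|o]; rewrite ?MCG_even //; lia.
have lph i : (i <= q)%N -> lead_in (fun e => fam e != 0%N) (ph i).
  by move=> hi; apply: lead_ph => //; lia.
have xP := @xthetaP n n1.
have lal i : (0 < i < n)%N -> lead_in (fun e => fam e != 0%N) (chi K n (N - q + i) * ph i).
  by move=> hi; apply: lead_inM; [exact: lchi|apply: lph; lia].
have lbe i : (0 < i < n)%N -> lead_in (fun e => fam e != 0%N) (ph i.-1 * chi K n (N - q + i.-1)).
  by move=> hi; apply: lead_inM; [apply: lph; lia|exact: lchi'].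
have xinj p p' : (0 < p <= n)%N -> (0 < p' <= n)%N -> xtheta n p = xtheta n p' -> p = p'.
  by move=> /xP[_ _ e1] /xP[_ _ e2] e; move: e1; rewrite e e2 => -[].
have xlt p : (0 < p <= n)%N -> (xtheta n p < n * n)%N by move=> /xP[].
have xfam p : (0 < p <= n)%N -> fam (xtheta n p) = 0%N by move=> /xP[].
have lfS p : (p < n)%N -> lform (wU n) (th p.+1) = lform (wU n) (th p) * mvar K (n * n) (xtheta n p.+1).
  exact: lform_thetaS.
split=> [i hi|i j hi hj ij].
  exists (g' i); last exact: rel.
  exact: (chain_cop_mutated (g := fun i => th i) (th0 K n) lfS xlt xfam xinj lal lbe rel).
exact: (chain_cop (g := fun i => th i) (th0 K n) lfS xlt xfam xinj lal lbe rel).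
Qed.

Lemma phi_chain :
  (forall p, (0 < p < N)%N -> exists2 g', cop (ph p) g' & ph p * g' =
     (WTh K n p.+1 * NPsi K n p.+1) * ph p.-1 + (EPsi K n p * STh K n p) * ph p.+1) /\
  (forall i j, (0 < i <= N)%N -> (0 < j <= N)%N -> i != j -> cop (ph i) (ph j)).
Proof.
have [g' rel] := choice_below 0 (phi_relation K n1).
have xP := @xphiP n n1.
have lal p : (0 < p < N)%N -> lead_in (fun e => fam e != 1%N) (WTh K n p.+1 * NPsi K n p.+1).
  by move=> /andP[_ hp]; apply: lead_inM; [exact: lead_WTh|exact: lead_NPsi].
have lbe p : (0 < p < N)%N -> lead_in (fun e => fam e != 1%N) (EPsi K n p * STh K n p).
  by move=> /andP[_ /ltnW hp]; apply: lead_inM; [exact: lead_EPsi|exact: lead_STh].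
have xinj p p' : (0 < p <= N)%N -> (0 < p' <= N)%N -> xphi n p = xphi n p' -> p = p'.
  by move=> /xP[_ _ _ e1] /xP[_ _ _ e2] e; move: e1; rewrite e e2 => -[].
have xlt p : (0 < p <= N)%N -> (xphi n p < n * n)%N by move=> /xP[].
have xfam p : (0 < p <= N)%N -> fam (xphi n p) = 1%N by move=> /xP[].
have lfS p : (p < N)%N -> lform (wU n) (ph p.+1) = lform (wU n) (ph p) * mvar K (n * n) (xphi n p.+1).
  exact: lform_phiS.
split=> [i hi|i j hi hj ij].
  exists (g' i); last exact: rel.
  exact: (chain_cop_mutated (g := fun i => ph i) (ph0 K n) lfS xlt xfam xinj lal lbe rel).
exact: (chain_cop (g := fun i => ph i) (ph0 K n) lfS xlt xfam xinj lal lbe rel).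
Qed.

Lemma psi_chain :
  (forall p, (0 < p < M)%N -> exists2 g', cop (ps p) g' & ps p * g' =
     (ph p * NPhi K n (p + n)) * ps p.-1 + (EPhi K n (p + q) * ph p.-1) * ps p.+1) /\
  (forall i j, (0 < i <= M)%N -> (0 < j <= M)%N -> i != j -> cop (ps i) (ps j)).
Proof.
have [g' rel] := choice_below 0 (psi_relation K n1).
have xP := @xpsiP n n1; have hMN := MN n.
have lal p : (0 < p < M)%N -> lead_in (fun e => fam e != 2) (ph p * NPhi K n (p + n)).
  by move=> hp; apply: lead_inM; [apply: lead_ph => //|apply: lead_NPhi => //]; lia.
have lbe p : (0 < p < M)%N -> lead_in (fun e => fam e != 2) (EPhi K n (p + q) * ph p.-1).
  by move=> hp; apply: lead_inM; [apply: lead_EPhi => //|apply: lead_ph => //]; lia.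
have xinj p p' : (0 < p <= M)%N -> (0 < p' <= M)%N -> xpsi n p = xpsi n p' -> p = p'.
  by move=> /xP[_ _ _ e1] /xP[_ _ _ e2] e; move: e1; rewrite e e2 => -[].
have xlt p : (0 < p <= M)%N -> (xpsi n p < n * n)%N by move=> /xP[].
have xfam p : (0 < p <= M)%N -> fam (xpsi n p) = 2 by move=> /xP[].
have lfS p : (p < M)%N -> lform (wU n) (ps p.+1) = lform (wU n) (ps p) * mvar K (n * n) (xpsi n p.+1).
  exact: lform_psiS.
split=> [i hi|i j hi hj ij].
  exists (g' i); last exact: rel.
  exact: (chain_cop_mutated (g := fun i => ps i) (ps0 K n) lfS xlt xfam xinj lal lbe rel).
exact: (chain_cop (g := fun i => ps i) (ps0 K n) lfS xlt xfam xinj lal lbe rel).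
Qed.

Lemma phi_le a b : (b <= k)%N -> (b * q - a <= N)%N.
Proof. by move=> bk; apply: leq_trans (leq_subr _ _) _; rewrite NCG_E leq_mul2r bk orbT. Qed.

Lemma psi_le a b : (b.*2 <= n)%N -> (b * q - a <= M)%N.
Proof.
move=> bn; apply: leq_trans (leq_subr _ _) _; rewrite MCG_E //.
have ke := @kCG_even n n1; have ko := @kCG_odd n n1.
by case: ifP => [/ko|/negbT /ke] k2; rewrite leq_mul2r; apply/orP; right; lia.
Qed.

Lemma vertexP e : (e < n * n)%N ->
  [\/ exists2 a, (a < n)%N & e = (a * n.+1)%N,
      exists a b, [/\ (a < q)%N, (0 < b)%N, (b <= k)%N & e = (a * n.+1 + b.*2.-1)%N]
    | exists a b, [/\ (a < q)%N, (0 < b)%N, (b.*2 <= n)%N & e = (a * n.+1 + b.*2)%N]].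
Proof.
move=> /(coord_CG n1)[a [rho [-> hr la ha]]].
have ke := @kCG_even n n1; have ko := @kCG_odd n n1.
have [r0|r0] := posnP rho; first by constructor 1; exists a; rewrite // r0 addn0.
have laq : (a < q)%N by lia.
have [ro|re] := boolP (odd rho).
  constructor 2; exists a, (rho.+1)./2; split; try lia.
by constructor 3; exists a, rho./2; split; lia.
Qed.

Lemma idxCG_inj e e' : (e < n * n)%N -> (e' < n * n)%N -> idxCG n e = idxCG n e' -> e = e'.
Proof.
move=> /(idxCG_in n1)[_ h] /(idxCG_in n1)[_ h'] ee; move: h; rewrite ee h'.
by case=> h1 h2; apply: (@vx_inj n); rewrite /vx h1 h2.
Qed.

Definition idx_spec e c (i : cgidx) :=
  [/\ fv e = cgfun K n i, fam e = c, idxCG n e = i &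
      match i with Theta j => c = 0%N /\ (0 < j <= n)%N
      | Phi j => c = 1%N /\ (0 < j <= N)%N | Psi j => c = 2 /\ (0 < j <= M)%N end].

Lemma vertex_spec e : (e < n * n)%N -> exists c i, idx_spec e c i.
Proof.
have k2 := kCG_le n1.
move=> /vertexP[[a la ->]|[a [b [la b0 bk ->]]]|[a [b [la b0 bn ->]]]].
- exists 0%N, (Theta (n - a)); split; [exact: fvT| |exact: idx_theta|by split=> //; lia].
  by rewrite /chain_of -[(_ * _)%N]addn0 (divmod_CG a (leq0n n)).
- exists 1%N, (Phi (b * q - a)); split; [by apply: fvF; rewrite // b0| |exact: (idx_phi n1)|].
    rewrite /chain_of !divmod_CG; try lia.
    have -> : (b.*2.-1 == 0)%N = false by lia.
    by have -> : odd b.*2.-1 by lia.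
  by rewrite phi_le // coord_pos.
exists 2, (Psi (b * q - a)); split; [by apply: fvP| |exact: (idx_psi n1)|].
  rewrite /chain_of !divmod_CG //.
  have -> : (b.*2 == 0)%N = false by lia.
  by have -> : odd b.*2 = false by lia.
by rewrite psi_le // coord_pos.
Qed.

Lemma fv_lead e : (e < n * n)%N -> lead_in (fun t => fam t == fam e) (fv e).
Proof.
move=> /vertex_spec[c [[i|p|p] [-> -> _ [-> /andP[_ h]]]]].
- exact: lead_theta.
- exact: lead_phi.
- exact: lead_psi.
Qed.

Lemma fv_cop e e' : (e < n * n)%N -> (e' < n * n)%N -> e != e' -> cop (fv e) (fv e').
Proof.
move=> le le' ne; have [ee|ff] := eqVneq (fam e) (fam e'); last first.
  apply: cop_fam (fv_lead le) _; apply: lead_inW (fv_lead le') => t /eqP ->.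
  by rewrite eq_sym.
have [c [i [-> fe ie hi]]] := vertex_spec le.
have [c' [i' [-> fe' ie' hi']]] := vertex_spec le'.
have ii : i <> i'.
  by move=> ii; move/eqP: ne; apply; apply: idxCG_inj => //; rewrite ie ie'.
move: ee; rewrite {}fe {}fe' => cc.
have [_ tc] := theta_chain; have [_ fc] := phi_chain; have [_ pc] := psi_chain.
case: i hi ii {ie} => [i|i|i] [ec hi] ii; case: i' hi' ii {ie'} => [i'|i'|i'] [ec' hi'] ii;
  try by rewrite ec ec' in cc.
- by apply: tc => //; apply/eqP => h; rewrite h in ii.
- by apply: fc => //; apply/eqP => h; rewrite h in ii.
- by apply: pc => //; apply/eqP => h; rewrite h in ii.
Qed.

Lemma fv_exchange e : mobile n e -> exists2 g', cop (fv e) g' & fv e * g' =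
  nbrW fv e * nbrN n fv e * nbrSE n fv e + nbrE n fv e * nbrS n fv e * nbrNW n fv e.
Proof.
move=> /and4P[e0 e1 e2 le]; have k2 := kCG_le n1; have ke := @kCG_even n n1; have ko := @kCG_odd n n1.
case: (vertexP le) => [[a la eE]|[a [b [la b0 bk eE]]]|[a [b [la b0 bn eE]]]].
- have a0 : (0 < a)%N by rewrite lt0n; apply: contraTneq e0 => a0; rewrite eE a0.
  have [i iE] : exists i, i = (n - a)%N by exists (n - a)%N.
  have [ex _] := theta_chain; have [|g' cg rg] := ex i; first by lia.
  rewrite (theta_W K n1 a0 la eE iE) (theta_N K n1 a0 la eE iE) (theta_SE K n1 a0 la eE iE).
  rewrite (theta_E K n1 a0 la eE iE) (theta_S K n1 a0 la eE iE) (theta_NW K n1 a0 la eE iE).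
  by rewrite (fvT K eE iE); exists g'.
- have [p pE] : exists p, p = (b * q - a)%N by exists (b * q - a)%N.
  (* Equality would mean [b = k] and [a = 0], which is a frozen vertex. *)
  have pN : (p < N)%N.
    rewrite ltn_neqAle pE phi_le // andbT; apply/eqP => h.
    have : (b = k /\ a = 0)%N.
      have [lbk|] := ltnP b k.
        by have := leq_mul2r q b.+1 k; rewrite lbk orbT mulSn; move: h; rewrite NCG_E; lia.
      move=> kb; have bE : b = k by lia.
      by move: h (coord_pos b0 la); rewrite NCG_E bE; lia.
    by case=> bE a0; move: e1 e2; rewrite eE bE a0; case: (boolP (odd n)) => [/ko|/ke]; lia.
  have [ex _] := phi_chain; have [|g' cg rg] := ex p; first by rewrite pN pE coord_pos.
  rewrite (phi_W K n1 la b0 bk eE pE pN) (phi_N K n1 la b0 bk eE pE pN e2) (phi_SE K n1 la b0 bk eE pE pN).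
  rewrite (phi_E K n1 la b0 bk eE pE pN) (phi_S K n1 la b0 bk eE pE pN) (phi_NW K n1 la b0 bk eE pE pN).
  by rewrite (fvF K n1 eE _ pE) ?b0 //; exists g'.
have [p pE] : exists p, p = (b * q - a)%N by exists (b * q - a)%N.
have pM : (p < M)%N.
  rewrite ltn_neqAle pE psi_le // andbT; apply/eqP => h.
  have [c cE c2] : exists2 c, M = (c * q)%N & (b <= c /\ c.*2 = n \/ b <= c /\ c.*2 = n.-1)%N.
    rewrite (MCG_E n1); case: ifP => [/ko|/negbT /ke] k2'; [exists k.-1|exists k] => //; lia.
  have : (b = c /\ a = 0)%N.
    have [lbk|] := ltnP b c.
      by have := leq_mul2r q b.+1 c; rewrite lbk orbT mulSn; move: h; rewrite cE; lia.
    move=> kb; have bE : b = c by lia.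
    by move: h (coord_pos b0 la); rewrite cE bE; lia.
  by case=> bE a0; move: e1 e2; rewrite eE bE a0; lia.
have [ex _] := psi_chain; have [|g' cg rg] := ex p; first by rewrite pM pE coord_pos.
rewrite (psi_W K n1 la b0 bn eE pE pM) (psi_N K n1 la b0 bn eE pE pM e1 e2) (psi_SE K n1 la b0 bn eE pE pM).
rewrite (psi_E K n1 la b0 bn eE pE pM e1) (psi_S K n1 la b0 bn eE pE pM) (psi_NW K n1 la b0 bn eE pE pM).
by rewrite (fvP K n1 eE b0 bn pE); exists g'.
Qed.

End CGChains.

(** * A positive point of determinant 1 *)

Lemma poly_eventually_pos (F : realFieldType) (p : {poly F}) : 0 < lead_coef p ->
  exists d T, [/\ 0 < d, 0 < T & forall t, T <= t -> d <= p.[t]].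
Proof.
elim/poly_ind: p => [|p c IH]; first by rewrite lead_coef0 ltxx.
have [->|p0] := eqVneq p 0.
  rewrite mul0r add0r lead_coefC => c0; exists c, 1; split=> // t _.
  by rewrite hornerC.
have szp : (size (c%:P) < size (p * 'X)%R)%N.
  by rewrite size_mulX // ltnS (leq_trans (size_polyC_leq1 _)) // size_poly_gt0.
rewrite lead_coefDl // lead_coefMX => /IH[d [T [d0 T0 hT]]].
(* The uniform bound [d] on the previous polynomial lets its product with [t] exceed the constant
   [c] by at least 1 once [t] is at least [(1 + |c|) / d]. *)
have hs : 0 <= (1 + `|c|) / d by rewrite divr_ge0 ?addr_ge0 // ltW.
exists 1, (T + (1 + `|c|) / d); split=> //; first by rewrite ltr_pwDl.
move=> t ht; rewrite hornerD hornerMX hornerC.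
have h1 : d <= p.[t] by apply: hT; apply: le_trans ht; rewrite lerDl.
have h2 : (1 + `|c|) / d <= t by apply: le_trans ht; rewrite lerDr ltW.
have t0 : 0 <= t by apply: le_trans h2.
have h3 : d * ((1 + `|c|) / d) <= p.[t] * t by apply: ler_pM => //; apply: ltW.
have h4 : d * ((1 + `|c|) / d) = 1 + `|c| by rewrite mulrCA mulfV ?mulr1 // gt_eqF.
have h5 : - c <= `|c| by rewrite -normrN ler_norm.
by rewrite h4 in h3; lra.
Qed.

Section Values.
Variable n : nat.
Hypothesis n1 : (1 < n)%N.

(** The minors over an arbitrary ring, so that one integer point can be read over the rationals and
    over [K]. *)
Definition cgval (S : comNzRingType) (z : nat -> S) (f : cgidx) : S :=
  let u r c p := \det (\matrix_(a < p, b < p)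
    if Uidx n (r + a) (c + b) is Some e then z e else 0) in
  match f with
  | Theta i => \det (\matrix_(a < i, b < i) z ((n - i + a) * n + (n - i + b))%N)
  | Phi p => u (NCG n - p)%N (kCG n * n.+1 - p)%N p
  | Psi p => u (NCG n - p)%N (kCG n * n.+1 - p + 1)%N p
  end.

Definition cgsize f := match f with Theta i => i | Phi p => p | Psi p => p end.

Lemma cgval_map (S S' : comNzRingType) (h : {rmorphism S -> S'}) z f :
  h (cgval z f) = cgval (fun e => h (z e)) f.
Proof.
by case: f => p; rewrite /= -det_map_mx; congr (\det _); apply/matrixP => a b;
  rewrite !mxE //; case: (Uidx _ _ _) => [e|] //; rewrite rmorph0.
Qed.

Lemma cgval_scale (S : comNzRingType) (c : S) z f :
  cgval (fun e => c * z e) f = c ^+ cgsize f * cgval z f.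
Proof.
by case: f => p; rewrite /= -detZ; congr (\det _); apply/matrixP => a b;
  rewrite !mxE //; case: (Uidx _ _ _) => [e|] //; rewrite mulr0.
Qed.

Lemma cgfunE (K : fieldType) f : cgfun K n f = cgval (mvar K (n * n)) f.
Proof.
by case: f => p //; rewrite /= /minorU; congr (\det _); apply/matrixP => a b; rewrite !mxE UentE.
Qed.

Lemma mvar_ge (K : fieldType) m i : (m <= i)%N -> mvar K m i = 0.
Proof.
elim: m => // m IH lim; rewrite /= gtn_eqF //.
by rewrite IH ?polyC0 // ltnW.
Qed.

Lemma mhom_cgfun (K : fieldType) (S : comNzRingType) (c : {rmorphism K -> S}) z f :
  (forall e, (n * n <= e)%N -> z e = 0) -> mhom c z (n * n) (cgfun K n f) = cgval z f.
Proof.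
move=> hz; rewrite cgfunE cgval_map; congr cgval; apply: functional_extensionality => e.
have [h|h] := ltnP e (n * n); first by rewrite mhom_var.
by rewrite mvar_ge // rmorph0 hz.
Qed.

Lemma mhom_wgr (K : fieldType) (w : nat -> nat) (t : K) m (f : mpoly K m) :
  mhom idfun (fun e => t ^+ w e) m f = (map_poly (mhom idfun (fun=> 1) m) (wgr K m w f)).[t].
Proof.
elim/mpoly_ind: f => [a|i lim|p r hp hr|p r hp hr].
- by rewrite mhom_const wgr_const map_polyC hornerC /= mhom_const.
- rewrite mhom_var // wgr_var // rmorphM /= map_polyC map_polyXn /= mhom_var //.
  by rewrite hornerM hornerC hornerXn mul1r.
- by rewrite !rmorphD hornerD hp hr.
- by rewrite !rmorphM hornerM hp hr.
Qed.

(** Along the curve [y_e = t^(w e)] the function is a polynomial in [t]; its leading coefficient is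
    the leading monomial at all ones, which is 1. *)
Lemma lead_in_eventually_pos (P : pred nat) (f : mpoly rat (n * n)) : lead_in (wU n) P f ->
  exists T : nat, forall t : nat, (T <= t)%N -> 0 < mhom idfun (fun e => t%:R ^+ wU n e) (n * n) f.
Proof.
case=> l [lf hl]; pose h := mhom (K := rat) idfun (fun=> 1) (n * n).
have h1 : h (lform (wU n) f) = 1.
  rewrite lf rmorph_prod /=; elim: l hl {lf} => [_|e l IH /= /andP[/andP[le _] hl]].
    by rewrite big_nil.
  by rewrite big_cons IH // mulr1 mhom_var.
have [|d [T [d0 T0 hT]]] := @poly_eventually_pos _ (map_poly h (wgr rat (n * n) (wU n) f)).
  rewrite lead_coef_map_eq; first by apply: lt_le_trans ltr01 _; rewrite -h1.
  by apply: contra_eq_neq h1 => h0; rewrite [X in X == _]h0 eq_sym oner_eq0.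
exists (Num.bound T) => t ht; rewrite mhom_wgr; apply: lt_le_trans d0 (hT _ _).
apply: ltW; apply: lt_le_trans (archi_boundP (ltW T0)) _.
by rewrite ler_nat.
Qed.

(** The threshold [T] is found over the rationals, since [K] need not be archimedean, and the point
    is then transferred through the integers. *)
Lemma positive_point (K : numClosedFieldType) : exists z : nat -> K,
  (forall e, (e < n * n)%N -> 0 < mhom idfun z (n * n) (fv K n e)) /\
  mhom idfun z (n * n) (cgfun K n (Theta n)) = 1.
Proof.
have [T hT] : exists T : nat, forall e, (e < n * n)%N ->
    0 < mhom (K := rat) idfun (fun e => T%:R ^+ wU n e) (n * n) (fv rat n e).
  have : forall m, (m <= n * n)%N -> exists T : nat, forall t, (T <= t)%N -> forall e, (e < m)%N ->
      0 < mhom (K := rat) idfun (fun e => t%:R ^+ wU n e) (n * n) (fv rat n e).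
    elim=> [_|m IH lm]; first by exists 0%N.
    have [T1 h1] := IH (ltnW lm); have [T2 h2] := lead_in_eventually_pos (fv_lead rat n1 lm).
    exists (maxn T1 T2) => t; rewrite geq_max => /andP[t1 t2] e.
    by rewrite ltnS leq_eqVlt => /predU1P[->|le]; [apply: h2|apply: h1].
  by case/(_ _ (leqnn _)) => T hT; exists T => e; apply: hT.
pose zi e : int := if (e < n * n)%N then (T ^ wU n e)%N%:Z else 0.
pose z0 e : K := (zi e)%:~R.
have zi_pos e : (e < n * n)%N -> 0 < cgval zi (idxCG n e).
  move=> le; have := hT e le; rewrite -(ltr0z rat) (cgval_map intr).
  rewrite -(@mhom_cgfun rat _ idfun); last first.
    by move=> t ht; rewrite /zi ltnNge ht.
  congr (0 < _); apply: mhom_eq => [a|i li]; first by rewrite !mhom_const.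
  by rewrite !mhom_var // /zi li -natrX.
have z0_ge e : (n * n <= e)%N -> z0 e = 0 by move=> h; rewrite /z0 /zi ltnNge h.
have z0_pos e : (e < n * n)%N -> 0 < cgval z0 (idxCG n e).
  by move=> /zi_pos; rewrite -(ltr0z K) (cgval_map intr).
have d0 : 0 < cgval z0 (Theta n).
  have := z0_pos 0%N; rewrite -[0%N](mul0n n.+1) idx_theta subn0; apply.
  by rewrite muln_gt0; lia.
(* The determinant is homogeneous of degree [n], so this factor normalizes it to 1; the other
   functions are multiplied by positive powers of [c]. *)
pose c := (n.-root (cgval z0 (Theta n)))^-1.
have n0 : (0 < n)%N by lia.
have c0 : 0 < c by rewrite invr_gt0 rootC_gt0.
have z_ge e : (n * n <= e)%N -> c * z0 e = 0 by move=> /z0_ge ->; rewrite mulr0.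
exists (fun e => c * z0 e); split=> [e le|].
  by rewrite /fv mhom_cgfun // cgval_scale pmulr_rgt0 ?exprn_gt0 ?z0_pos.
by rewrite mhom_cgfun // cgval_scale /c exprVn rootCK // mulVf // gt_eqF.
Qed.

End Values.

(** * Regularity on matrices and on the special linear group *)

Section MatRegular.
Variables (K : numFieldType) (n : nat).
Hypothesis n1 : (1 < n)%N.
Local Notation fv := (fv K n).
Local Notation k := (kCG n).

Lemma x0MatE (v : vtx n) : x0Mat K v = (fv (vidx v))%:F.
Proof.
by rewrite /x0Mat -{1}(vidx_div n1 v) -{1}(vidx_mod v) (fun_atE n1 (vidx_lt n1 v)).
Qed.

Lemma BMat_skew : skewB (@BMat n).
Proof. by move=> u v; rewrite /BMat opprB. Qed.

Lemma place_vertex e (i j : 'I_n) : (e < n * n)%N -> (place n (idxCG n e) == Some (i : nat, j : nat)) = (e == i * n + j)%N.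
Proof.
move=> le; have [_ ->] := idxCG_in n1 le; rewrite /vx; apply/eqP/eqP => [[h1 h2]|->].
  by rewrite -h1 -h2 -divn_eq.
by rewrite divnMDl ?modnMDl ?divn_small ?modn_small ?addn0 //; lia.
Qed.

(** The largest phi and psi minors sit at positions [n] and [n - 1] for odd [n], and the other way
    round for even [n]. *)
Lemma frozenMatE (i j : 'I_n) : frozenMat n i j = frozen3 n i j.
Proof.
have k0 := kCG_gt0 n1; have q0 : (0 < n.-1)%N by lia.
have nn : (n + n <= n * n)%N by have := leq_mul2r n 2 n; rewrite n1 orbT; lia.
have li := ltn_ord i; have lj := ltn_ord j.
have rowE : ((n == i * n + j) = (i == 1 :> nat) && (j == 0 :> nat))%N.
  case: (nat_of_ord i) => [|[|i']]; apply/idP/idP; lia.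
have colE : ((n.-1 == i * n + j) = (i == 0 :> nat) && (j == n.-1 :> nat))%N.
  case: (nat_of_ord i) => [|i']; apply/idP/idP; lia.
have e0 : (place n (Theta n) == Some (i : nat, j : nat)) = (i == 0 :> nat) && (j == 0 :> nat).
  by rewrite /= subnn; apply/eqP/andP => [[<- <-]|[/eqP -> /eqP ->]].
rewrite /frozenMat /frozen3 e0; congr (_ || _).
have k2 := kCG_le n1.
have eF : idxCG n (k.*2.-1) = Phi (NCG n).
  by have := idx_phi n1 0 k0 (leqnn k); rewrite mul0n add0n subn0.
have [o|o] := boolP (odd n).
  have kE := kCG_odd n1 o.
  have MP : (0 < MCG n)%N by rewrite (MCG_E n1) o muln_gt0 q0 andbT; lia.
  have eP : idxCG n n.-1 = Psi (MCG n).
    have h : (k.-1.*2 = n.-1)%N by lia.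
    have [h1 h2] : (0 < k.-1 /\ k.-1.*2 <= n)%N by lia.
    by have := idx_psi n1 0 h1 h2; rewrite mul0n add0n subn0 h (MCG_E n1) o.
  have nE : k.*2.-1 = n by lia.
  rewrite MP -eF -eP nE (place_vertex i j (e := n)); last by lia.
  by rewrite place_vertex ?rowE ?colE 1?orbC //; lia.
have kE := kCG_even n1 o.
have MP : (0 < MCG n)%N by rewrite (MCG_E n1) (negbTE o) muln_gt0 q0 andbT.
have eP : idxCG n n = Psi (MCG n).
  have h1 : (k.*2 <= n)%N by lia.
  by have := idx_psi n1 0 k0 h1; rewrite mul0n add0n subn0 kE (MCG_E n1) (negbTE o).
rewrite MP -eF -eP kE (place_vertex i j (e := n)); last by lia.
by rewrite place_vertex ?rowE ?colE //; lia.
Qed.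

(** Positivity of [P] at [eps] is recorded for SL_n, where it shows that no cluster variable
    restricts to zero. *)
Theorem Mat_regular (eps : {rmorphism RCG K n -> K}) s (v : vtx n) :
  (forall e, (e < n * n)%N -> 0 < eps (fv e)) ->
  all (fun v : vtx n => ~~ frozen3 n v.1 v.2) s ->
  exists P, (mutseq (seedMat K n) s).2 v = P%:F /\ 0 < eps P.
Proof.
move=> hpos hs; pose mut (v : vtx n) := ~~ frozen3 n v.1 v.2.
have ex u : exists g', mut u -> cop (fv (vidx u)) g' /\
    fv (vidx u) * g' = \prod_t fv (vidx t) ^+ pe (BMat u t) + \prod_t fv (vidx t) ^+ pe (- BMat u t).
  case: (boolP (mut u)) => mu; last by exists 0.
  have [|g' cg eg] := @fv_exchange K n n1 (vidx u); first by rewrite mobileE.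
  by exists g' => _; have [-> ->] := exchange_products n1 fv mu.
have [f' hf'] := fin_all_exists ex.
have -> : seedMat K n = (@BMat n, fun v => (fv (vidx v))%:F).
  by congr pair; apply: functional_extensionality => u; rewrite x0MatE.
apply: (starfish (mconst_rmorphism K (n * n)) (f' := f') BMat_skew (mut := mut)) => //.
- by move=> i; apply: hpos; apply: vidx_lt.
- by move=> i /hf'[].
- by move=> i j _ _ ij; apply: fv_cop; rewrite ?vidx_lt // (inj_eq (@vidx_inj n n1)).
- by move=> i /hf'[].
Qed.

End MatRegular.

Lemma det_row0 (S : comNzRingType) (F : nat -> nat -> S) n : (0 < n)%N ->
  \det (\matrix_(a < n, b < n) F a b) =
  \sum_(j < n) F 0%N j * ((-1) ^+ j * \det (\matrix_(a < n.-1, b < n.-1) F a.+1 (bump j b))).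
Proof.
case: n => // n _; rewrite (expand_det_row _ ord0); apply: eq_bigr => j _; rewrite mxE.
congr (_ * _); rewrite /cofactor /= add0n; congr (_ * \det _).
by apply/matrixP => a b; rewrite !mxE.
Qed.

(** * Restriction to determinant 1 *)

Section SL.
Variables (K : numClosedFieldType) (n : nat).
Hypothesis n1 : (1 < n)%N.
Local Notation R := (RCG K n).
Local Notation m := (n * n)%N.
Local Notation fv := (fv K n).
Local Notation x := (xg K n).
Local Notation th i := (cgfun K n (Theta i)).
Local Notation cof := (cof0 K n).

Definition sigma_const : {rmorphism K -> {fraction R}} := (@tofrac R \o mconst_rmorphism K m).

Definition sigma : {rmorphism R -> {fraction R}} :=
  mhom sigma_const (fun i => if i == 0%N then sub11 K n else (mvar K m i)%:F) m.

Lemma sigmaE p : sigmaSL p = sigma p.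
Proof.
have cE : (fun a => (mconst m a)%:F) = (sigma_const : K -> {fraction R}).
  by apply: functional_extensionality => a; rewrite /= mconst_rmorphismE.
by rewrite /sigmaSL cE; apply: meval_mhom.
Qed.

Let n0 : (0 < n)%N. Proof. by lia. Qed.
Let m0 : (0 < m)%N. Proof. by rewrite muln_gt0 n0. Qed.

Lemma sigma_var i : (0 < i)%N -> sigma (mvar K m i) = (mvar K m i)%:F.
Proof.
move=> i0; have [li|li] := ltnP i m; last by rewrite mvar_ge // !rmorph0.
by rewrite /sigma mhom_var // gtn_eqF.
Qed.

Lemma sigma_var0 : sigma (mvar K m 0) = sub11 K n.
Proof. by rewrite /sigma mhom_var. Qed.

(** Cofactors of the first row contain no entry of that row, so the substitution for [x_11] leaves
    them unchanged. *)
Lemma sigma_cof j : sigma (cof j) = (cof j)%:F.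
Proof.
rewrite /cof0 !rmorphM !rmorphXn !rmorphN !rmorph1 -!det_map_mx; congr (_ * \det _).
apply/matrixP => a b; rewrite !mxE sigma_var // mulSn addn_gt0 addn_gt0 n0.
by [].
Qed.

Lemma theta_n_cof : th n = x 0 0 * cof 0 + \sum_(1 <= j < n) x 0 j * cof j.
Proof.
have -> : x 0 0 * cof 0 + \sum_(1 <= j < n) x 0 j * cof j = \sum_(0 <= j < n) x 0 j * cof j.
  by rewrite -big_ltn.
rewrite big_mkord -(@det_row0 _ (fun a b => x a b) n n0) /cgfun subnn.
by congr (\det _); apply/matrixP => a b; rewrite !mxE !add0n.
Qed.

Lemma big_vtxSL (F : vtx n -> {fraction R}) (o : vtx n) : (o.1 : nat, o.2 : nat) = (0, 0)%N ->
  \prod_u F u = F o * \prod_(u : vtxSL n) F (val u).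
Proof.
move=> oE; rewrite (bigD1 o) //=; congr (_ * _).
pose A := [pred v : vtx n | (nat_of_ord v.1, nat_of_ord v.2) != (0, 0)%N].
transitivity (\prod_(u in A) F u); last exact: (@big_sub _ _ _ _ A F).
apply: eq_bigl => u; rewrite inE; congr (~~ _); case: o oE => i j [i0 j0]; case: u => a b /=.
by rewrite !xpair_eqE -!val_eqE /= i0 j0.
Qed.

Lemma cof0E : cof 0 = th n.-1.
Proof.
rewrite /cof0 expr0 mul1r /cgfun; congr (\det _); apply/matrixP => a b; rewrite !mxE.
by congr (x _ _); rewrite /bump /=; lia.
Qed.

Variable z : nat -> K.
Local Notation eps := (mhom (idfun : {rmorphism K -> K}) z m).
Hypothesis z_pos : forall e, (e < m)%N -> 0 < eps (fv e).
Hypothesis z_det : eps (th n) = 1.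

Lemma cof_pos : 0 < eps (cof 0).
Proof.
rewrite cof0E; have := z_pos (e := n.+1); rewrite (@fvT K n _ 1 n.-1) ?mul1n ?subn1 //; apply.
by have := leq_mul2r n 2 n; rewrite n1 orbT; have := leq_mul2l n 2 n; lia.
Qed.

Lemma cof_neq0 : (cof 0)%:F != 0.
Proof.
by rewrite tofrac_eq0; apply: contraTneq cof_pos => ->; rewrite rmorph0 ltxx.
Qed.

Lemma sub11_cof : sub11 K n * (cof 0)%:F = (1 - \sum_(1 <= j < n) x 0 j * cof j)%:F.
Proof.
rewrite /sub11 divfK ?cof_neq0 // rmorphB rmorph1 rmorph_sum; congr (_ - _).
by apply: eq_bigr => j _; rewrite [RHS]rmorphM.
Qed.

Lemma sigma_theta_n : sigma (th n) = 1.
Proof.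
rewrite theta_n_cof rmorphD rmorphM /x mul0n add0n sigma_var0 sigma_cof sub11_cof.
rewrite (_ : sigma (\sum_(1 <= j < n) x 0 j * cof j) = (\sum_(1 <= j < n) x 0 j * cof j)%:F).
  by rewrite rmorphB rmorph1 subrK.
rewrite !rmorph_sum; apply: eq_big_nat => j /andP[j0 _].
rewrite [LHS]rmorphM [RHS]rmorphM sigma_cof; congr (_ * _).
by apply: sigma_var; rewrite mul0n.
Qed.

(** The substitution has only powers of [cof 0] as denominators, and at a point of determinant 1 it
    reproduces the value of [x_11]; hence evaluation there is compatible with it. *)
Lemma sigma_clear P : exists d Q, sigma P * (cof 0)%:F ^+ d = Q%:F /\ eps Q = eps P * eps (cof 0) ^+ d.
Proof.
elim/mpoly_ind: P => [a|i li|P P' [d [Q [e h]]] [d' [Q' [e' h']]]|P P' [d [Q [e h]]] [d' [Q' [e' h']]]].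
- exists 0%N, (mconst m a); rewrite !expr0 !mulr1; split=> //.
  by rewrite /sigma mhom_const /= mconst_rmorphismE.
- have [->|i0] := posnP i; last by exists 0%N, (mvar K m i); rewrite !expr0 !mulr1 sigma_var.
  exists 1%N, (1 - \sum_(1 <= j < n) x 0 j * cof j); rewrite !expr1 sigma_var0 sub11_cof; split=> //.
  rewrite rmorphB rmorph1 -z_det theta_n_cof rmorphD addrK rmorphM; congr (_ * _).
- move: (cof 0) e e' h h' => c e e' h h'.
  exists (d + d')%N, (Q * c ^+ d' + Q' * c ^+ d); split.
    by rewrite (rmorphD sigma) tofracD !tofracM !tofracXn -e -e' !exprD; move: (_%:F ^+ d) (_%:F ^+ d') => u v; ring.
  by rewrite !(rmorphD eps) !(rmorphM eps) !(rmorphXn eps) h h' !exprD; move: (_ ^+ d) (_ ^+ d') => u v; ring.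
move: (cof 0) e e' h h' => c e e' h h'.
exists (d + d')%N, (Q * Q'); rewrite (rmorphM sigma) tofracM !(rmorphM eps) -e -e' h h' !exprD; split.
  by move: (_%:F ^+ d) (_%:F ^+ d') => u v; ring.
by move: (_ ^+ d) (_ ^+ d') => u v; ring.
Qed.

Lemma sigma_neq0 P : 0 < eps P -> sigma P != 0.
Proof.
move=> hP; have [d [Q [e h]]] := sigma_clear P; apply: contraTneq hP => s0.
move: e; rewrite s0 mul0r => /esym /eqP; rewrite tofrac_eq0 => /eqP Q0.
have c0 : eps (cof 0) ^+ d != 0 by rewrite expf_neq0 // gt_eqF ?cof_pos.
by move/esym/eqP: h; rewrite Q0 rmorph0 mulf_eq0 (negPf c0) orbF => /eqP ->; rewrite ltxx.
Qed.

End SL.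

Lemma tofrac_inj (R : idomainType) (p r : R) : p%:F = r%:F -> p = r.
Proof. by move=> /eqP; rewrite tofrac_eq => /eqP. Qed.

Section SLSeeds.
Variables (K : numClosedFieldType) (n : nat).
Hypothesis n1 : (1 < n)%N.
Local Notation m := (n * n)%N.
Local Notation th i := (cgfun K n (Theta i)).
Local Notation sigma := (sigma K n).
Variable z : nat -> K.
Local Notation eps := (mhom (idfun : {rmorphism K -> K}) z m).
Hypothesis z_pos : forall e, (e < m)%N -> 0 < eps (fv K n e).
Hypothesis z_det : eps (th n) = 1.

Let n0 : (0 < n)%N. Proof. by lia. Qed.
Let o : vtx n := (Ordinal n0, Ordinal n0).

Let mutSL (v : vtxSL n) := ~~ frozenSL n (val v).1 (val v).2.

Let mutMat (v : vtxSL n) : mutSL v -> ~~ frozen3 n (val v).1 (val v).2.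
Proof.
move=> mv; rewrite -(frozenMatE n1).
rewrite -[frozenMat _ _ _]/((place n (Theta n) == _) || frozenSL n _ _) negb_or.
rewrite [~~ frozenSL _ _ _]mv andbT.
by apply: contraNneq (valP v); rewrite /= subnn => -[<- <-].
Qed.

Let mutMats s : all mutSL s -> all (fun v : vtx n => ~~ frozen3 n v.1 v.2) (map val s).
Proof. by move=> h; rewrite all_map; apply: sub_all h => v; apply: mutMat. Qed.

Let mat (s : seq (vtxSL n)) := mutseq (seedMat K n) (map val s).

Let mat_spec s (v : vtx n) : all mutSL s -> exists P, (mat s).2 v = P%:F /\ 0 < eps P.
Proof. by move=> h; apply: Mat_regular (mutMats h). Qed.

Let mat_o s : all mutSL s -> (mat s).2 o = (th n)%:F.
Proof.
elim/last_ind: s => [_|s k IH]; first by rewrite [LHS](x0MatE K n1) (@fvT K n _ 0 n) ?subn0.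
rewrite all_rcons => /andP[mk ms]; rewrite /mat map_rcons mutseq_rcons /= mutxE.
case: eqP => [h|_]; last exact: IH.
by move: (valP k); have -> : \val k = o by []; rewrite eqxx.
Qed.

(** Induction on the last mutation. The division commutes with [sigma] because the variable divided
    by is positive at the chosen point and so restricts to a nonzero element. *)
Lemma SL_restriction s : all mutSL s ->
  (forall u v, (mutseq (seedSL K n) s).1 u v = (mat s).1 (val u) (val v)) /\
  (forall v P, (mat s).2 (val v) = P%:F -> (mutseq (seedSL K n) s).2 v = sigma P).
Proof.
elim/last_ind: s => [_|s k IH].
  split=> // v P; rewrite /mat /= x0MatE // => /tofrac_inj <-.
  by rewrite /x0SL -{1}(vidx_div n1 (val v)) -{1}(vidx_mod (val v)) (fun_atE n1 (vidx_lt n1 _)) sigmaE.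
rewrite all_rcons => /andP[mk ms]; have [IHB IHx] := IH ms.
have mks : all mutSL (rcons s k) by rewrite all_rcons mk.
have spec := fun v => mat_spec v ms.
have spec' := fun v => mat_spec v mks.
have mo := mat_o ms; move: spec spec' mo IHB IHx.
rewrite /mat map_rcons !mutseq_rcons -/(mat s).
move: (mat s) (mutseq (seedSL K n) s) => [B x] [B' x'] /= spec spec' xo IHB IHx; split=> [u v|v P].
  by rewrite /mutB !IHB !(inj_eq val_inj).
rewrite !mutxE (inj_eq val_inj); case: eqP => [_|_]; last exact: IHx.
have [p hp] := fin_all_exists spec.
have xE u : x u = (p u)%:F by case: (hp u).
have p0 u : p u != 0.
  by have [_] := hp u; apply: contraTneq => ->; rewrite rmorph0 ltxx.
have x'E u : x' u = sigma (p (val u)) by apply: IHx; rewrite xE.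
have sp0 : sigma (p (val k)) != 0 by apply: (sigma_neq0 n1 z_pos z_det); case: (hp (val k)).
have po : p o = th n by apply: tofrac_inj; rewrite -xE.
have prodE (f : int -> nat) :
    \prod_u x u ^+ f (B (val k) u) = (\prod_u p u ^+ f (B (val k) u))%:F.
  by rewrite rmorph_prod; apply: eq_bigr => u _; rewrite xE rmorphXn.
have prodE' (f : int -> nat) :
    \prod_u x' u ^+ f (B' k u) = sigma (\prod_u p u ^+ f (B (val k) u)).
  (* The deleted vertex always carries [th n], whose restriction is 1, so it may be dropped from the
     exchange products. *)
  rewrite rmorph_prod (big_vtxSL _ (o := o)) // rmorphXn po (sigma_theta_n n1 z_pos) // expr1n mul1r.
  by apply: eq_bigr => u _; rewrite x'E IHB rmorphXn.
move=> e; rewrite /exch (prodE' pe) (prodE' (fun i => pe (- i))) -rmorphD x'E.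
apply: (mulIf sp0); rewrite divfK // -rmorphM; congr (sigma _).
apply: tofrac_inj; rewrite tofracM -e -xE divfK ?xE ?tofrac_eq0 //.
by rewrite /exch (prodE pe) (prodE (fun i => pe (- i))) -tofracD.
Qed.

Lemma SL_regular s v : all mutSL s -> exists P, (mutseq (seedSL K n) s).2 v = sigmaSL P.
Proof.
move=> ms; have [P [e _]] := mat_spec (val v) ms.
by exists P; rewrite sigmaE; apply: (SL_restriction ms).2.
Qed.

End SLSeeds.

Theorem theorem5 (K : numClosedFieldType) (n : nat) :
  (forall (s : seq (vtx n)), all (fun v : vtx n => ~~ frozenMat n v.1 v.2) s ->
     forall v : vtx n, exists P : RCG K n,
       (mutseq (seedMat K n) s).2 v = P%:F)
  /\
  (forall (s : seq (vtxSL n)), all (fun v : vtxSL n => ~~ frozenSL n (val v).1 (val v).2) s ->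
     forall v : vtxSL n, exists P : RCG K n,
       (mutseq (seedSL K n) s).2 v = sigmaSL P).
Proof.
(* For [n <= 1] there is at most one vertex, which is frozen, and on SL_n there is none. *)
have [n1|n1] := ltnP 1 n; last first.
  have zero (i : 'I_n) : i = 0%N :> nat by have := ltn_ord i; lia.
  split=> [s ms v|s _ v]; last by have := valP v; rewrite /= !zero.
  case: s ms => [_|u s] /=; last first.
    by case/andP; rewrite /frozenMat /= subnn !zero.
  rewrite /x0Mat; case: fun_at => [f|]; first by exists (cgfun K n f).
  by exists 0; rewrite rmorph0.
have [z [z_pos z_det]] := positive_point n1 K.
split=> s ms v; last exact: (SL_regular n1 z_pos z_det).
have [|P [e _]] := @Mat_regular K n n1 _ s v z_pos; last by exists P.
by apply: sub_all ms => u; rewrite frozenMatE.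
Qed.
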